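(* Fix $d\ge1$ and let $N=dp_N$ with $p_N\to\infty$. Let $\mathbb{C}^N=\bigoplus_{k=1}^{p_N}V_N^{(k)}$ be an orthogonal decomposition into subspaces of dimension $d$ with orthonormal bases $\mathbf{v}_N^{(k)}$ of $V_N^{(k)}$, inducing the identification $\mathcal{M}_N(\mathbb{C})\cong\mathcal{M}_{p_N}(\mathbb{C})\otimes\mathcal{M}_d(\mathbb{C})$. Let $\mathbf{A}_N=\{A_N^k:k\in K\}$ and $\mathbf{B}_N=\{B_N^k:k\in K\}$ be two ensembles of $N\times N$ independent matrices bounded in operator norm (uniformly in $N$). Let $U_N$ be a Haar unitary matrix of dimensions $p_N\times p_N$ leaving the first vector $\varepsilon_1$ of the canonical basis of $\mathbb{C}^{p_N}$ invariant, that is, $U_N$ acts as the identity on $\varepsilon_1$ and as a Haar unitary $\tilde V_N\in U(p_N-1)$ on the orthogonal complement of $\varepsilon_1$. Then, as $N$ tends to infinity, and almost surely, $$\varphi^{\mathbf{v}_N^{(1)}}\big[P(\mathbf{A}_N,U_N\cdot\mathbf{B}_N\cdot U_N^\star)\big]=\Big(\varphi^{\mathbf{v}_N^{(1)}}_{\mathbf{A}_N}\,{}_{\psi^{\mathbf{v}_N}_{\mathbf{A}_N}}\!*_{\psi^{\mathbf{v}_N}_{\mathbf{B}_N}}\,\varphi^{\mathbf{v}_N^{(1)}}_{\mathbf{B}_N}\Big)(P)+O(p_N^{-1})$$ for any polynomial $P\in\mathcal{M}_d(\mathbb{C})\langle X_k,Y_k:k\in K\rangle$.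
   Context: Under the identification, a matrix $M\in\mathcal{M}_N(\mathbb{C})$ is a $p_N\times p_N$ matrix with blocks $M(i,j)\in\mathcal{M}_d(\mathbb{C})$ ($M(i,j)$ is the matrix of the component $V_N^{(j)}\to V_N^{(i)}$ in the chosen bases). For $m,n\in\mathcal{M}_d(\mathbb{C})$, $m\cdot M\cdot n=(I_{p_N}\otimes m)M(I_{p_N}\otimes n)$; for $U\in\mathcal{M}_{p_N}(\mathbb{C})$, $U\cdot M\cdot U^\star=(U\otimes I_d)M(U^\star\otimes I_d)$, and $U\cdot\mathbf{B}\cdot U^\star=\{U\cdot B^k\cdot U^\star:k\in K\}$. For a random matrix $M$ of size $N$: $\varphi^{\mathbf{v}_N^{(1)}}(M)=\mathbb{E}[M(1,1)]\in\mathcal{M}_d(\mathbb{C})$ and $\psi^{\mathbf{v}_N}(M)=\mathbb{E}\big[\frac1{p_N}\sum_{k=1}^{p_N}M(k,k)\big]\in\mathcal{M}_d(\mathbb{C})$. $\mathcal{M}_d(\mathbb{C})\langle X_k,Y_k\rangle$ is the algebra of polynomials in noncommuting indeterminates with coefficients in $\mathcal{M}_d(\mathbb{C})$ (not commuting with the indeterminates); on evaluation a coefficient $m$ becomes $I_{p_N}\otimes m$. For $P\in\mathcal{M}_d(\mathbb{C})\langle X_k\rangle$, $\varphi^{\mathbf{v}_N^{(1)}}_{\mathbf{A}_N}(P)=\varphi^{\mathbf{v}_N^{(1)}}(P(\mathbf{A}_N))$ and $\psi^{\mathbf{v}_N}_{\mathbf{A}_N}(P)=\psi^{\mathbf{v}_N}(P(\mathbf{A}_N))$,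 and similarly for $\mathbf{B}_N$ on $\mathcal{M}_d(\mathbb{C})\langle Y_k\rangle$. Operator-valued conditionally free product: for unital $\mathcal{B}$-bimodule maps $\psi_1,\varphi_1$ on $\mathcal{B}\langle X_k\rangle$ and $\psi_2,\varphi_2$ on $\mathcal{B}\langle Y_k\rangle$ with values in $\mathcal{B}=\mathcal{M}_d(\mathbb{C})$, $\psi_1*\psi_2$ is the unique $\mathcal{B}$-bimodule map on $\mathcal{B}\langle X_k,Y_k\rangle$ extending $\psi_1,\psi_2$ and vanishing on products $P_1\cdots P_n$ whose factors alternate between $\mathcal{B}\langle X_k\rangle$ and $\mathcal{B}\langle Y_k\rangle$ and are each centered (mapped to $0$ by $\psi_1$ or $\psi_2$); $\varphi_1\,{}_{\psi_1}\!*_{\psi_2}\,\varphi_2$ is the unique $\mathcal{B}$-bimodule map $\varphi$ extending $\varphi_1,\varphi_2$ with $\varphi(P_1\cdots P_n)=\varphi(P_1)\cdots\varphi(P_n)$ for all such alternating centered products.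
   Formalization: The expectations in φ and ψ are taken over the Haar unitary only, given the realisation of A_N, B_N (to which ''almost surely'' refers); with the full expectation the claim fails, e.g. A_N=aI, B_N=bI with a, b independent uniform on {0,1}, P=XYXY. *)

(* Defs.v *)
From HB Require Import structures.
From Stdlib Require List.
From mathcomp Require Import all_boot all_order all_algebra.
From mathcomp Require Export complex mxtens.
From mathcomp Require Import all_classical all_reals all_analysis.

Set Implicit Arguments.
Unset Strict Implicit.
Unset Printing Implicit Defensive.

Import Order.TTheory GRing.Theory Num.Theory.
Import numFieldNormedType.Exports.

Local Open Scope classical_set_scope.
Local Open Scope ring_scope.
Local Open Scope complex_scope.
Local Open Scope sesquilinear_scope.

Section Matrices.
Variable R : realType.
Local Notation C := R[i].

Definition l2norm n (x : 'cV[C]_n) : R :=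
  Num.sqrt (\sum_(i < n) ComplexField.Normc.normc (x i 0) ^+ 2).

Definition opnorm n (M : 'M[C]_n) : R :=
  sup [set l2norm (M *m x) | x in [set x : 'cV[C]_n | l2norm x <= 1]].

(* An orthogonal decomposition of C^(p d) into p subspaces V^(k) of dimension d,
   with an orthonormal basis (v k a)_(a < d) of each V^(k), is the same thing
   as an orthonormal family of p d vectors, V^(k) being spanned by the v k a. *)
Definition orthonormal_bases p d (v : 'I_p -> 'I_d -> 'cV[C]_(p * d)) : Prop :=
  forall k a l b,
    ((v k a)^t* *m v l b) 0 0 = ((k == l) && (a == b))%:R.

(* The isomorphism M_(p d)(C) ~ M_p(C) (x) M_d(C) induced by v; on the
   right-hand side the position ((i, a), (j, b)) of the Kronecker product is
   the row mxtens_index (i, a) and the column mxtens_index (j, b). *)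
Definition identify p d (v : 'I_p -> 'I_d -> 'cV[C]_(p * d))
    (M : 'M[C]_(p * d)) : 'M[C]_(p * d) :=
  \matrix_(s, t) ((v (mxtens_unindex s).1 (mxtens_unindex s).2)^t* *m M *m
                 v (mxtens_unindex t).1 (mxtens_unindex t).2) 0 0.

Definition block p d (M : 'M[C]_(p * d)) (i j : 'I_p) : 'M[C]_d :=
  \matrix_(a, b) M (mxtens_index (i, a)) (mxtens_index (j, b)).

Definition act p d (U : 'M[C]_p) (M : 'M[C]_(p * d)) : 'M[C]_(p * d) :=
  (U *t (1%:M : 'M[C]_d)) *m M *m (U^t* *t (1%:M : 'M[C]_d)).

Definition fix_first q (V : 'M[C]_q) : 'M[C]_q.+1 :=
  block_mx (1%:M : 'M[C]_1) 0 0 V.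

End Matrices.

Section RandomMatrices.
Context (R : realType) (disp : measure_display) (T : measurableType disp).
Variable Pr : probability T R.
Local Notation C := R[i].

Definition random_matrix n (X : T -> 'M[C]_n) : Prop :=
  forall i j, measurable_fun setT (fun w => complex.Re (X w i j)) /\
              measurable_fun setT (fun w => complex.Im (X w i j)).

Definition expectationC (f : T -> C) : C :=
  (\int[Pr]_w complex.Re (f w)) +i* (\int[Pr]_w complex.Im (f w)).

Definition phi q d (M : T -> 'M[C]_(q.+1 * d)) : 'M[C]_d :=
  \matrix_(a, b) expectationC (fun w => block (M w) ord0 ord0 a b).

Definition psi q d (M : T -> 'M[C]_(q.+1 * d)) : 'M[C]_d :=
  \matrix_(a, b) expectationC
    (fun w => (q.+1%:R^-1 *: \sum_(k < q.+1) block (M w) k k) a b).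

(* The sigma-algebra generated by the (real and imaginary parts of the) entries
   of a family of matrices; the sample space is arbitrary, so that the identity
   map yields the sigma-algebra on the space of matrices itself. *)
Definition sigma_entries (S K : Type) n (X : K -> S -> 'M[C]_n) : set (set S) :=
  <<s [set E | exists k i j (D : set R), measurable D /\
        (E = [set w | D (complex.Re (X k w i j))] \/
         E = [set w | D (complex.Im (X k w i j))])] >>.

Definition measurable_mx n : set (set 'M[C]_n) :=
  sigma_entries (fun (_ : unit) (M : 'M[C]_n) => M).

Definition independent3 (F1 F2 F3 : set (set T)) : Prop :=
  forall E1 E2 E3, F1 E1 -> F2 E2 -> F3 E3 ->
    Pr (E1 `&` E2 `&` E3) = (Pr E1 * Pr E2 * Pr E3)%E.

Definition haar_unitary n (V : T -> 'M[C]_n) : Prop :=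
  [/\ random_matrix V,
      forall w, V w \is unitarymx &
      forall W : 'M[C]_n, W \is unitarymx ->
        forall S : set 'M[C]_n, measurable_mx S ->
          Pr [set w | S (W *m V w)] = Pr [set w | S (V w)] /\
          Pr [set w | S (V w *m W)] = Pr [set w | S (V w)]].

(* Norms are controlled for almost every w by a constant that does not depend
   on the index n of the sequence. *)
Definition bounded_ensemble (K : Type) (N : nat -> nat)
    (X : forall n, K -> T -> 'M[C]_(N n)) : Prop :=
  exists c : K -> R,
    {ae Pr, forall w, forall n k, opnorm (X n k w) <= c k}.

End RandomMatrices.

Section OperatorValuedPolynomials.
Context (R : realType) (d : nat).
Local Notation C := R[i].
Local Notation B := 'M[C]_d.

(* Polynomials in noncommuting indeterminates indexed by I, with coefficients
   in B = M_d(C) that do not commute with the indeterminates: the C-algebra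
   B<I> is presented by generators and relations, as the formal expressions
   below modulo the congruence nceq. *)
Inductive ncpoly (I : Type) : Type :=
| Coef of B
| Var of I
| Add of ncpoly I & ncpoly I
| Mul of ncpoly I & ncpoly I.
Arguments Coef {I}.
Arguments Var {I}.

Inductive nceq (I : Type) : ncpoly I -> ncpoly I -> Prop :=
| nceq_refl P : nceq P P
| nceq_sym P Q : nceq P Q -> nceq Q P
| nceq_trans P Q S : nceq P Q -> nceq Q S -> nceq P S
| nceq_Add P P' Q Q' : nceq P P' -> nceq Q Q' -> nceq (Add P Q) (Add P' Q')
| nceq_Mul P P' Q Q' : nceq P P' -> nceq Q Q' -> nceq (Mul P Q) (Mul P' Q')
| nceq_addA P Q S : nceq (Add P (Add Q S)) (Add (Add P Q) S)
| nceq_addC P Q : nceq (Add P Q) (Add Q P)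
| nceq_add0 P : nceq (Add (Coef 0) P) P
| nceq_addN P : nceq (Add P (Mul (Coef (- 1%:M)) P)) (Coef 0)
| nceq_mulA P Q S : nceq (Mul P (Mul Q S)) (Mul (Mul P Q) S)
| nceq_mul1l P : nceq (Mul (Coef 1%:M) P) P
| nceq_mul1r P : nceq (Mul P (Coef 1%:M)) P
| nceq_mulDl P Q S : nceq (Mul (Add P Q) S) (Add (Mul P S) (Mul Q S))
| nceq_mulDr P Q S : nceq (Mul P (Add Q S)) (Add (Mul P Q) (Mul P S))
| nceq_CoefD m n : nceq (Coef (m + n)) (Add (Coef m) (Coef n))
| nceq_CoefM m n : nceq (Coef (m *m n)) (Mul (Coef m) (Coef n))
| nceq_scalarC (c : C) x :
    nceq (Mul (Coef c%:M) (Var x)) (Mul (Var x) (Coef c%:M)).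

Fixpoint ncmap (I J : Type) (f : I -> J) (P : ncpoly I) : ncpoly J :=
  match P with
  | Coef m => Coef m
  | Var x => Var (f x)
  | Add P Q => Add (ncmap f P) (ncmap f Q)
  | Mul P Q => Mul (ncmap f P) (ncmap f Q)
  end.

Fixpoint nceval (I : Type) p (X : I -> 'M[C]_(p * d)) (P : ncpoly I)
    : 'M[C]_(p * d) :=
  match P with
  | Coef m => (1%:M : 'M[C]_p) *t m
  | Var x => X x
  | Add P Q => nceval X P + nceval X Q
  | Mul P Q => nceval X P *m nceval X Q
  end.

Definition bimodule_map (I : Type) (f : ncpoly I -> B) : Prop :=
  [/\ forall P Q, nceq P Q -> f P = f Q,
      forall P Q, f (Add P Q) = f P + f Q &
      forall m n P, f (Mul (Mul (Coef m) P) (Coef n)) = m *m f P *m n].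

Section ConditionallyFreeProduct.
Context (I J : Type).
Variables (phi1 psi1 : ncpoly I -> B) (psi2 phi2 : ncpoly J -> B).

(* A factor of a product in B<I, J>: an element of B<I> or of B<J>. *)
Definition factor := (ncpoly I + ncpoly J)%type.

Definition embed (F : factor) : ncpoly (I + J) :=
  match F with
  | inl P => ncmap inl P
  | inr Q => ncmap inr Q
  end.

Definition centered (F : factor) : Prop :=
  match F with
  | inl P => psi1 P = 0
  | inr Q => psi2 Q = 0
  end.

Definition is_left (F : factor) : bool := if F is inl _ then true else false.

Definition alternating (s : seq factor) : bool :=
  sorted (fun F G => is_left F != is_left G) s.

Definition ncprod (s : seq factor) : ncpoly (I + J) :=
  foldr (fun F P => Mul (embed F) P) (Coef 1%:M) s.

Definition is_cfree_product (f : ncpoly (I + J) -> B) : Prop :=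
  [/\ bimodule_map f,
      forall P, f (ncmap inl P) = phi1 P,
      forall Q, f (ncmap inr Q) = phi2 Q &
      forall s : seq factor, alternating s -> List.Forall centered s ->
        f (ncprod s) = \prod_(F <- s) f (embed F)].

(* The map characterised by is_cfree_product, which exists and is unique when
   phi1, psi1, psi2, phi2 are unital bimodule maps (0 is a junk value). *)
Definition cfree_product : ncpoly (I + J) -> B :=
  xget (fun _ => 0) [set f | is_cfree_product f].

End ConditionallyFreeProduct.
End OperatorValuedPolynomials.

Arguments Coef {R d I}.
Arguments Var {R d I}.

Section FunctionalsOfEnsembles.
Context (R : realType) (disp : measure_display) (T : measurableType disp).
Variable Pr : probability T R.
Context (d q : nat) (I : Type).

Definition phi_of (X : I -> T -> 'M[R[i]]_(q.+1 * d)) (P : ncpoly R d I) :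
    'M[R[i]]_d :=
  phi Pr (fun w => nceval (X^~ w) P).

Definition psi_of (X : I -> T -> 'M[R[i]]_(q.+1 * d)) (P : ncpoly R d I) :
    'M[R[i]]_d :=
  psi Pr (fun w => nceval (X^~ w) P).

End FunctionalsOfEnsembles.

Definition sum_family (I J S : Type) (f : I -> S) (g : J -> S) (x : I + J) : S :=
  match x with inl i => f i | inr j => g j end.

(* Main.v *)
From HB Require Import structures.
Require Import Defs.
From mathcomp Require Import all_boot all_order all_algebra.
From mathcomp Require Import zify ring lra.
From mathcomp Require Import all_classical all_reals all_analysis.
From mathcomp Require Import measurable_realfun.

Set Implicit Arguments.
Unset Strict Implicit.
Unset Printing Implicit Defensive.

Import Order.TTheory GRing.Theory Num.Theory.
Import numFieldNormedType.Exports.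

Local Open Scope classical_set_scope.
Local Open Scope ring_scope.
Local Open Scope complex_scope.
Local Open Scope sesquilinear_scope.

(** Write [p] for [(q n).+1] and [U = 1 (+) V]. Once the realisation of the
    ensembles is fixed, only the Haar unitary is random, and the assertion
    concerns two families of bounded deterministic block matrices.

    The heart of the matter is the corner block of an alternating word
    [X1 (U Y1 U^* ) X2 (U Y2 U^* ) ...] whose factors are centred, that is, have
    partial traces equal to zero. Both the mixed moment and the conditionally
    free product should equal the product of the corner blocks of the factors;
    for the former this has to be shown up to [O(1/p)]. Taking matrices of
    entries at a fixed position of the blocks ([slice]), the word becomes a sum
    over index paths of words of scalar matrices conjugated by [U], whose letters
    have bounded traces (lemma [block_corner_estimate]).

    For scalar words, the invariance of the Haar measure under multiplication by
    unitaries close to the identity gives a Schwinger-Dyson equation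
    ([loop_equation]). Its boundary term is [q n] times the expectation to be
    estimated, and the remaining terms are products of traces of shorter
    alternating words. Applied to a word and its adjoint it shows by induction on
    the length that the unnormalised traces of alternating words have bounded
    second moments ([trace_moments]); when the two ends of the word belong to the
    same side, they are first merged under the trace and recentred. As [U]
    fixes the first basis vector, the corner entry of a single letter is
    deterministic; that of a word differs from the product of the corner entry of
    its first letter with that of the remaining word by a trace over the
    orthogonal complement ([word_00_split]). The loop equation and the second moments make the
    expectation of this trace [O(1/p)] ([complement_trace_small],
    [corner_estimate]).

    Everything else is algebra. Every polynomial is a sum of words, and centring
    or merging factors reduces words to alternating centred ones and shorter
    words. Hence a bimodule map that is small on alternating centred words, in
    terms of the norms of the factors, is small on every word
    ([word_bound_exists]), with constants that do not see the dimension. Applied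
    to the difference of the mixed moments and the conditionally free product,
    this is the theorem ([mixed_moment_rate]).

    Since [cfree_product] is meaningful only if the conditionally free product
    exists, its existence has to be proved as well. It is obtained from the same
    estimates: for fixed families of matrices, put many diagonal copies of them
    into larger and larger matrices, which changes neither the corners nor, up to
    a bounded defect, the vanishing of partial traces. The mixed moments of these
    amplifications form Cauchy sequences by the reduction principle, and their
    limit factorises on alternating centred words ([cfree_product_exists]). *)


(** * Complex moduli and operator bounds *)

Section ComplexModulus.
Variable R : realType.
Local Notation C := R[i].
Local Notation N := (@ComplexField.Normc.normc R).

Lemma normc_ge0 (z : C) : 0 <= N z.
Proof. by rewrite /ComplexField.Normc.normc; case: z => a b; exact: sqrtr_ge0. Qed.

Lemma normcD (x y : C) : N (x + y) <= N x + N y.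
Proof. exact: le_normcD. Qed.

Lemma normcB (x y : C) : N (x - y) <= N x + N y.
Proof. by rewrite -[N y](@normcN R); exact: normcD. Qed.

Lemma normc_eq0 (z : C) : (N z == 0) = (z == 0).
Proof.
apply/eqP/eqP => [/ComplexField.Normc.eq0_normc //|->].
exact: ComplexField.Normc.normc0.
Qed.

Lemma normc_real (x : R) : N x%:C = `|x|.
Proof. by rewrite /= expr0n addr0 sqrtr_sqr. Qed.

Lemma normc_nat (n : nat) : N n%:R = n%:R.
Proof. by rewrite -(rmorph_nat (real_complex R)) normc_real ger0_norm. Qed.

Lemma normc_conj (z : C) : N z^* = N z.
Proof. by case: z => a b /=; rewrite sqrrN. Qed.

Lemma normc_sum (I : Type) (s : seq I) (P : pred I) (F : I -> C) :
  N (\sum_(i <- s | P i) F i) <= \sum_(i <- s | P i) N (F i).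
Proof.
elim/big_rec2: _ => [|i y x _ le_xy]; first by rewrite ComplexField.Normc.normc0.
by apply: le_trans (normcD _ _) _; rewrite lerD2l.
Qed.

Lemma mul_conjc (z : C) : z * z^* = (N z ^+ 2)%:C.
Proof. by rewrite rmorphXn /= -sqr_normc. Qed.

Lemma Re_le_normc (z : C) : complex.Re z <= N z.
Proof.
rewrite -lecR; apply: le_trans (normc_ge_Re z).
by rewrite lecR ler_norm.
Qed.

Lemma normRe_le_normc (z : C) : `|complex.Re z| <= N z.
Proof. by rewrite -lecR; exact: normc_ge_Re. Qed.

Lemma normIm_le_normc (z : C) : `|complex.Im z| <= N z.
Proof. by case: z => a b /=; rewrite -sqrtr_sqr ler_wsqrtr // lerDr sqr_ge0. Qed.

Lemma CauchySchwarz_sum (I : finType) (a b : I -> R) :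
  (\sum_i a i * b i) ^+ 2 <= (\sum_i a i ^+ 2) * (\sum_i b i ^+ 2).
Proof.
set A := \sum_i a i ^+ 2; set B := \sum_i b i ^+ 2; set S := \sum_i a i * b i.
have B0 : 0 <= B by apply: sumr_ge0 => i _; exact: sqr_ge0.
have [B_eq0|Bn0] := eqVneq B 0.
  have b0 i : b i = 0.
    move/eqP: B_eq0; rewrite psumr_eq0; last by move=> j _; exact: sqr_ge0.
    by move/allP/(_ i); rewrite mem_index_enum => /(_ isT) /=; rewrite sqrf_eq0 => /eqP.
  by rewrite B_eq0 mulr0 /S big1 ?expr0n // => i _; rewrite b0 mulr0.
have Bp : 0 < B by rewrite lt_def Bn0.
have : 0 <= \sum_i (B * a i - S * b i) ^+ 2 by apply: sumr_ge0 => i _; exact: sqr_ge0.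
have -> : \sum_i (B * a i - S * b i) ^+ 2 = B * (A * B - S ^+ 2).
  have -> : \sum_i (B * a i - S * b i) ^+ 2 =
      \sum_i (B ^+ 2 * a i ^+ 2 - 2 * B * S * (a i * b i) + S ^+ 2 * b i ^+ 2).
    by apply: eq_bigr => i _; ring.
  by rewrite big_split sumrB /= -!mulr_sumr -/A -/B -/S; ring.
by rewrite pmulr_rge0 // subr_ge0.
Qed.

End ComplexModulus.

Section OperatorBounds.
Variable R : realType.
Local Notation C := R[i].
Local Notation N := (@ComplexField.Normc.normc R).

Definition norm2 n (x : 'cV[C]_n) : R := \sum_i N (x i 0) ^+ 2.

(** An upper bound for the operator norm; unlike the norm itself it makes sense
    for rectangular matrices and involves no supremum. *)
Definition opbound m n (c : R) (M : 'M[C]_(m, n)) : Prop :=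
  0 <= c /\ forall x, norm2 (M *m x) <= c ^+ 2 * norm2 x.

Lemma norm2_ge0 n (x : 'cV[C]_n) : 0 <= norm2 x.
Proof. by apply: sumr_ge0 => i _; exact: sqr_ge0. Qed.

Lemma norm2E n (x : 'cV[C]_n) : (norm2 x)%:C = (x^t* *m x) 0 0.
Proof.
rewrite /norm2 rmorph_sum !mxE; apply: eq_bigr => i _.
by rewrite !mxE mulrC mul_conjc.
Qed.

Lemma norm2_delta n (j : 'I_n) : norm2 (delta_mx j 0) = 1.
Proof.
rewrite /norm2 (bigD1 j) //= big1 => [|i /negbTE nij].
  by rewrite mxE !eqxx ComplexField.Normc.normc1 expr1n addr0.
by rewrite mxE nij ComplexField.Normc.normc0 expr0n.
Qed.

Lemma normc_coord_le n (x : 'cV[C]_n) i : N (x i 0) ^+ 2 <= norm2 x.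
Proof.
rewrite /norm2 (bigD1 i) //= lerDl.
by apply: sumr_ge0 => j _; exact: sqr_ge0.
Qed.

Lemma CauchySchwarz_norm2 n (x y : 'cV[C]_n) :
  N ((x^t* *m y) 0 0) ^+ 2 <= norm2 x * norm2 y.
Proof.
apply: le_trans (CauchySchwarz_sum (fun i => N (x i 0)) (fun i => N (y i 0))).
rewrite ler_pXn2r ?nnegrE ?normc_ge0 //; last first.
  by apply: sumr_ge0 => i _; rewrite mulr_ge0 ?normc_ge0.
rewrite mxE; apply: le_trans (normc_sum _ _ _) _.
by apply: ler_sum => i _; rewrite !mxE ComplexField.Normc.normcM normc_conj.
Qed.

Lemma norm2D n (x y : 'cV[C]_n) (a b : R) : 0 <= a -> 0 <= b ->
  norm2 x <= a ^+ 2 -> norm2 y <= b ^+ 2 -> norm2 (x + y) <= (a + b) ^+ 2.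
Proof.
move=> a0 b0 hx hy.
have cs := CauchySchwarz_sum (fun i => N (x i 0)) (fun i => N (y i 0)).
set S := \sum_i _ in cs.
have S0 : 0 <= S by apply: sumr_ge0 => i _; rewrite mulr_ge0 ?normc_ge0.
have le_S : S <= a * b.
  rewrite -(@ler_pXn2r _ 2) ?nnegrE ?mulr_ge0 //.
  by apply: le_trans cs _; rewrite exprMn ler_pM ?norm2_ge0.
apply: (@le_trans _ _ (norm2 x + 2 * S + norm2 y)); last first.
  by rewrite sqrrD lerD // lerD // mulr2n mulrDl mul1r lerD.
rewrite /norm2 mulr_sumr -!big_split /=; apply: ler_sum => i _.
rewrite mxE; apply: (@le_trans _ _ ((N (x i 0) + N (y i 0)) ^+ 2)).
  by rewrite ler_pXn2r ?nnegrE ?addr_ge0 ?normc_ge0 // normcD.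
by rewrite le_eqVlt; apply/orP; left; apply/eqP; ring.
Qed.

Lemma opbound_ge0 m n c (M : 'M[C]_(m, n)) : opbound c M -> 0 <= c.
Proof. by case. Qed.

Lemma opbound_le m n c c' (M : 'M[C]_(m, n)) :
  c <= c' -> opbound c M -> opbound c' M.
Proof.
move=> le_c [c0 hM]; split=> [|x]; first exact: le_trans le_c.
apply: le_trans (hM x) _; apply: ler_wpM2r; first exact: norm2_ge0.
by rewrite ler_pXn2r ?nnegrE //; exact: le_trans le_c.
Qed.

Lemma opboundM m n p c c' (M : 'M[C]_(m, n)) (M' : 'M[C]_(n, p)) :
  opbound c M -> opbound c' M' -> opbound (c * c') (M *m M').
Proof.
move=> [c0 hM] [c'0 hM']; split=> [|x]; first exact: mulr_ge0.
rewrite -mulmxA exprMn -mulrA; apply: le_trans (hM _) _.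
by apply: ler_wpM2l; rewrite ?sqr_ge0.
Qed.

Lemma opboundD m n c c' (M M' : 'M[C]_(m, n)) :
  opbound c M -> opbound c' M' -> opbound (c + c') (M + M').
Proof.
move=> [c0 hM] [c'0 hM']; split=> [|x]; first exact: addr_ge0.
have [sx0 ssx] : 0 <= Num.sqrt (norm2 x) /\ Num.sqrt (norm2 x) ^+ 2 = norm2 x.
  by split; rewrite ?sqrtr_ge0 ?sqr_sqrtr ?norm2_ge0.
rewrite mulmxDl -ssx -exprMn mulrDl.
by apply: norm2D; rewrite ?mulr_ge0 // exprMn ssx.
Qed.

Lemma opboundZ m n c a (M : 'M[C]_(m, n)) :
  opbound c M -> opbound (N a * c) (a *: M).
Proof.
move=> [c0 hM]; split=> [|x]; first by rewrite mulr_ge0 ?normc_ge0.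
rewrite -scalemxAl exprMn -mulrA.
have -> : norm2 (a *: (M *m x)) = N a ^+ 2 * norm2 (M *m x).
  rewrite /norm2 mulr_sumr; apply: eq_bigr => i _.
  by rewrite mxE ComplexField.Normc.normcM exprMn.
by apply: ler_wpM2l; rewrite ?sqr_ge0.
Qed.

Lemma opboundB m n c c' (M M' : 'M[C]_(m, n)) :
  opbound c M -> opbound c' M' -> opbound (c + c') (M - M').
Proof.
move=> hM hM'; apply: opboundD => //; rewrite -scaleN1r -[c']mul1r.
have -> : (1 : R) = N (-1 : C) by rewrite normcN ComplexField.Normc.normc1.
exact: opboundZ.
Qed.

Lemma opbound_scalar n (a : C) : opbound (N a) (a%:M : 'M[C]_n).
Proof.
split=> [|x]; first exact: normc_ge0.
rewrite mul_scalar_mx /norm2 mulr_sumr; apply: ler_sum => i _.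
by rewrite mxE ComplexField.Normc.normcM exprMn.
Qed.

Lemma opbound1 n : opbound 1 (1%:M : 'M[C]_n).
Proof. by rewrite -(@ComplexField.Normc.normc1 R); exact: opbound_scalar. Qed.

Lemma opbound0 m n : opbound 0 (0 : 'M[C]_(m, n)).
Proof.
split=> // x; rewrite mul0mx /norm2 big1 ?expr0n ?mul0r // => i _.
by rewrite mxE ComplexField.Normc.normc0 expr0n.
Qed.

Lemma opbound_sum m n (I : Type) (s : seq I) (P : pred I) (c : I -> R)
    (F : I -> 'M[C]_(m, n)) : (forall i, P i -> opbound (c i) (F i)) ->
  opbound (\sum_(i <- s | P i) c i) (\sum_(i <- s | P i) F i).
Proof.
move=> hF; elim/big_rec2: _ => [|i M a Pi]; first exact: opbound0.
exact: opboundD (hF i Pi).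
Qed.

Lemma opbound_entry m n c (M : 'M[C]_(m, n)) i j : opbound c M -> N (M i j) <= c.
Proof.
move=> [c0 hM]; rewrite -(@ler_pXn2r _ 2) ?nnegrE ?normc_ge0 //.
have := hM (delta_mx j 0); rewrite norm2_delta mulr1; apply: le_trans.
by rewrite -colE; apply: le_trans (normc_coord_le _ i); rewrite mxE.
Qed.

Lemma opbound_trace n c (M : 'M[C]_n) : opbound c M -> N (\tr M) <= n%:R * c.
Proof.
move=> hM; apply: le_trans (normc_sum _ _ _) _.
apply: le_trans (ler_sum _ (fun i _ => opbound_entry i i hM)) _.
by rewrite sumr_const card_ord mulr_natl.
Qed.

Lemma adjmxM m n p (M : 'M[C]_(m, n)) (M' : 'M[C]_(n, p)) :
  (M *m M')^t* = M'^t* *m M^t*.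
Proof. by rewrite trmx_mul map_mxM. Qed.

Lemma adjmxK m n (M : 'M[C]_(m, n)) : (M^t*)^t* = M.
Proof. by apply/matrixP => i j; rewrite !mxE; exact: conjcK. Qed.

Lemma adjmxD m n (M M' : 'M[C]_(m, n)) : (M + M')^t* = M^t* + M'^t*.
Proof. by rewrite linearD map_mxD. Qed.

Lemma adjmxZ m n a (M : 'M[C]_(m, n)) : (a *: M)^t* = Num.conj a *: M^t*.
Proof. by rewrite linearZ /= map_mxZ. Qed.

Lemma mxtrace_adj n (M : 'M[C]_n) : \tr (M^t*) = Num.conj (\tr M).
Proof. by rewrite /mxtrace rmorph_sum; apply: eq_bigr => i _; rewrite !mxE. Qed.

Lemma conjC_real (x : R) : Num.conj (x%:C : C) = x%:C.
Proof. by rewrite /Num.conj /= oppr0. Qed.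

(** Cauchy-Schwarz applied to [x] and [M y] with [y] the image of [x] under the
    adjoint: [|y|^2 <= |x| c |y|]. *)
Lemma opbound_adj m n c (M : 'M[C]_(m, n)) : opbound c M -> opbound c (M^t*).
Proof.
move=> [c0 hM]; split=> // x; set y := M^t* *m x.
have [y0|yn0] := eqVneq (norm2 y) 0.
  by rewrite y0 mulr_ge0 ?sqr_ge0 ?norm2_ge0.
have yp : 0 < norm2 y by rewrite lt_def yn0 norm2_ge0.
have cs := CauchySchwarz_norm2 x (M *m y).
have e : x^t* *m (M *m y) = y^t* *m y.
  by rewrite mulmxA; congr (_ *m _); rewrite /y adjmxM adjmxK.
rewrite e -norm2E normc_real ger0_norm ?norm2_ge0 // in cs.
rewrite -(ler_pM2r yp) -expr2; apply: le_trans cs _.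
by rewrite mulrAC mulrC ler_wpM2r ?norm2_ge0.
Qed.

Lemma opbound_isometry m n (M : 'M[C]_(m, n)) : M^t* *m M = 1%:M -> opbound 1 M.
Proof.
move=> hM; split=> // x; rewrite expr1n mul1r -lecR !norm2E.
by rewrite adjmxM -mulmxA (mulmxA _ M) hM mul1mx.
Qed.

Lemma opbound_unitary n (M : 'M[C]_n) : M \is unitarymx -> opbound 1 M.
Proof.
move=> hM; apply: opbound_isometry.
by apply/eqP; rewrite -trmxC_unitary in hM; move/unitarymxP: hM; rewrite adjmxK => ->.
Qed.

(** The coordinate inclusion along [g], an isometry when [g] is injective, so
    that submatrices are compressions. *)
Definition select_mx n n' (g : 'I_n' -> 'I_n) : 'M[C]_(n, n') :=
  \matrix_(j, k) (j == g k)%:R.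

Lemma select_mx_isometry n n' (g : 'I_n' -> 'I_n) :
  injective g -> (select_mx g)^t* *m select_mx g = 1%:M.
Proof.
move=> gI; apply/matrixP => k l; rewrite !mxE (bigD1 (g k)) //= big1 ?addr0.
  by rewrite !mxE eqxx rmorph1 mul1r (inj_eq gI).
by move=> j /negbTE njk; rewrite !mxE njk rmorph0 mul0r.
Qed.

Lemma mxsub_select m n m' n' (M : 'M[C]_(m, n)) (f : 'I_m' -> 'I_m)
    (g : 'I_n' -> 'I_n) :
  mxsub f g M = (select_mx f)^t* *m M *m select_mx g.
Proof.
apply/matrixP => i k; rewrite -mulmxA !mxE (bigD1 (f i)) //= big1 ?addr0.
  rewrite !mxE eqxx rmorph1 mul1r (bigD1 (g k)) //= big1 ?addr0 ?mxE ?eqxx ?mulr1 //.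
  by move=> j /negbTE njk; rewrite !mxE njk mulr0.
by move=> j /negbTE njk; rewrite !mxE njk rmorph0 mul0r.
Qed.

Lemma opbound_mxsub m n m' n' c (M : 'M[C]_(m, n)) (f : 'I_m' -> 'I_m)
    (g : 'I_n' -> 'I_n) : injective f -> injective g ->
  opbound c M -> opbound c (mxsub f g M).
Proof.
move=> fI gI hM; rewrite mxsub_select -[c]mul1r -[1 * c]mulr1.
apply: opboundM; last exact/opbound_isometry/select_mx_isometry.
apply: opboundM => //; apply: opbound_adj.
exact/opbound_isometry/select_mx_isometry.
Qed.

Lemma opbound_delta m n i j : opbound 1 (delta_mx i j : 'M[C]_(m, n)).
Proof.
have -> : delta_mx i j = select_mx (fun _ : 'I_1 => i) *m (select_mx (fun _ : 'I_1 => j))^t*.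
  by apply/matrixP => k l; rewrite !mxE big_ord1 !mxE rmorph_nat -natrM mulnb.
have inj1 k (h : 'I_1 -> 'I_k) : injective h by move=> a b _; rewrite !ord1.
rewrite -[1]mulr1; apply: opboundM; last apply: opbound_adj.
all: exact/opbound_isometry/select_mx_isometry.
Qed.

(** A crude bound depending on the dimensions; it is applied only when these
    are fixed. *)
Lemma opbound_entries m n c (M : 'M[C]_(m, n)) :
  0 <= c -> (forall i j, N (M i j) <= c) -> opbound (m%:R * n%:R * c) M.
Proof.
move=> c0 hM; rewrite [M]matrix_sum_delta.
have -> : m%:R * n%:R * c = \sum_(i < m) \sum_(j < n) c.
  by rewrite sumr_const card_ord sumr_const card_ord -mulrA !mulr_natl.
apply: opbound_sum => i _; apply: opbound_sum => j _.
apply: opbound_le (hM i j) _; rewrite -[N _]mulr1.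
exact/opboundZ/opbound_delta.
Qed.

Lemma opbound_exists m n (M : 'M[C]_(m, n)) : exists c, opbound c M.
Proof.
exists (m%:R * n%:R * \sum_i \sum_j N (M i j)); apply: opbound_entries.
  by do 2 (apply: sumr_ge0 => ? _); exact: normc_ge0.
move=> i j; rewrite (bigD1 i) //= (bigD1 j) //= -addrA lerDl.
by apply: addr_ge0; do ?(apply: sumr_ge0 => ? _); exact: normc_ge0.
Qed.

End OperatorBounds.

(** * Expectations of bounded complex random variables *)

Section BoundedRandomVariables.
Context (R : realType).
Local Notation C := R[i].
Local Notation N := (@ComplexField.Normc.normc R).

Section Measurability.
Context (d : measure_display) (T : measurableType d).

Definition measurableC (f : T -> C) : Prop :=
  measurable_fun setT (fun w => complex.Re (f w)) /\
  measurable_fun setT (fun w => complex.Im (f w)).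

Lemma measurableC_cst (c : C) : measurableC (fun=> c).
Proof. by split; exact: measurable_cst. Qed.

Lemma measurableCD (f g : T -> C) :
  measurableC f -> measurableC g -> measurableC (fun w => f w + g w).
Proof.
move=> [fr fi] [gr gi]; split.
  rewrite (_ : (fun _ => _) = (fun w => complex.Re (f w)) \+ (fun w => complex.Re (g w))).
    exact: measurable_funD.
  by apply/funext => w /=; case: (f w) => ? ?; case: (g w).
rewrite (_ : (fun _ => _) = (fun w => complex.Im (f w)) \+ (fun w => complex.Im (g w))).
  exact: measurable_funD.
by apply/funext => w /=; case: (f w) => ? ?; case: (g w).
Qed.

Lemma measurableCM (f g : T -> C) :
  measurableC f -> measurableC g -> measurableC (fun w => f w * g w).
Proof.
move=> [fr fi] [gr gi]; split.
  rewrite (_ : (fun _ => _) =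
     ((fun w => complex.Re (f w)) \* (fun w => complex.Re (g w))) \-
     ((fun w => complex.Im (f w)) \* (fun w => complex.Im (g w)))).
    by apply: measurable_funB; exact: measurable_funM.
  by apply/funext => w /=; case: (f w) => ? ?; case: (g w).
rewrite (_ : (fun _ => _) =
     ((fun w => complex.Re (f w)) \* (fun w => complex.Im (g w))) \+
     ((fun w => complex.Im (f w)) \* (fun w => complex.Re (g w)))).
  by apply: measurable_funD; exact: measurable_funM.
by apply/funext => w /=; case: (f w) => ? ?; case: (g w).
Qed.

Lemma measurableC_conj (f : T -> C) : measurableC f -> measurableC (fun w => (f w)^*).
Proof.
move=> [fr fi]; split.
  by rewrite (_ : (fun _ => _) = (fun w => complex.Re (f w))) //; apply/funext => w; case: (f w).
rewrite (_ : (fun _ => _) = \- (fun w => complex.Im (f w))).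
  exact: measurableT_comp.
by apply/funext => w /=; case: (f w).
Qed.

Lemma measurableC_sum (I : Type) (s : seq I) (f : I -> T -> C) :
  (forall i, measurableC (f i)) -> measurableC (fun w => \sum_(i <- s) f i w).
Proof.
move=> hf; elim: s => [|i s IH].
  under eq_fun do rewrite big_nil; exact: measurableC_cst.
under eq_fun do rewrite big_cons; exact: measurableCD.
Qed.

Lemma measurable_normc (f : T -> C) :
  measurableC f -> measurable_fun setT (fun w => N (f w)).
Proof.
move=> [fr fi]; rewrite (_ : (fun _ => _) = Num.sqrt \o
     ((fun w => complex.Re (f w) ^+ 2) \+ (fun w => complex.Im (f w) ^+ 2))).
  apply: measurableT_comp.
    by apply: continuous_measurable_fun; exact: sqrt_continuous.
  by apply: measurable_funD; exact: measurable_funX.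
by apply/funext => w /=; case: (f w).
Qed.

End Measurability.

Section Expectation.
Context (d : measure_display) (T : measurableType d) (Pr : probability T R).

Definition bounded_mC (f : T -> C) : Prop :=
  measurableC f /\ exists c, forall w, N (f w) <= c.

Definition bounded_mR (f : T -> R) : Prop :=
  measurable_fun setT f /\ exists c, forall w, `|f w| <= c.

Lemma bounded_mC_cst (c : C) : bounded_mC (fun=> c).
Proof. by split; [exact: measurableC_cst|exists (N c)]. Qed.

Lemma bounded_mCD f g : bounded_mC f -> bounded_mC g -> bounded_mC (fun w => f w + g w).
Proof.
move=> [mf [a fa]] [mg [b gb]]; split; first exact: measurableCD.
by exists (a + b) => w; apply: le_trans (normcD _ _) _; exact: lerD.
Qed.

Lemma bounded_mCM f g : bounded_mC f -> bounded_mC g -> bounded_mC (fun w => f w * g w).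
Proof.
move=> [mf [a fa]] [mg [b gb]]; split; first exact: measurableCM.
exists (a * b) => w; rewrite ComplexField.Normc.normcM.
by apply: ler_pM; rewrite ?normc_ge0.
Qed.

Lemma bounded_mC_conj f : bounded_mC f -> bounded_mC (fun w => (f w)^*).
Proof.
move=> [mf [a fa]]; split; first exact: measurableC_conj.
by exists a => w; rewrite normc_conj.
Qed.

Lemma bounded_mC_sum (I : Type) (s : seq I) (f : I -> T -> C) :
  (forall i, bounded_mC (f i)) -> bounded_mC (fun w => \sum_(i <- s) f i w).
Proof.
move=> hf; elim: s => [|i s IH].
  under eq_fun do rewrite big_nil; exact: bounded_mC_cst.
under eq_fun do rewrite big_cons; exact: bounded_mCD.
Qed.

Lemma bounded_mCN f : bounded_mC f -> bounded_mC (fun w => - f w).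
Proof.
move=> hf; under eq_fun do rewrite -mulN1r.
by apply: bounded_mCM => //; exact: bounded_mC_cst.
Qed.

Lemma bounded_mCB f g : bounded_mC f -> bounded_mC g -> bounded_mC (fun w => f w - g w).
Proof. by move=> hf hg; apply: bounded_mCD => //; exact: bounded_mCN. Qed.

Lemma bounded_mR_normc f : bounded_mC f -> bounded_mR (fun w => N (f w)).
Proof.
move=> [mf [a fa]]; split; first exact: measurable_normc.
by exists a => w; rewrite ger0_norm ?normc_ge0.
Qed.

Lemma bounded_mR_Re f : bounded_mC f -> bounded_mR (fun w => complex.Re (f w)).
Proof.
by move=> [[mf _] [a fa]]; split=> //; exists a => w; exact: le_trans (normRe_le_normc _) _.
Qed.

Lemma bounded_mR_Im f : bounded_mC f -> bounded_mR (fun w => complex.Im (f w)).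
Proof.
by move=> [[_ mf] [a fa]]; split=> //; exists a => w; exact: le_trans (normIm_le_normc _) _.
Qed.

Lemma bounded_mR_cst c : bounded_mR (fun=> c).
Proof. by split; [exact: measurable_cst|exists `|c|]. Qed.

Lemma bounded_mRD f g : bounded_mR f -> bounded_mR g -> bounded_mR (fun w => f w + g w).
Proof.
move=> [mf [a fa]] [mg [b gb]]; split; first exact: measurable_funD.
by exists (a + b) => w; apply: le_trans (ler_normD _ _) _; exact: lerD.
Qed.

Lemma bounded_mRM f g : bounded_mR f -> bounded_mR g -> bounded_mR (fun w => f w * g w).
Proof.
move=> [mf [a fa]] [mg [b gb]]; split; first exact: measurable_funM.
by exists (a * b) => w; rewrite normrM; apply: ler_pM.
Qed.

Lemma bounded_mR_sum (I : Type) (s : seq I) (P : pred I) (f : I -> T -> R) :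
  (forall i, bounded_mR (f i)) -> bounded_mR (fun w => \sum_(i <- s | P i) f i w).
Proof.
move=> hf; elim: s => [|i s IH].
  under eq_fun do rewrite big_nil; exact: bounded_mR_cst.
under eq_fun do rewrite big_cons; case: (P i) => //; exact: bounded_mRD.
Qed.

Lemma bounded_mRX f n : bounded_mR f -> bounded_mR (fun w => f w ^+ n).
Proof.
move=> hf; elim: n => [|n IH]; first exact: bounded_mR_cst.
by under eq_fun do rewrite exprS; exact: bounded_mRM.
Qed.

Local Notation Er f := (\int[Pr]_w f w)%R.
Local Notation E := (expectationC Pr).

Lemma bounded_mR_integrable f : bounded_mR f -> Pr.-integrable setT (EFin \o f).
Proof.
move=> [mf [a fa]]; apply: measurable_bounded_integrable => //.
  by apply: le_lt_trans (probability_le1 _ _) _ => //; exact: ltry.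
exists a; split; first exact: num_real.
by move=> x ax y _ /=; exact: le_trans (fa y) (ltW ax).
Qed.

Lemma expR_cst c : Er (fun=> c) = c.
Proof. by rewrite Rintegral_cst //= probability_setT mulr1. Qed.

Lemma expRD f g : bounded_mR f -> bounded_mR g ->
  Er (fun w => f w + g w) = Er f + Er g.
Proof. by move=> hf hg; rewrite RintegralD //; exact: bounded_mR_integrable. Qed.

Lemma expRZ c f : bounded_mR f -> Er (fun w => c * f w) = c * Er f.
Proof. by move=> hf; rewrite RintegralZl //; exact: bounded_mR_integrable. Qed.

Lemma expR_le f g : bounded_mR f -> bounded_mR g -> (forall w, f w <= g w) ->
  Er f <= Er g.
Proof. by move=> hf hg fg; apply: le_Rintegral => //; exact: bounded_mR_integrable. Qed.

Lemma expR_ge0 f : (forall w, 0 <= f w) -> 0 <= Er f.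
Proof. by move=> f0; apply: Rintegral_ge0. Qed.

Lemma expR_sum (I : Type) (s : seq I) (P : pred I) (f : I -> T -> R) :
  (forall i, bounded_mR (f i)) ->
  Er (fun w => \sum_(i <- s | P i) f i w) = \sum_(i <- s | P i) Er (f i).
Proof.
move=> hf; elim: s => [|i s IH].
  by rewrite big_nil; under eq_Rintegral do rewrite big_nil; rewrite expR_cst.
rewrite big_cons; under eq_Rintegral do rewrite big_cons.
case: (P i) => //; rewrite expRD ?IH //; exact: bounded_mR_sum.
Qed.

Lemma expC_cst c : E (fun=> c) = c.
Proof. by rewrite /expectationC !expR_cst; case: c. Qed.

Lemma expCD f g : bounded_mC f -> bounded_mC g ->
  E (fun w => f w + g w) = E f + E g.
Proof.
move=> hf hg; rewrite /expectationC; apply/eqP; rewrite eq_complex /=; apply/andP; split; apply/eqP.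
  rewrite -expRD; [|exact: bounded_mR_Re..].
  by apply: eq_Rintegral => w _; case: (f w) => ? ?; case: (g w).
rewrite -expRD; [|exact: bounded_mR_Im..].
by apply: eq_Rintegral => w _; case: (f w) => ? ?; case: (g w).
Qed.

Lemma expCZ c f : bounded_mC f -> E (fun w => c * f w) = c * E f.
Proof.
move=> hf; have hr := bounded_mR_Re hf; have hi := bounded_mR_Im hf.
rewrite /expectationC; case: c => a b; apply/eqP; rewrite eq_complex /=; apply/andP; split; apply/eqP.
  rewrite -!expRZ // -[- _]mulN1r -expRZ; last by apply: bounded_mRM => //; exact: bounded_mR_cst.
  rewrite -expRD; [|exact: (bounded_mRM (bounded_mR_cst _))|].
    by apply: eq_Rintegral => w _; case: (f w) => ? ? /=; rewrite mulN1r.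
  by apply: (bounded_mRM (bounded_mR_cst _)); exact: (bounded_mRM (bounded_mR_cst _)).
rewrite -!expRZ // -expRD; [|exact: (bounded_mRM (bounded_mR_cst _))..].
by apply: eq_Rintegral => w _; case: (f w).
Qed.

Lemma expCB f g : bounded_mC f -> bounded_mC g ->
  E (fun w => f w - g w) = E f - E g.
Proof.
move=> hf hg; rewrite expCD //; last exact: bounded_mCN.
congr (_ + _); rewrite -mulN1r -expCZ //.
by congr (expectationC Pr _); apply/funext => w; rewrite mulN1r.
Qed.

Lemma expC_sum (I : Type) (s : seq I) (f : I -> T -> C) :
  (forall i, bounded_mC (f i)) ->
  E (fun w => \sum_(i <- s) f i w) = \sum_(i <- s) E (f i).
Proof.
move=> hf; elim: s => [|i s IH].
  by rewrite big_nil -[RHS](expC_cst 0); congr (expectationC Pr _); apply/funext => w; rewrite big_nil.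
rewrite big_cons -IH -expCD //; last exact: bounded_mC_sum.
by congr (expectationC Pr _); apply/funext => w; rewrite big_cons.
Qed.

(** Rotating [f] by the phase of its expectation makes the expectation real,
    so that it is the integral of a real part, hence at most that of the
    modulus. *)
Lemma normc_expC_le f : bounded_mC f -> N (E f) <= Er (fun w => N (f w)).
Proof.
move=> hf; have [->|z0] := eqVneq (E f) 0.
  by rewrite ComplexField.Normc.normc0; apply: expR_ge0 => w; exact: normc_ge0.
set z := E f in z0 *.
have nz0 : N z != 0 by rewrite normc_eq0.
have bcf : bounded_mC (fun w => z^* * f w) by apply: bounded_mCM => //; exact: bounded_mC_cst.
have e : N z ^+ 2 = Er (fun w => complex.Re (z^* * f w)).
  have := expCZ z^* hf; rewrite -/z mulrC mul_conjc => /(congr1 (@complex.Re R)).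
  by rewrite /expectationC /= => ->.
have : N z ^+ 2 <= N z * Er (fun w => N (f w)).
  rewrite e -expRZ; last exact: bounded_mR_normc.
  apply: expR_le => [||w]; first exact: bounded_mR_Re.
    by apply: bounded_mRM; [exact: bounded_mR_cst|exact: bounded_mR_normc].
  by apply: le_trans (Re_le_normc _) _; rewrite ComplexField.Normc.normcM normc_conj.
by rewrite expr2 ler_pM2l // lt_def nz0 normc_ge0.
Qed.

Lemma expC_norm2 f : bounded_mC f ->
  N (E (fun w => f w * (f w)^*)) = Er (fun w => N (f w) ^+ 2).
Proof.
move=> hf; have -> : E (fun w => f w * (f w)^*) = (Er (fun w => N (f w) ^+ 2))%:C.
  rewrite /expectationC; congr (_ +i* _).
    by apply: eq_Rintegral => w _; rewrite mul_conjc.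
  by under eq_Rintegral do rewrite mul_conjc /=; rewrite expR_cst.
by rewrite normc_real ger0_norm // expR_ge0 // => w; rewrite sqr_ge0.
Qed.

(** The modulus is dominated by its square, so a second moment bound gives a
    first moment bound without square roots. *)
Lemma expR_norm_le f c : bounded_mC f ->
  Er (fun w => N (f w) ^+ 2) <= c -> Er (fun w => N (f w)) <= 1 + c.
Proof.
move=> hf hc; have hn := bounded_mR_normc hf.
apply: (@le_trans _ _ (Er (fun w => 1 + N (f w) ^+ 2))).
  apply: expR_le => // [|w].
    by apply: bounded_mRD; [exact: bounded_mR_cst|exact: bounded_mRX].
  have : 0 <= (N (f w) - 2^-1) ^+ 2 by exact: sqr_ge0.
  by nra.
by rewrite expRD ?expR_cst ?lerD2l //; [exact: bounded_mR_cst|exact: bounded_mRX].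
Qed.

End Expectation.
End BoundedRandomVariables.

(** * Bounded random matrices and invariance of the Haar measure *)

Section RandomMatrixCalculus.
Context (R : realType).
Local Notation C := R[i].
Local Notation N := (@ComplexField.Normc.normc R).

Section MeasurableMatrices.
Context (d : measure_display) (T : measurableType d).

Definition measurable_mxC m n (X : T -> 'M[C]_(m, n)) : Prop :=
  forall i j, measurableC (fun w => X w i j).

Lemma measurable_mxC_cst m n (M : 'M[C]_(m, n)) : measurable_mxC (fun=> M).
Proof. by move=> i j; exact: measurableC_cst. Qed.

Lemma measurable_mxCM m n p (X : T -> 'M[C]_(m, n)) (Y : T -> 'M[C]_(n, p)) :
  measurable_mxC X -> measurable_mxC Y -> measurable_mxC (fun w => X w *m Y w).
Proof.
move=> hX hY i j; under eq_fun do rewrite mxE.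
by apply: measurableC_sum => k; exact: measurableCM.
Qed.

Lemma measurable_mxCD m n (X Y : T -> 'M[C]_(m, n)) :
  measurable_mxC X -> measurable_mxC Y -> measurable_mxC (fun w => X w + Y w).
Proof. by move=> hX hY i j; under eq_fun do rewrite mxE; exact: measurableCD. Qed.

Lemma measurable_mxC_adj m n (X : T -> 'M[C]_(m, n)) :
  measurable_mxC X -> measurable_mxC (fun w => (X w)^t*).
Proof. by move=> hX i j; under eq_fun do rewrite !mxE; exact: measurableC_conj. Qed.

Lemma measurableC_trace n (X : T -> 'M[C]_n) :
  measurable_mxC X -> measurableC (fun w => \tr (X w)).
Proof. by move=> hX; apply: measurableC_sum => i; exact: hX. Qed.

Lemma measurable_mxC_fix_first q (X : T -> 'M[C]_q) :
  measurable_mxC X -> measurable_mxC (fun w => fix_first (X w)).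
Proof.
move=> hX i j; rewrite /fix_first.
under eq_fun do rewrite /block_mx mxE.
case: splitP => i' _; under eq_fun do rewrite mxE; case: splitP => j' _.
- exact: measurableC_cst.
- exact: measurableC_cst.
- exact: measurableC_cst.
- exact: hX.
Qed.

Definition bounded_mx n (X : T -> 'M[C]_n) : Prop :=
  measurable_mxC X /\ exists c, forall w, opbound c (X w).

Lemma bounded_mxM n (X Y : T -> 'M[C]_n) :
  bounded_mx X -> bounded_mx Y -> bounded_mx (fun w => X w *m Y w).
Proof.
move=> [mX [a hX]] [mY [b hY]]; split; first exact: measurable_mxCM.
by exists (a * b) => w; exact: opboundM.
Qed.

Lemma bounded_mxD n (X Y : T -> 'M[C]_n) :
  bounded_mx X -> bounded_mx Y -> bounded_mx (fun w => X w + Y w).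
Proof.
move=> [mX [a hX]] [mY [b hY]]; split; first exact: measurable_mxCD.
by exists (a + b) => w; exact: opboundD.
Qed.

Lemma bounded_mx_cst n (M : 'M[C]_n) : bounded_mx (fun=> M).
Proof.
split; first exact: measurable_mxC_cst.
by have [c hc] := opbound_exists M; exists c.
Qed.

Lemma bounded_mxB n (X Y : T -> 'M[C]_n) :
  bounded_mx X -> bounded_mx Y -> bounded_mx (fun w => X w - Y w).
Proof.
move=> hX [mY [b hY]]; apply: bounded_mxD => //; split.
  move=> i j; under eq_fun do rewrite mxE -mulN1r.
  by apply: measurableCM; [exact: measurableC_cst|exact: mY].
exists b => w; rewrite -scaleN1r -[b]mul1r.
have -> : (1 : R) = N (-1 : C) by rewrite normcN ComplexField.Normc.normc1.
exact: opboundZ.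
Qed.

Lemma bounded_mx_sum n (I : Type) (s : seq I) (P : pred I) (X : I -> T -> 'M[C]_n) :
  (forall i, bounded_mx (X i)) -> bounded_mx (fun w => \sum_(i <- s | P i) X i w).
Proof.
move=> hX; elim: s => [|i s IH].
  under eq_fun do rewrite big_nil; exact: bounded_mx_cst.
by under eq_fun do rewrite big_cons; case: (P i) => //; exact: bounded_mxD.
Qed.

Lemma bounded_mC_entry n (X : T -> 'M[C]_n) i j :
  bounded_mx X -> bounded_mC (fun w => X w i j).
Proof.
by move=> [mX [a hX]]; split=> //; exists a => w; exact: opbound_entry.
Qed.

Lemma bounded_mC_trace n (X : T -> 'M[C]_n) :
  bounded_mx X -> bounded_mC (fun w => \tr (X w)).
Proof.
move=> [mX [a hX]]; split; first exact: measurableC_trace.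
by exists (n%:R * a) => w; exact: opbound_trace.
Qed.

End MeasurableMatrices.

Section HaarInvariance.
Context (disp : measure_display) (T : measurableType disp).
Variable Pr : probability T R.

Lemma expR_eq_law (X Y : T -> R) : bounded_mR X -> bounded_mR Y ->
  (forall D : set R, measurable D -> Pr (X @^-1` D) = Pr (Y @^-1` D)) ->
  \int[Pr]_w X w = \int[Pr]_w Y w.
Proof.
move=> bX bY hXY; rewrite /Rintegral; congr fine.
pose X' : {mfun T >-> R} := HB.pack X (isMeasurableFun.Build _ _ _ _ X bX.1).
pose Y' : {mfun T >-> R} := HB.pack Y (isMeasurableFun.Build _ _ _ _ Y bY.1).
have eX := @integral_distribution _ _ _ _ _ Pr X' (EFin : R -> \bar R) _ (bounded_mR_integrable Pr bX).
have eY := @integral_distribution _ _ _ _ _ Pr Y' (EFin : R -> \bar R) _ (bounded_mR_integrable Pr bY).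
have eM : measurable_fun [set: R] (EFin : R -> \bar R) by exact: EFin_measurable.
rewrite -[LHS](eX eM) -[RHS](eY eM).
by apply: eq_measure_integral => D mD _; exact: hXY.
Qed.

Definition mx_pointed q : pointedType :=
  HB.pack_for pointedType 'M[C]_q (isPointed.Build 'M[C]_q 0).

(** A copy of the matrix space that carries the sigma-algebra [measurable_mx],
    so that measurability of functions of a matrix can be expressed. *)
Definition mx_space q : Type :=
  @g_sigma_algebraType (mx_pointed q)
    [set E | exists (k : unit) i j (D : set R), measurable D /\
       (E = [set M : 'M[C]_q | D (complex.Re (M i j))] \/
        E = [set M : 'M[C]_q | D (complex.Im (M i j))])].

HB.instance Definition _ q := Measurable.on (mx_space q).

Lemma measurable_mx_space q (S : set 'M[C]_q) :
  measurable (S : set (mx_space q)) -> measurable_mx S.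
Proof. by []. Qed.

Lemma measurable_mxC_id q : measurable_mxC (fun M : mx_space q => M : 'M[C]_q).
Proof.
by move=> i j; split=> _ D mD; rewrite setTI; apply: sub_sigma_algebra;
   exists tt, i, j, D; split=> //; [left|right].
Qed.

(** Invariance of the law gives invariance of expectations of bounded
    measurable functions, because [g (W V)] and [g V] have the same law. *)
Lemma haar_expC q (V : T -> 'M[C]_q) (W : 'M[C]_q) (g : 'M[C]_q -> C) :
  haar_unitary Pr V -> W \is unitarymx ->
  measurableC (g : mx_space q -> C) ->
  bounded_mC (fun w => g (V w)) -> bounded_mC (fun w => g (W *m V w)) ->
  expectationC Pr (fun w => g (W *m V w)) = expectationC Pr (fun w => g (V w)).
Proof.
move=> [_ _ inv] uW [mr mi] b1 b2; rewrite /expectationC; congr (_ +i* _).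
  apply: expR_eq_law; [exact: bounded_mR_Re|exact: bounded_mR_Re|] => D mD.
  pose S : set 'M[C]_q := [set M | D (complex.Re (g M))].
  have mS : measurable_mx S.
    by apply: measurable_mx_space; rewrite -[S]setTI; exact: mr.
  exact: (inv W uW S mS).1.
apply: expR_eq_law; [exact: bounded_mR_Im|exact: bounded_mR_Im|] => D mD.
pose S : set 'M[C]_q := [set M | D (complex.Im (g M))].
have mS : measurable_mx S.
  by apply: measurable_mx_space; rewrite -[S]setTI; exact: mi.
exact: (inv W uW S mS).1.
Qed.

End HaarInvariance.
End RandomMatrixCalculus.

(** * Words in a unitary and their first order expansions *)

Section Words.
Context (R : realType).
Local Notation C := R[i].
Local Notation N := (@ComplexField.Normc.normc R).

Section WordAlgebra.
Variable p : nat.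

(** The boolean tells whether the matrix is conjugated by the unitary. *)
Definition letter := (bool * 'M[C]_p)%type.

Definition letter_val (U : 'M[C]_p) (l : letter) : 'M[C]_p :=
  if l.1 then U *m l.2 *m U^t* else l.2.

Definition word_val (U : 'M[C]_p) (L : seq letter) : 'M[C]_p :=
  foldr (fun l M => letter_val U l *m M) 1%:M L.

Definition rotated (L : seq letter) (k : nat) : bool := (nth (false, 0) L k).1.

Lemma word_val_cat U L L' : word_val U (L ++ L') = word_val U L *m word_val U L'.
Proof. by elim: L => [|l L IH] /=; rewrite ?mul1mx // IH mulmxA. Qed.

Definition adj_word (L : seq letter) : seq letter :=
  rev (map (fun l => (l.1, l.2^t*)) L).

Lemma letter_val_adj U l : (letter_val U l)^t* = letter_val U (l.1, l.2^t*).
Proof. by rewrite /letter_val /=; case: l.1 => //=; rewrite !adjmxM adjmxK mulmxA. Qed.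

Lemma word_val_adj U L : (word_val U L)^t* = word_val U (adj_word L).
Proof.
elim: L => [|l L IH] /=; first by rewrite trmx1 map_mx1.
rewrite adjmxM IH letter_val_adj /adj_word /= rev_cons -cats1 word_val_cat /=.
by rewrite mulmx1.
Qed.

(** First order variation of the word when [U] moves along [D *m U]. *)
Definition word_deriv (U D : 'M[C]_p) (L : seq letter) : 'M[C]_p :=
  \sum_(k < size L) (rotated L k)%:R *:
    (word_val U (take k L) *m D *m word_val U (drop k L) -
     word_val U (take k.+1 L) *m D *m word_val U (drop k.+1 L)).

Lemma word_deriv_cons U D l L :
  word_deriv U D (l :: L) =
  (l.1%:R *: (D *m letter_val U l - letter_val U l *m D)) *m word_val U L
  + letter_val U l *m word_deriv U D L.
Proof.
rewrite /word_deriv [in LHS]/= big_ord_recl; congr (_ + _).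
  by rewrite /rotated /= -scalemxAl take0 drop0 /= mul1mx mulmx1 mulmxBl mulmxA.
rewrite mulmx_sumr; apply: eq_bigr => k _; rewrite -scalemxAr /rotated /=.
by rewrite /bump /= add1n mulmxBr !mulmxA.
Qed.

Lemma word_derivZ U a D L : word_deriv U (a *: D) L = a *: word_deriv U D L.
Proof.
rewrite /word_deriv scaler_sumr; apply: eq_bigr => k _.
by rewrite -!scalemxAr -!scalemxAl -scalerBr !scalerA mulrC.
Qed.

Lemma word_derivD U D D' L :
  word_deriv U (D + D') L = word_deriv U D L + word_deriv U D' L.
Proof.
rewrite /word_deriv -big_split; apply: eq_bigr => k _ /=.
by rewrite !mulmxDr !mulmxDl opprD addrACA scalerDr.
Qed.

Lemma opbound_letter U (c : R) l : U \is unitarymx -> opbound c l.2 ->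
  opbound c (letter_val U l).
Proof.
move=> uU hl; rewrite /letter_val; case: l.1 => //.
rewrite -[c]mulr1 -[c * 1]mul1r mulrA; apply: opboundM.
  by apply: opboundM => //; exact: opbound_unitary.
exact/opbound_adj/opbound_unitary.
Qed.

Lemma opbound_word U (c : R) L : U \is unitarymx ->
  {in L, forall l, opbound c l.2} -> opbound (c ^+ size L) (word_val U L).
Proof.
move=> uU; elim: L => [|l L IH] hL /=; first by rewrite expr0; exact: opbound1.
rewrite exprS; apply: opboundM.
  by apply: opbound_letter => //; apply: hL; rewrite mem_head.
by apply: IH => l' hl'; apply: hL; rewrite inE hl' orbT.
Qed.

End WordAlgebra.

Section Jets.
Context (disp : measure_display) (T : measurableType disp).
Variable Pr : probability T R.

(** [F e = F0 + e F1 + O(e^2)], with a remainder bounded uniformly over the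
    sample space, so that the expansion survives taking expectations. *)
Definition jet n (F : R -> T -> 'M[C]_n) (F0 F1 : T -> 'M[C]_n) : Prop :=
  exists (r : R -> T -> 'M[C]_n) (c : R),
    (forall w, opbound c (F0 w) /\ opbound c (F1 w)) /\
    forall e, 0 < e <= 1 -> forall w, opbound c (r e w) /\
      F e w = F0 w + e%:C *: F1 w + (e ^+ 2)%:C *: r e w.

Lemma jet_cst n (F0 : T -> 'M[C]_n) c :
  (forall w, opbound c (F0 w)) -> jet (fun=> F0) F0 (fun=> 0).
Proof.
move=> hF; exists (fun _ _ => 0), `|c|; split=> [w|e _ w].
  by split; [apply: opbound_le (hF w); exact: ler_norm|exact: opbound_le (opbound0 _ _ _)].
split; first exact: opbound_le (opbound0 _ _ _).
by rewrite !scaler0 !addr0.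
Qed.

Lemma jet_const n (M : 'M[C]_n) : jet (fun _ _ => M) (fun _ : T => M) (fun=> 0).
Proof. by have [c hc] := opbound_exists M; exact: (@jet_cst n (fun=> M) c). Qed.

Lemma opboundZR n (c e : R) (M : 'M[C]_n) : 0 <= e <= 1 -> opbound c M ->
  opbound c (e%:C *: M).
Proof.
move=> /andP[e0 e1] hM; apply: opbound_le (opboundZ e%:C hM).
by rewrite normc_real ger0_norm // ler_piMl // (opbound_ge0 hM).
Qed.

Lemma jetM n (F G : R -> T -> 'M[C]_n) F0 F1 G0 G1 :
  jet F F0 F1 -> jet G G0 G1 ->
  jet (fun e w => F e w *m G e w) (fun w => F0 w *m G0 w)
      (fun w => F1 w *m G0 w + F0 w *m G1 w).
Proof.
move=> [r [c [hF hr]]] [s [c' [hG hs]]].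
exists (fun e w => F1 w *m G1 w + F0 w *m s e w + r e w *m G0 w +
   e%:C *: (F1 w *m s e w + r e w *m G1 w) + e%:C *: (e%:C *: (r e w *m s e w))).
exists (6 * (c * c')); split=> [w|e /[dup] e01 /andP[e0 e1] w].
  have [f0 f1] := hF w; have [g0 g1] := hG w.
  have c0 : 0 <= c * c' by rewrite mulr_ge0 ?(opbound_ge0 f0) ?(opbound_ge0 g0).
  split; first by apply: opbound_le (opboundM f0 g0); lra.
  by apply: opbound_le (opboundD (opboundM f1 g0) (opboundM f0 g1)); lra.
have [f0 f1] := hF w; have [g0 g1] := hG w.
have [rb ->] := hr e e01 w; have [sb ->] := hs e e01 w.
have c0 : 0 <= c * c' by rewrite mulr_ge0 ?(opbound_ge0 f0) ?(opbound_ge0 g0).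
have e01' : 0 <= e <= 1 by rewrite ltW.
split.
  have -> : 6 * (c * c') = c * c' + c * c' + c * c' + (c * c' + c * c') + c * c' by ring.
  apply: opboundD; last by do 2 apply: opboundZR => //; exact: opboundM.
  apply: opboundD; last by apply: opboundZR => //; apply: opboundD; exact: opboundM.
  by apply: opboundD; [apply: opboundD|]; exact: opboundM.
rewrite !(mulmxDl, mulmxDr) -!scalemxAl -!scalemxAr.
have -> : (e ^+ 2)%:C = e%:C * e%:C :> C by rewrite expr2 rmorphM.
move: (e%:C) => a.
move: (F0 w *m G0 w) (F1 w *m G0 w) (r e w *m G0 w) (F0 w *m G1 w) (F1 w *m G1 w)
  (r e w *m G1 w) (F0 w *m s e w) (F1 w *m s e w) (r e w *m s e w).
by move=> m1 m2 m3 m4 m5 m6 m7 m8 m9; apply/matrixP => i j; rewrite !mxE; ring.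
Qed.

Lemma jet_adj n (F : R -> T -> 'M[C]_n) F0 F1 : jet F F0 F1 ->
  jet (fun e w => (F e w)^t*) (fun w => (F0 w)^t*) (fun w => (F1 w)^t*).
Proof.
move=> [r [c [hF hr]]]; exists (fun e w => (r e w)^t*), c; split=> [w|e e01 w].
  by have [f0 f1] := hF w; split; exact: opbound_adj.
have [rb ->] := hr e e01 w; split; first exact: opbound_adj.
by rewrite !adjmxD !adjmxZ !conjC_real.
Qed.

Lemma jet_trace n (F : R -> T -> 'M[C]_n) F0 F1 : jet F F0 F1 ->
  jet (fun e w => (\tr (F e w))%:M) (fun w => (\tr (F0 w))%:M : 'M[C]_n)
      (fun w => (\tr (F1 w))%:M).
Proof.
move=> [r [c [hF hr]]].
exists (fun e w => (\tr (r e w))%:M), (n%:R * c).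
have b (M : 'M[C]_n) : opbound c M -> opbound (n%:R * c) ((\tr M)%:M : 'M[C]_n).
  by move=> hM; apply: opbound_le (opbound_trace hM) (opbound_scalar _ _).
split=> [w|e e01 w]; first by have [f0 f1] := hF w; split; exact: b.
have [rb ->] := hr e e01 w; split; first exact: b.
by rewrite !raddfD /= !mxtraceZ !scale_scalar_mx.
Qed.

(** The difference quotient of a constant is zero, and differs from the expected
    derivative by [O(e)]. *)
Lemma jet_stationary n (F : R -> T -> 'M[C]_n) F0 F1 : jet F F0 F1 ->
  bounded_mx F0 -> bounded_mx F1 ->
  (forall e, 0 < e <= 1 -> bounded_mC (fun w => \tr (F e w)) /\
     expectationC Pr (fun w => \tr (F e w)) = expectationC Pr (fun w => \tr (F0 w))) ->
  expectationC Pr (fun w => \tr (F1 w)) = 0.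
Proof.
move=> [r [c [hF hr]]] b0 b1 hE; apply/eqP; rewrite -normc_eq0.
have t0 := bounded_mC_trace b0; have t1 := bounded_mC_trace b1.
set x := expectationC Pr _.
have bound e : 0 < e <= 1 -> N x <= e * (n%:R * c).
  move=> /[dup] e01 /andP[e0 e1]; have [be Ee] := hE e e01.
  have en0 : e%:C != 0 :> C by rewrite fmorph_eq0 gt_eqF.
  have trE w : \tr (r e w) = (e%:C ^- 2) * ((\tr (F e w) - \tr (F0 w)) - e%:C * \tr (F1 w)).
    have [_ ->] := hr e e01 w; rewrite !raddfD /= !mxtraceZ rmorphXn /=; field.
    exact: en0.
  have br : bounded_mC (fun w => \tr (r e w)).
    under eq_fun do rewrite trE.
    apply: (bounded_mCM (bounded_mC_cst _ _)); apply: bounded_mCB; first exact: bounded_mCB.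
    exact: (bounded_mCM (bounded_mC_cst _ _)).
  have Er : expectationC Pr (fun w => \tr (r e w)) = - (e%:C^-1 * x).
    under eq_fun do rewrite trE.
    rewrite expCZ; last first.
      apply: bounded_mCB; first exact: bounded_mCB.
      exact: (bounded_mCM (bounded_mC_cst _ _)).
    rewrite expCB; [|exact: bounded_mCB|exact: (bounded_mCM (bounded_mC_cst _ _))].
    rewrite expCB // Ee subrr sub0r expCZ // -/x; field; exact: en0.
  have : N (- (e%:C^-1 * x)) <= n%:R * c.
    rewrite -Er; apply: le_trans (normc_expC_le _ br) _.
    rewrite -(expR_cst Pr (n%:R * c)); apply: expR_le => [||w].
    - exact: bounded_mR_normc.
    - exact: bounded_mR_cst.
    - by apply: opbound_trace; have [] := hr e e01 w.
  rewrite normcN ComplexField.Normc.normcM ComplexField.Normc.normcV normc_real gtr0_norm //.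
  by rewrite mulrC ler_pdivrMr // mulrC.
set K := n%:R * c in bound.
rewrite eq_le normc_ge0 andbT; apply/ler_addgt0Pr => d d0; rewrite add0r.
have K0 : 0 <= K.
  by have := bound 1; rewrite ltr01 lexx mul1r => /(_ isT); apply: le_trans; exact: normc_ge0.
pose e := Num.min 1 (d / (1 + K)).
have K1 : 0 < 1 + K by rewrite ltr_pwDl.
have e01 : 0 < e <= 1 by rewrite /e lt_min ltr01 divr_gt0 //= ge_min lexx.
apply: le_trans (bound e e01) _.
apply: (@le_trans _ _ (d / (1 + K) * K)).
  by apply: ler_wpM2r => //; rewrite /e ge_min lexx orbT.
rewrite mulrAC ler_pdivrMr // ler_pM2l //; lra.
Qed.

End Jets.
End Words.

(** * The loop equation *)

Section Curves.
Context (R : realType).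
Local Notation C := R[i].
Local Notation N := (@ComplexField.Normc.normc R).
Context (disp : measure_display) (T : measurableType disp).
Variable Pr : probability T R.

Section UnitaryCurve.
Variables (q : nat) (u : 'cV[C]_q).

Let Y : 'M[C]_q := u *m u^t*.
Let nu : R := norm2 u.

Definition curve_coef (e : R) : C := 2 * 'i * e%:C / (1 - 'i * (e * nu)%:C).

(** The Cayley transform of [i e u u^*]: a curve of unitary rank one
    perturbations of the identity, with velocity [2 i u u^*] at [e = 0]. Only
    the first order at [e = 0] matters, and this rational choice avoids the
    matrix exponential. *)
Definition unitary_curve (e : R) : 'M[C]_q := 1%:M + curve_coef e *: Y.

Lemma curve_denominator (x : R) : (1 - 'i * x%:C : C) != 0.
Proof. by rewrite eq_complex /= !mul0r !mul1r; apply/nandP; left; simpc; rewrite oner_neq0. Qed.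

Lemma normc_curve_denominator (x : R) : 1 <= N (1 - 'i * x%:C).
Proof.
have -> : (1 - 'i * x%:C : C) = 1 +i* (- x).
  by apply/eqP; rewrite eq_complex /=; apply/andP; split; apply/eqP; ring.
rewrite /= -[X in X <= _]sqrtr1 ler_wsqrtr // expr1n lerDl sqr_ge0 //.
Qed.

Lemma rank1_sq : Y *m Y = nu%:C *: Y.
Proof.
rewrite /Y mulmxA -(mulmxA u) [u^t* *m u]mx11_scalar -norm2E -/nu.
by rewrite mul_mx_scalar scalemxAl.
Qed.

Lemma rank1_adj : Y^t* = Y.
Proof. by rewrite /Y adjmxM adjmxK. Qed.

Lemma conjC_i : Num.conj ('i : C) = - 'i.
Proof. by apply/eqP; rewrite eq_complex /= oppr0 !eqxx. Qed.

Lemma curve_coef_unitary e :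
  let s := curve_coef e in s + Num.conj s + s * Num.conj s * nu%:C = 0.
Proof.
rewrite /curve_coef !rmorphM fmorphV !rmorphB rmorph1 !rmorphM /= !conjC_real conjC_i.
have h1 := curve_denominator (e * nu).
have h2 : (1 + 'i * (e * nu)%:C : C) != 0.
  by have := curve_denominator (- (e * nu)); rewrite rmorphN mulrN opprK.
have -> : Num.conj (2 : C) = 2 by rewrite -(rmorph_nat (real_complex R)) conjC_real.
rewrite rmorphM in h1 h2 *.
have i2 : ('i : C) ^+ 2 = -1 by exact: sqr_i.
by field : i2; rewrite h1 mulNr opprK h2.
Qed.

Lemma unitary_curve_unitary e : unitary_curve e \is unitarymx.
Proof.
apply/unitarymxP; rewrite /unitary_curve adjmxD adjmxZ trmx1 map_mx1 rank1_adj.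
rewrite mulmxDl !mulmxDr !mul1mx !mulmx1 -scalemxAl -scalemxAr.
rewrite rank1_sq !scalerA -addrA addrCA -!scalerDl.
have := curve_coef_unitary e => /= h.
rewrite addrCA -scalerDl [X in X *: Y](_ : _ = 0) ?scale0r ?addr0 // -h; ring.
Qed.

Lemma fix_first_curve e : fix_first (unitary_curve e) =
  1%:M + curve_coef e *: (block_mx (0 : 'M[C]_1) 0 0 Y : 'M[C]_(1 + q)).
Proof.
rewrite /fix_first /unitary_curve scale_block_mx !scaler0.
rewrite [X in _ = X + _](@scalar_mx_block _ 1 q).
have := @add_block_mx C 1 q 1 q 1%:M 0 0 1%:M 0 0 0 (curve_coef e *: Y).
by rewrite !addr0 => <-.
Qed.

Lemma jet_curve : jet (fun e (_ : T) => fix_first (unitary_curve e))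
  (fun=> 1%:M) (fun=> (2 * 'i) *: (block_mx (0 : 'M[C]_1) 0 0 Y : 'M[C]_(1 + q))).
Proof.
set X : 'M[C]_(1 + q) := block_mx _ _ _ _.
pose r (e : R) : C := - 2 * nu%:C / (1 - 'i * (e * nu)%:C).
have [c hc] := opbound_exists X.
have c0 := opbound_ge0 hc.
exists (fun e _ => r e *: X), (1 + 2 * c + 2 * nu * c).
have nu0 : 0 <= nu by exact: norm2_ge0.
have nuc : 0 <= nu * c by exact: mulr_ge0.
split=> [_|e e01 _]; first split.
- by apply: opbound_le (opbound1 _ _); lra.
- apply: opbound_le (opboundZ _ hc).
  rewrite ComplexField.Normc.normcM normc_nat.
  have -> : N 'i = 1 by rewrite /= expr0n add0r expr1n sqrtr1.
  lra.
split.
  apply: opbound_le (opboundZ _ hc).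
  rewrite /r !ComplexField.Normc.normcM normcN normc_nat normc_real ger0_norm //.
  rewrite ComplexField.Normc.normcV.
  have := normc_curve_denominator (e * nu); set D := N _ => D1.
  have D0 : 0 < D by exact: lt_le_trans D1.
  have : D^-1 <= 1 by rewrite invf_le1.
  have : 0 <= D^-1 by rewrite invr_ge0 ltW.
  nra.
rewrite fix_first_curve -addrA; congr (_ + _); rewrite !scalerA -scalerDl; congr (_ *: _).
rewrite /curve_coef /r; have h1 := curve_denominator (e * nu).
rewrite rmorphXn rmorphM /= in h1 *.
have i2 : ('i : C) ^+ 2 = -1 by exact: sqr_i.
by field : i2; rewrite h1.
Qed.

End UnitaryCurve.
End Curves.

Section HaarVariation.
Context (R : realType).
Local Notation C := R[i].

Section MeasurableWords.
Context (d : measure_display) (T : measurableType d).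

Lemma measurable_mxC_word n (X : T -> 'M[C]_n) (L : seq (letter R n)) :
  measurable_mxC X -> measurable_mxC (fun w => word_val (X w) L).
Proof.
move=> mX; elim: L => [|[[] M] L IH] /=; first exact: measurable_mxC_cst.
  apply: measurable_mxCM => //; apply: measurable_mxCM; last exact: measurable_mxC_adj.
  by apply: measurable_mxCM => //; exact: measurable_mxC_cst.
by apply: measurable_mxCM => //; exact: measurable_mxC_cst.
Qed.

Lemma measurable_mxC_scalar n (f : T -> C) :
  measurableC f -> measurable_mxC (fun w => (f w)%:M : 'M[C]_n).
Proof.
move=> mf i j; under eq_fun do rewrite mxE.
by case: (i == j); [under eq_fun do rewrite mulr1n|exact: measurableC_cst].
Qed.

Lemma bounded_mx_adj n (X : T -> 'M[C]_n) :
  bounded_mx X -> bounded_mx (fun w => (X w)^t*).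
Proof.
move=> [mX [c hX]]; split; first exact: measurable_mxC_adj.
by exists c => w; exact: opbound_adj.
Qed.

Lemma bounded_mx_word n (X : T -> 'M[C]_n) (L : seq (letter R n)) :
  bounded_mx X -> bounded_mx (fun w => word_val (X w) L).
Proof.
move=> bX; elim: L => [|[[] M] L IH] /=; first exact: bounded_mx_cst.
  apply: bounded_mxM => //; apply: bounded_mxM; last exact: bounded_mx_adj.
  by apply: bounded_mxM => //; exact: bounded_mx_cst.
by apply: bounded_mxM => //; exact: bounded_mx_cst.
Qed.

Lemma bounded_mx_scalar n (f : T -> C) :
  bounded_mC f -> bounded_mx (fun w => (f w)%:M : 'M[C]_n).
Proof.
move=> [mf [c hf]]; split; first exact: measurable_mxC_scalar.
by exists c => w; apply: opbound_le (hf w) (opbound_scalar _ _).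
Qed.

Lemma bounded_mxZ n a (X : T -> 'M[C]_n) :
  bounded_mx X -> bounded_mx (fun w => a *: X w).
Proof.
by move=> bX; under eq_fun do rewrite -mul_scalar_mx; apply: bounded_mxM => //; exact: bounded_mx_cst.
Qed.

Lemma bounded_mx_deriv n (X : T -> 'M[C]_n) D (L : seq (letter R n)) :
  bounded_mx X -> bounded_mx (fun w => word_deriv (X w) D L).
Proof.
move=> bX; apply: bounded_mx_sum => k; apply: bounded_mxZ.
apply: bounded_mxB; apply: bounded_mxM; try exact: bounded_mx_word.
all: by apply: bounded_mxM; [exact: bounded_mx_word|exact: bounded_mx_cst].
Qed.

End MeasurableWords.

Context (disp : measure_display) (T : measurableType disp).
Variable Pr : probability T R.

Lemma jet_ext n (F : R -> T -> 'M[C]_n) F0 F1 F0' F1' :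
  jet F F0 F1 -> F0 =1 F0' -> F1 =1 F1' -> jet F F0' F1'.
Proof. by move=> jF /funext <- /funext <-. Qed.

(** An antihermitian velocity [D] acts on each conjugated letter as a
    commutator, whence [word_deriv]. *)
Lemma jet_word n (X : R -> T -> 'M[C]_n) (X0 : T -> 'M[C]_n) (D : 'M[C]_n)
    (L : seq (letter R n)) : D^t* = - D ->
  jet X X0 (fun w => D *m X0 w) ->
  jet (fun e w => word_val (X e w) L) (fun w => word_val (X0 w) L)
      (fun w => word_deriv (X0 w) D L).
Proof.
move=> hD jX.
elim: L => [|l L IH] /=.
  by apply: jet_ext (jet_const T _) _ _ => // w; rewrite /word_deriv big_ord0.
have jl : jet (fun e w => letter_val (X e w) l) (fun w => letter_val (X0 w) l)
   (fun w => l.1%:R *: (D *m letter_val (X0 w) l - letter_val (X0 w) l *m D)).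
  case: l => [[] M]; rewrite /letter_val /=; last first.
    by apply: jet_ext (jet_const T M) _ _ => // w; rewrite scale0r.
  apply: jet_ext (jetM (jetM jX (jet_const T M)) (jet_adj jX)) _ _ => // w.
  by rewrite scale1r mulmx0 addr0 adjmxM hD mulmxN mulmxN !mulmxA.
by apply: jet_ext (jetM jl IH) _ _ => // w; rewrite word_deriv_cons.
Qed.

Lemma fix_firstM q (X Y : 'M[C]_q) : fix_first (X *m Y) = fix_first X *m fix_first Y.
Proof.
rewrite /fix_first; have := @mulmx_block C 1 q 1 q 1 q 1%:M 0 0 X 1%:M 0 0 Y.
by rewrite !mulmx0 !mul0mx !addr0 !add0r mulmx1 => ->.
Qed.

Lemma fix_first_adj q (X : 'M[C]_q) : (fix_first X)^t* = fix_first (X^t*).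
Proof.
rewrite /fix_first; have -> := @tr_block_mx C 1 q 1 q 1%:M 0 0 X.
have -> := @map_block_mx C C Num.conj 1 q 1 q 1%:M^T 0^T 0^T X^T.
by rewrite !trmx0 !map_mx0 trmx1 map_mx1.
Qed.

Lemma fix_first1 q : fix_first (1%:M : 'M[C]_q) = 1%:M.
Proof. by symmetry; exact: (@scalar_mx_block _ 1 q). Qed.

Lemma fix_first_unitary q (X : 'M[C]_q) : X \is unitarymx -> fix_first X \is unitarymx.
Proof.
by move=> /unitarymxP uX; apply/unitarymxP; rewrite fix_first_adj -fix_firstM uX fix_first1.
Qed.

Lemma bounded_mx_fix_first q (V : T -> 'M[C]_q) :
  haar_unitary Pr V -> bounded_mx (fun w => fix_first (V w)).
Proof.
move=> [mV uV _]; split; first exact: measurable_mxC_fix_first.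
by exists 1 => w; apply/opbound_unitary/fix_first_unitary.
Qed.

Section Loop.
Variables (q : nat) (V : T -> 'M[C]_q).
Hypothesis haarV : haar_unitary Pr V.
Local Notation U w := (fix_first (V w)).
Implicit Types L : seq (letter R q.+1).

(** The derivative of [tr (Y w(U)) tr (w'(U))] when [U] moves along [D U]. *)
Definition loop_integrand (Y D : 'M[C]_q.+1) L L' w : C :=
  \tr (Y *m word_deriv (U w) D L) * \tr (word_val (U w) L') +
  \tr (Y *m word_val (U w) L) * \tr (word_deriv (U w) D L').

Lemma bounded_loop_integrand Y D L L' : bounded_mC (loop_integrand Y D L L').
Proof.
have bU := bounded_mx_fix_first haarV.
apply: bounded_mCD; apply: bounded_mCM; apply: bounded_mC_trace;
  rewrite ?[X in bounded_mx X]/=; try exact: bounded_mx_word; try exact: bounded_mx_deriv.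
- by apply: bounded_mxM; [exact: bounded_mx_cst|exact: bounded_mx_deriv].
- by apply: bounded_mxM; [exact: bounded_mx_cst|exact: bounded_mx_word].
Qed.

(** By invariance the expectation of [tr (Y w(U)) tr (w'(U))] is constant along
    the curve [fix_first (unitary_curve u e) U]. *)
Lemma loop_rank1 (u : 'cV[C]_q) Y L L' :
  expectationC Pr (loop_integrand Y
    (block_mx (0 : 'M[C]_1) 0 0 (u *m u^t*) : 'M[C]_(1 + q)) L L') = 0.
Proof.
set X0 : 'M[C]_(1 + q) := block_mx _ _ _ _.
pose D : 'M[C]_q.+1 := (2 * 'i) *: X0.
have hX0 : X0^t* = X0.
  rewrite /X0 tr_block_mx (map_block_mx Num.conj) !trmx0 !map_mx0.
  by rewrite -/((u *m u^t*)^t*) rank1_adj.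
have hD : D^t* = - D.
  rewrite /D adjmxZ hX0 -scaleNr rmorphM /= conjC_i mulrN.
  by rewrite -[2](rmorph_nat (real_complex R)) conjC_real.
have bU := bounded_mx_fix_first haarV.
have [_ uV _] := haarV.
pose Ue e w := fix_first (unitary_curve u e *m V w).
have jU : jet Ue (fun w => U w) (fun w => D *m U w).
  have jU0 : jet (fun _ w => U w) (fun w => U w) (fun=> 0).
    by apply: (@jet_cst _ _ _ _ _ 1) => w; apply/opbound_unitary/fix_first_unitary.
  rewrite /Ue; under eq_fun do under eq_fun do rewrite fix_firstM.
  apply: jet_ext (jetM (jet_curve T u) jU0) _ _ => w; first by rewrite mul1mx.
  by rewrite mulmx0 addr0.
pose g (M : 'M[C]_q) := \tr (Y *m word_val (fix_first M) L *m (\tr (word_val (fix_first M) L'))%:M).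
have jF := jetM (jetM (jet_const T Y) (jet_word L hD jU)) (jet_trace (jet_word L' hD jU)).
have bg (X : T -> 'M[C]_q) : bounded_mx (fun w => fix_first (X w)) ->
    bounded_mC (fun w => g (X w)).
  move=> bX; apply: bounded_mC_trace; apply: bounded_mxM.
    by apply: bounded_mxM; [exact: bounded_mx_cst|exact: bounded_mx_word].
  by apply: bounded_mx_scalar; apply: bounded_mC_trace; exact: bounded_mx_word.
have bUe e : bounded_mx (fun w => Ue e w).
  rewrite /Ue; under eq_fun do rewrite fix_firstM.
  by apply: bounded_mxM; [exact: bounded_mx_cst|exact: bU].
have := @jet_stationary _ _ _ Pr _ _ _ _ jF.
set F1 := (X in _ -> _ -> _ -> expectationC Pr X = 0).
have eF1 w : F1 w = (2 * 'i) * loop_integrand Y X0 L L' w.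
  rewrite /F1 /loop_integrand mul0mx add0r mul_mx_scalar mxtraceD mul_mx_scalar !mxtraceZ.
  by rewrite /D !word_derivZ -!scalemxAr !mxtraceZ; ring.
rewrite (funext eF1) expCZ; last exact: bounded_loop_integrand.
move=> h; have /eqP : 2 * 'i * expectationC Pr (loop_integrand Y X0 L L') = 0 :> C.
  apply: h.
  - apply: bounded_mxM.
      by apply: bounded_mxM; [exact: bounded_mx_cst|exact: bounded_mx_word].
    by apply: bounded_mx_scalar; apply: bounded_mC_trace; exact: bounded_mx_word.
  - apply: bounded_mxD; apply: bounded_mxM.
    + apply: bounded_mxD; apply: bounded_mxM; by [exact: bounded_mx_cst|exact: bounded_mx_word|exact: bounded_mx_deriv].
    + by apply: bounded_mx_scalar; apply: bounded_mC_trace; exact: bounded_mx_word.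
    + by apply: bounded_mxM; [exact: bounded_mx_cst|exact: bounded_mx_word].
    + by apply: bounded_mx_scalar; apply: bounded_mC_trace; exact: bounded_mx_deriv.
  - move=> e e01; split; first exact: (bg (fun w => unitary_curve u e *m V w) (bUe e)).
    apply: (@haar_expC _ _ _ Pr q V (unitary_curve u e) g haarV (unitary_curve_unitary u e)).
    + apply: measurableC_trace; apply: measurable_mxCM.
        apply: measurable_mxCM; first exact: measurable_mxC_cst.
        by apply/measurable_mxC_word/measurable_mxC_fix_first/measurable_mxC_id.
      apply/measurable_mxC_scalar/measurableC_trace.
      by apply/measurable_mxC_word/measurable_mxC_fix_first/measurable_mxC_id.
    + exact: bg.
    + exact: (bg (fun w => unitary_curve u e *m V w) (bUe e)).
rewrite mulf_eq0 (negbTE (mulf_neq0 _ _)) ?pnatr_eq0 //= => [/eqP //|].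
by rewrite eq_complex /= oner_eq0 andbF.
Qed.

End Loop.
End HaarVariation.

Section LoopEquation.
Context (R : realType).
Local Notation C := R[i].
Context (disp : measure_display) (T : measurableType disp).
Variable Pr : probability T R.

Lemma trace_delta n (a b : 'I_n) (M : 'M[C]_n) : \tr (delta_mx a b *m M) = M b a.
Proof.
rewrite /mxtrace (bigD1 a) //= big1 ?addr0 => [|k /negbTE nk].
  rewrite mxE (bigD1 b) //= big1 ?addr0 => [|l /negbTE nl]; rewrite mxE ?eqxx ?mul1r //.
  by rewrite nl andbF mul0r.
by rewrite mxE big1 // => l _; rewrite mxE nk mul0r.
Qed.

Lemma mul_delta_entry n (A B : 'M[C]_n) a b c d :
  (A *m delta_mx a b *m B) c d = A c a * B b d.
Proof.
rewrite mxE (bigD1 b) //= big1 ?addr0 => [|k /negbTE nk].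
  rewrite mxE (bigD1 a) //= big1 ?addr0 => [|l /negbTE nl]; rewrite mxE ?eqxx ?mulr1 //.
  by rewrite nl mulr0.
rewrite mxE big1 ?mul0r // => l _; by rewrite mxE nk andbF mulr0.
Qed.

Section Loop.
Variables (q : nat) (V : T -> 'M[C]_q).
Hypothesis haarV : haar_unitary Pr V.
Local Notation U w := (fix_first (V w)).
Implicit Types L : seq (letter R q.+1).

Local Notation shift i := (rshift 1 i : 'I_q.+1).

Definition complement_trace (M : 'M[C]_q.+1) : C := \sum_(i < q) M (shift i) (shift i).

Lemma mxtrace_complement (M : 'M[C]_q.+1) : \tr M = M 0 0 + complement_trace M.
Proof.
rewrite /mxtrace big_ord_recl; congr (_ + _); apply: eq_bigr => i _.
by congr (M _ _); apply: val_inj.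
Qed.

Lemma loop_integrandD Y D D' L L' w :
  loop_integrand V Y (D + D') L L' w =
  loop_integrand V Y D L L' w + loop_integrand V Y D' L L' w.
Proof. by rewrite /loop_integrand !word_derivD mulmxDr !mxtraceD mulrDl mulrDr addrACA. Qed.

Lemma loop_integrandZ Y a D L L' w :
  loop_integrand V Y (a *: D) L L' w = a * loop_integrand V Y D L L' w.
Proof.
rewrite /loop_integrand !word_derivZ -scalemxAr !mxtraceZ [RHS]mulrDr; congr (_ + _);
  first by rewrite mulrA.
by rewrite mulrCA.
Qed.

Definition complement_block (M : 'M[C]_q) : 'M[C]_q.+1 :=
  block_mx (0 : 'M[C]_1) 0 0 M : 'M[C]_(1 + q).

Lemma complement_block_delta i j : complement_block (delta_mx i j) = delta_mx (shift i) (shift j).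
Proof.
apply/matrixP => a b; rewrite /complement_block /block_mx !mxE.
case: splitP => a' ea; rewrite mxE; case: splitP => b' eb; rewrite !mxE.
- by case: eqP => // /(congr1 val) /=; rewrite ea ord1.
- by case: eqP => // /(congr1 val) /=; rewrite ea ord1.
- by rewrite andbC; case: eqP => // /(congr1 val) /=; rewrite eb ord1.
- by rewrite -!val_eqE /= ea eb !eqSS.
Qed.

Lemma complement_blockD (M M' : 'M[C]_q) :
  complement_block (M + M') = complement_block M + complement_block M'.
Proof.
by rewrite /complement_block; have := @add_block_mx C 1 q 1 q 0 0 0 M 0 0 0 M'; rewrite !addr0 => ->.
Qed.

Lemma complement_blockZ a (M : 'M[C]_q) : complement_block (a *: M) = a *: complement_block M.
Proof. by rewrite /complement_block; have := @scale_block_mx C 1 q 1 q a 0 0 0 M; rewrite !scaler0 => ->. Qed.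

Definition rank1_pair n (i j : 'I_n) (a : C) : 'M[C]_n :=
  let v : 'cV[C]_n := delta_mx i 0 + a *: delta_mx j 0 in v *m v^t*.

Lemma rank1_pairE n (i j : 'I_n) a k l : rank1_pair i j a k l =
  ((k == i)%:R + a * (k == j)%:R) * ((l == i)%:R + Num.conj a * (l == j)%:R).
Proof.
rewrite /rank1_pair mxE big_ord1 !mxE !eqxx !andbT; congr (_ * _).
by rewrite rmorphD rmorphM /= !rmorph_nat.
Qed.

(** Polarisation: a matrix unit is a combination of rank one projections. *)
Lemma delta_polarization n (i j : 'I_n) :
  4 *: delta_mx i j = rank1_pair i j 1 + (-1) *: rank1_pair i j (-1)
    + 'i *: rank1_pair i j 'i%R + (- 'i) *: rank1_pair i j (- 'i)%R :> 'M[C]_n.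
Proof.
have := rank1_pairE i j; move: (rank1_pair i j) => S hS.
apply/matrixP => k l; rewrite !mxE !hS !rmorphN /= conjC_i rmorph1 -mulnb natrM.
have i2 : ('i : C) ^+ 2 = -1 by exact: sqr_i.
move: (k == i)%:R (k == j)%:R (l == i)%:R (l == j)%:R => a b c d.
by ring : i2.
Qed.

(** The integrand is linear in the velocity, which may therefore be taken to be
    any complex combination of the rank one projections. *)
Lemma loop_delta i j Y L L' :
  expectationC Pr (loop_integrand V Y (delta_mx (shift i) (shift j)) L L') = 0.
Proof.
have E0 a : expectationC Pr (loop_integrand V Y (complement_block (rank1_pair i j a)) L L') = 0.
  exact: loop_rank1.
have pol := delta_polarization i j; move: (rank1_pair i j) E0 pol => S E0 pol.
have zero (f g : T -> C) (c : C) : bounded_mC f /\ expectationC Pr f = 0 ->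
    bounded_mC g /\ expectationC Pr g = 0 ->
    bounded_mC (fun w => f w + c * g w) /\ expectationC Pr (fun w => f w + c * g w) = 0.
  move=> [bf Ef] [bg Eg].
  have bcg : bounded_mC (fun w => c * g w) by exact: (bounded_mCM (bounded_mC_cst _ _)).
  by split; [exact: bounded_mCD|rewrite (expCD Pr bf bcg) (expCZ Pr c bg) Ef Eg mulr0 addr0].
have {}E0 a : bounded_mC (loop_integrand V Y (complement_block (S a)) L L') /\
    expectationC Pr (loop_integrand V Y (complement_block (S a)) L L') = 0.
  by split; [exact: (bounded_loop_integrand haarV)|exact: E0].
have e : 4 * expectationC Pr (loop_integrand V Y (delta_mx (shift i) (shift j)) L L') = 0.
  rewrite -(expCZ Pr _ (bounded_loop_integrand haarV _ _ _ _)) -complement_block_delta.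
  under eq_fun do rewrite -loop_integrandZ -complement_blockZ pol !complement_blockD !complement_blockZ
    !loop_integrandD !loop_integrandZ.
  exact: (zero _ _ _ (zero _ _ _ (zero _ _ _ (E0 _) (E0 _)) (E0 _)) (E0 _)).2.
by move/eqP: e; rewrite mulf_eq0 pnatr_eq0 => /eqP.
Qed.

(** The two words into which the position [k] cuts [L], each traced over the
    complement. *)
Definition cut w L k : C :=
  complement_trace (word_val (U w) (take k L)) * complement_trace (word_val (U w) (drop k L)).

Definition cyclic_deriv w L : 'M[C]_q.+1 :=
  \sum_(k < size L) (rotated L k)%:R *:
    (word_val (U w) (drop k L) *m word_val (U w) (take k L) -
     word_val (U w) (drop k.+1 L) *m word_val (U w) (take k.+1 L)).

Definition cut_sum w L : C :=
  \sum_(k < size L) (rotated L k)%:R * (cut w L k - cut w L k.+1).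

Lemma sum_trace_delta (A B : 'M[C]_q.+1) :
  \sum_(i < q) \sum_(j < q) \tr (delta_mx (shift j) (shift i) *m
     (A *m delta_mx (shift i) (shift j) *m B)) = complement_trace A * complement_trace B.
Proof.
rewrite /complement_trace mulr_suml; apply: eq_bigr => i _; rewrite mulr_sumr.
by apply: eq_bigr => j _; rewrite trace_delta mul_delta_entry.
Qed.

Lemma sum_deriv_cut w L :
  \sum_(i < q) \sum_(j < q) \tr (delta_mx (shift j) (shift i) *m
     word_deriv (U w) (delta_mx (shift i) (shift j)) L) = cut_sum w L.
Proof.
rewrite /cut_sum; under eq_bigr => i _ do under eq_bigr => j _ do
  rewrite /word_deriv mulmx_sumr raddf_sum /=.
under eq_bigr => i _ do rewrite exchange_big /=.
rewrite exchange_big /=; apply: eq_bigr => k _.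
under eq_bigr => i _ do under eq_bigr => j _ do rewrite -scalemxAr mxtraceZ mulmxBr raddfB /=.
under eq_bigr => i _ do rewrite -mulr_sumr sumrB.
by rewrite -mulr_sumr sumrB !sum_trace_delta.
Qed.

Lemma trace_word_deriv w a b L :
  \tr (word_deriv (U w) (delta_mx a b) L) = cyclic_deriv w L b a.
Proof.
rewrite /word_deriv /cyclic_deriv raddf_sum summxE; apply: eq_bigr => k _ /=.
have entry c (A B : 'M[C]_q.+1) : (c *: (A - B)) b a = c * (A b a - B b a) by rewrite !mxE.
rewrite mxtraceZ raddfB /= entry; congr (_ * (_ - _)).
all: by rewrite mxtrace_mulC mulmxA mxtrace_mulC trace_delta.
Qed.

Lemma sum_loop_integrand w L L' :
  \sum_(i < q) \sum_(j < q)
    loop_integrand V (delta_mx (shift j) (shift i)) (delta_mx (shift i) (shift j)) L L' w =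
  cut_sum w L * \tr (word_val (U w) L') +
  \sum_(i < q) \sum_(j < q) word_val (U w) L (shift i) (shift j) *
     cyclic_deriv w L' (shift j) (shift i).
Proof.
rewrite /loop_integrand -sum_deriv_cut mulr_suml -big_split; apply: eq_bigr => i _ /=.
rewrite mulr_suml -big_split; apply: eq_bigr => j _ /=; congr (_ + _).
by rewrite trace_delta trace_word_deriv.
Qed.

(** The Schwinger-Dyson equation of the Haar measure on the orthogonal
    complement of the first basis vector. Summing the stationarity identities
    over all matrix units of the complement turns each insertion point of
    [word_deriv] into a product of two compressed traces (a cut), and each
    insertion point in the second trace into a trace of the two words joined. *)
Theorem loop_equation L L' :
  expectationC Pr (fun w => cut_sum w L * \tr (word_val (U w) L') +
    \sum_(i < q) \sum_(j < q) word_val (U w) L (shift i) (shift j) *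
      cyclic_deriv w L' (shift j) (shift i)) = 0.
Proof.
under eq_fun do rewrite -sum_loop_integrand.
have bl Y D : bounded_mC (loop_integrand V Y D L L') by exact: (bounded_loop_integrand haarV).
rewrite expC_sum; last by move=> i; exact: bounded_mC_sum.
rewrite big1 // => i _; rewrite expC_sum // big1 // => j _; exact: loop_delta.
Qed.

End Loop.
End LoopEquation.

(** * Second moments of unnormalised traces *)

Section TraceFluctuations.
Context (R : realType).
Local Notation C := R[i].
Local Notation N := (@ComplexField.Normc.normc R).
Context (disp : measure_display) (T : measurableType disp).
Variable Pr : probability T R.
Local Notation Er f := (\int[Pr]_w f w)%R.
Local Notation E := (expectationC Pr).

Lemma normc_bool_diff (b b' : bool) : N (b%:R - b'%:R) = (b != b')%:R.
Proof.
by case: b b' => [] [];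
   rewrite ?subrr ?subr0 ?sub0r ?normcN ?ComplexField.Normc.normc0 // normc_nat.
Qed.

(** Along an alternating word [b] flips at every step; summation by parts
    isolates the two trivial cuts [c 0] and [c m.+1]. *)
Lemma abel_summation (b c : nat -> C) m :
  \sum_(k < m.+1) b k * (c k - c k.+1) =
  b 0 * c 0 - b m * c m.+1 + \sum_(k < m) (b k.+1 - b k) * c k.+1.
Proof.
elim: m => [|m IH]; first by rewrite big_ord_recr !big_ord0 /= add0r addr0 mulrBr.
by rewrite big_ord_recr /= IH [in RHS]big_ord_recr /=; ring.
Qed.

Definition alternating_word p (L : seq (letter R p)) : bool :=
  sorted (fun l l' => l.1 != l'.1) L.

Lemma rotated_alternating p (L : seq (letter R p)) k :
  alternating_word L -> (k < size L)%N -> rotated L k = rotated L 0 (+) odd k.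
Proof.
elim: L k => // l L IH [|k] aL; first by rewrite addbF.
rewrite /= ltnS => kL; rewrite {1}/rotated /= -/(rotated L k).
rewrite IH //; last exact: path_sorted aL.
case: L aL kL {IH} => // l' L /= /andP[ll' _] _; rewrite /rotated /=.
by case: l.1 l'.1 ll' => [] [] //=; case: (odd k).
Qed.

Lemma alternating_take p (L : seq (letter R p)) k : alternating_word L -> alternating_word (take k L).
Proof. exact: take_sorted. Qed.

Lemma alternating_drop p (L : seq (letter R p)) k : alternating_word L -> alternating_word (drop k L).
Proof. exact: drop_sorted. Qed.

Section Fixed.
Variables (q : nat) (V : T -> 'M[C]_q).
Hypothesis haarV : haar_unitary Pr V.
Local Notation U w := (fix_first (V w)).
Local Notation shift i := (rshift 1 i : 'I_q.+1).
Implicit Types L : seq (letter R q.+1).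

Lemma haar_fix_first_unitary w : U w \is unitarymx.
Proof. by have [_ uV _] := haarV; exact: fix_first_unitary. Qed.

Lemma bounded_mx_haar_word L : bounded_mx (fun w => word_val (U w) L).
Proof. by apply: bounded_mx_word; exact: (bounded_mx_fix_first haarV). Qed.

Lemma bounded_trace_word L : bounded_mC (fun w => \tr (word_val (U w) L)).
Proof. exact: (bounded_mC_trace (bounded_mx_haar_word L)). Qed.

Lemma bounded_complement_word L : bounded_mC (fun w => complement_trace (word_val (U w) L)).
Proof. by apply: bounded_mC_sum => i; exact: (bounded_mC_entry _ _ (bounded_mx_haar_word L)). Qed.

Lemma bounded_cut L k : bounded_mC (fun w => cut V w L k).
Proof. by apply: bounded_mCM; exact: bounded_complement_word. Qed.

Definition cross_term L L' w : C :=
  \sum_(i < q) \sum_(j < q) word_val (U w) L (shift i) (shift j) *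
     cyclic_deriv V w L' (shift j) (shift i).

Lemma bounded_cross_term L L' : bounded_mC (cross_term L L').
Proof.
apply: bounded_mC_sum => i; apply: bounded_mC_sum => j; apply: bounded_mCM.
  exact: (bounded_mC_entry _ _ (bounded_mx_haar_word L)).
apply: bounded_mC_entry; apply: bounded_mx_sum => k; apply: bounded_mxZ.
by apply: bounded_mxB; apply: bounded_mxM; exact: bounded_mx_haar_word.
Qed.

Lemma complement_trace1 : complement_trace (1%:M : 'M[C]_q.+1) = q%:R.
Proof.
rewrite /complement_trace (eq_bigr (fun=> 1)) ?sumr_const ?card_ord // => i _.
by rewrite mxE eqxx.
Qed.

(** When the two ends of the word lie on different sides, exactly one boundary
    term of the loop equation survives; it is [q] times the quantity to be
    estimated. *)
Lemma loop_bound L L' m : size L = m.+1 -> rotated L 0 != rotated L m ->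
  q%:R * N (E (fun w => complement_trace (word_val (U w) L) * \tr (word_val (U w) L'))) <=
  \sum_(k < m) Er (fun w => N (cut V w L k.+1) * N (\tr (word_val (U w) L'))) +
  Er (fun w => N (cross_term L L' w)).
Proof.
move=> sL nr.
pose F w := complement_trace (word_val (U w) L) * \tr (word_val (U w) L').
pose S w := \sum_(k < m) ((rotated L k.+1)%:R - (rotated L k)%:R) * cut V w L k.+1.
pose H w := S w * \tr (word_val (U w) L') + cross_term L L' w.
have bF : bounded_mC F.
  by apply: bounded_mCM; [exact: bounded_complement_word|exact: bounded_trace_word].
have bS : bounded_mC S.
  by apply: bounded_mC_sum => k; apply: (bounded_mCM (bounded_mC_cst _ _)); exact: bounded_cut.
have bH : bounded_mC H.
  apply: bounded_mCD; last exact: bounded_cross_term.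
  by apply: bounded_mCM => //; exact: bounded_trace_word.
pose s : C := (rotated L 0)%:R - (rotated L m)%:R.
have := loop_equation haarV L L'.
have -> : (fun w => cut_sum V w L * \tr (word_val (U w) L') + cross_term L L' w)
    = (fun w => (s * q%:R) * F w + H w).
  apply/funext => w; rewrite /cut_sum sL.
  rewrite (abel_summation (fun k => (rotated L k)%:R) (cut V w L)) -/(S w).
  rewrite /cut take0 drop0 -sL take_size drop_size /= complement_trace1 /H /F /s; ring.
have bsF : bounded_mC (fun w => s * q%:R * F w) by exact: (bounded_mCM (bounded_mC_cst _ _)).
rewrite (expCD Pr bsF bH) (expCZ Pr _ bF) => /eqP; rewrite addr_eq0 => /eqP eH.
have Ns : N s = 1.
  by rewrite /s normc_bool_diff nr.
have -> : q%:R * N (E F) = N (E H).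
  by rewrite -[RHS](@normcN R) -eH !ComplexField.Normc.normcM Ns mul1r normc_nat.
apply: le_trans (normc_expC_le Pr bH) _.
have bt := bounded_mR_normc (bounded_trace_word L').
have bc k := bounded_mR_normc (bounded_cut L k).
have bx := bounded_mR_normc (bounded_cross_term L L').
rewrite -(expR_sum Pr); last by move=> k; exact: bounded_mRM.
rewrite -expRD //; last by apply: bounded_mR_sum => k; exact: bounded_mRM.
apply: expR_le => [||w].
- exact: bounded_mR_normc.
- by apply: bounded_mRD => //; apply: bounded_mR_sum => k; exact: bounded_mRM.
apply: le_trans (normcD _ _) _; apply: lerD => //.
rewrite ComplexField.Normc.normcM -mulr_suml; apply: ler_wpM2r; first exact: normc_ge0.
apply: le_trans (normc_sum _ _ _) _; apply: ler_sum => k _.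
rewrite ComplexField.Normc.normcM -[X in _ <= X]mul1r ler_wpM2r ?normc_ge0 //.
by rewrite normc_bool_diff; case: (_ != _).
Qed.

Lemma normc_complement_trace (c : R) (M : 'M[C]_q.+1) :
  opbound c M -> N (complement_trace M) <= N (\tr M) + c.
Proof.
move=> hM; have -> : complement_trace M = \tr M - M 0 0 by rewrite mxtrace_complement addrC addKr.
by apply: le_trans (normcB _ _) _; rewrite lerD2l; exact: opbound_entry.
Qed.

(** The joined words are traced only once, hence contribute [O(q)]: this is
    [O(1)] after division by the factor [q] of [loop_bound]. *)
Lemma normc_cross_term (M : R) L L' w : 1 <= M ->
  {in L, forall l, opbound M l.2} -> {in L', forall l, opbound M l.2} ->
  N (cross_term L L' w) <= q%:R * (M ^+ size L * ((2 * M ^+ size L') *+ size L')).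
Proof.
move=> M1 hL hL'; have uU := haar_fix_first_unitary w.
have -> : cross_term L L' w =
   \tr (mxsub (fun i => shift i) (fun i => shift i) (word_val (U w) L) *m
        mxsub (fun i => shift i) (fun i => shift i) (cyclic_deriv V w L')).
  rewrite /cross_term /mxtrace; apply: eq_bigr => i _; rewrite mxE; apply: eq_bigr => j _.
  by rewrite [in RHS]mxE; congr (_ * _); rewrite [in RHS]mxE.
have rI : injective (fun i : 'I_q => shift i) by exact: (@rshift_inj 1 q).
apply/opbound_trace/opboundM; apply: (opbound_mxsub rI rI); first exact: opbound_word.
have -> : (2 * M ^+ size L') *+ size L' = \sum_(k < size L') (2 * M ^+ size L').
  by rewrite sumr_const card_ord.
apply: opbound_sum => k _.
have h j : opbound (M ^+ size L') (word_val (U w) (drop j L') *m word_val (U w) (take j L')).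
  have -> : M ^+ size L' = M ^+ size (drop j L') * M ^+ size (take j L').
    by rewrite -exprD -size_cat -[in LHS](cat_take_drop j L') !size_cat addnC.
  by apply: opboundM; apply: opbound_word => // l hl; apply: hL';
     [exact: mem_drop hl|exact: mem_take hl].
have -> : 2 * M ^+ size L' = 1 * (M ^+ size L' + M ^+ size L') by ring.
apply: (@opbound_le _ _ _ (N (rotated L' k)%:R * (M ^+ size L' + M ^+ size L'))); last first.
  by apply: opboundZ; exact: opboundB.
apply: ler_wpM2r; last by rewrite normc_nat; case: (rotated L' k).
by rewrite addr_ge0 // exprn_ge0 // (le_trans ler01).
Qed.

(** Unnormalised traces stay bounded as the size grows: this includes centred
    letters, whose traces vanish, and leaves room for the letters of bounded
    trace that appear when matrices are padded. *)
Definition good_word (M : R) L : Prop :=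
  alternating_word L /\ {in L, forall l, opbound M l.2 /\ N (\tr l.2) <= M}.

Lemma good_word_le M M' L : M <= M' -> good_word M L -> good_word M' L.
Proof.
move=> le_M [aL hL]; split=> // l /hL [h1 h2].
by split; [exact: opbound_le h1|exact: le_trans le_M].
Qed.

Lemma good_word_take M L k : good_word M L -> good_word M (take k L).
Proof.
by move=> [aL hL]; split; [exact: alternating_take|move=> l /mem_take; exact: hL].
Qed.

Lemma good_word_drop M L k : good_word M L -> good_word M (drop k L).
Proof.
by move=> [aL hL]; split; [exact: alternating_drop|move=> l /mem_drop; exact: hL].
Qed.

End Fixed.
End TraceFluctuations.

Section SecondMoments.
Context (R : realType).
Local Notation C := R[i].
Local Notation N := (@ComplexField.Normc.normc R).
Context (disp : measure_display) (T : measurableType disp).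
Variable Pr : probability T R.
Local Notation Er f := (\int[Pr]_w f w)%R.
Local Notation E := (expectationC Pr).

Definition trace_moment_bound (n : nat) (M c : R) : Prop :=
  forall q (V : T -> 'M[C]_q), haar_unitary Pr V -> (0 < q)%N ->
  forall L : seq (letter R q.+1), (0 < size L <= n)%N -> good_word M L ->
  Er (fun w => N (\tr (word_val (fix_first (V w)) L)) ^+ 2) <= c.

Section EvenWords.
Variables (q : nat) (V : T -> 'M[C]_q).
Hypothesis haarV : haar_unitary Pr V.
Local Notation U w := (fix_first (V w)).
Implicit Types L : seq (letter R q.+1).

Lemma opbound_good_word (M : R) L w n : 1 <= M -> good_word M L -> (size L <= n)%N ->
  opbound (M ^+ n) (word_val (U w) L).
Proof.
move=> M1 [_ hL] sL; apply: (@opbound_le _ _ _ (M ^+ size L)).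
  by rewrite ler_weXn2l.
by apply: opbound_word => [|l /hL []//]; exact: (haar_fix_first_unitary haarV).
Qed.

(** Both factors of a proper cut are shorter alternating words; their second
    moments control the first moment of the product. *)
Lemma expR_cut_le (M c : R) L n k : 1 <= M -> good_word M L -> (0 < q)%N ->
  size L = n.+1 -> (0 < k < size L)%N -> trace_moment_bound n M c ->
  Er (fun w => N (cut V w L k)) <= 2 * c + 2 * (M ^+ n.+1) ^+ 2.
Proof.
move=> M1 gL q0 sL /andP[k0 kL] hc; set K := M ^+ n.+1.
have K0 : 0 <= K by rewrite exprn_ge0 // (le_trans ler01).
have gt := good_word_take k gL; have gd := good_word_drop k gL.
have st : (0 < size (take k L) <= n)%N by rewrite size_take kL k0 /= -ltnS -sL.
have sd : (0 < size (drop k L) <= n)%N by rewrite size_drop sL; lia.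
have ht := hc q V haarV q0 _ st gt; have hd := hc q V haarV q0 _ sd gd.
have bt L' := bounded_mR_normc (bounded_trace_word haarV L').
pose f w := N (\tr (word_val (U w) (take k L))) ^+ 2 +
  N (\tr (word_val (U w) (drop k L))) ^+ 2 + 2 * K ^+ 2.
have bf0 : bounded_mR (fun w => N (\tr (word_val (U w) (take k L))) ^+ 2 +
    N (\tr (word_val (U w) (drop k L))) ^+ 2).
  by apply: bounded_mRD; exact: bounded_mRX.
apply: (@le_trans _ _ (Er f)); last first.
  rewrite /f expRD //; last exact: bounded_mR_cst.
  rewrite expR_cst lerD2r expRD; [|exact: bounded_mRX..].
  by rewrite mulr2n mulrDl mul1r lerD.
apply: expR_le => [||w].
- exact/bounded_mR_normc/(bounded_cut haarV).
- by apply: bounded_mRD => //; exact: bounded_mR_cst.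
rewrite /cut ComplexField.Normc.normcM /f.
have h1 : N (complement_trace (word_val (U w) (take k L))) <=
    N (\tr (word_val (U w) (take k L))) + K.
  by apply/normc_complement_trace/opbound_good_word => //; rewrite size_take kL ltnW // -sL.
have h2 : N (complement_trace (word_val (U w) (drop k L))) <=
    N (\tr (word_val (U w) (drop k L))) + K.
  by apply/normc_complement_trace/opbound_good_word => //; rewrite size_drop sL leq_subr.
have := normc_ge0 (complement_trace (word_val (U w) (take k L))).
have := normc_ge0 (complement_trace (word_val (U w) (drop k L))).
move: h1 h2 (normc_ge0 (\tr (word_val (U w) (take k L)))) (normc_ge0 (\tr (word_val (U w) (drop k L)))).
move: (N _) (N _) (N (\tr _)) (N (\tr _)) => x1 x2 t1 t2 h1 h2 p1 p2 p3 p4.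
have : x1 * x2 <= (t1 + K) * (t2 + K) by apply: ler_pM.
have : 0 <= (t1 - t2) ^+ 2 by exact: sqr_ge0.
have : 0 <= (t1 - K) ^+ 2 by exact: sqr_ge0.
have : 0 <= (t2 - K) ^+ 2 by exact: sqr_ge0.
by nra.
Qed.

(** The loop equation for the word and its adjoint: up to a corner entry, the
    surviving boundary term is [q] times the second moment. The other terms are
    [O(q)]: a cut together with the trace of the adjoint word is a product of
    three traces, of which the third is at most of order [q] while the first two
    have second moments of order one by induction, and the joined words are
    traced once. *)
Lemma second_moment_even (M c : R) L n : 1 <= M -> good_word M L -> (0 < q)%N ->
  size L = n.+1 -> odd n -> trace_moment_bound n M c ->
  Er (fun w => N (\tr (word_val (U w) L)) ^+ 2) <=
  2 * (let K := M ^+ n.+1 in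
    K ^+ 2 + n%:R * (2 * K * (2 * c + 2 * K ^+ 2)) + K * (2 * K *+ n.+1)).
Proof.
move=> M1 gL q0 sL on hc /=; set K := M ^+ n.+1.
have K0 : 0 <= K by rewrite exprn_ge0 // (le_trans ler01).
have bt := bounded_trace_word haarV L; have bn := bounded_mR_normc bt.
set x := (X in X <= _).
have x_eq : x = N (E (fun w => \tr (word_val (U w) L) * Num.conj (\tr (word_val (U w) L)))).
  by rewrite expC_norm2.
have wK w : opbound K (word_val (U w) L) by apply: opbound_good_word => //; rewrite sL.
have tK w : N (\tr (word_val (U w) L)) <= q.+1%:R * K by exact: opbound_trace.
have tadj w : \tr (word_val (U w) (adj_word L)) = Num.conj (\tr (word_val (U w) L)).
  by rewrite -word_val_adj mxtrace_adj.
pose D w := word_val (U w) L 0 0 * Num.conj (\tr (word_val (U w) L)).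
pose F w := complement_trace (word_val (U w) L) * \tr (word_val (U w) (adj_word L)).
have bD : bounded_mC D.
  apply: bounded_mCM; last exact: bounded_mC_conj.
  exact: (bounded_mC_entry _ _ (bounded_mx_haar_word haarV L)).
have bF : bounded_mC F.
  by apply: bounded_mCM; [exact: (bounded_complement_word haarV)|exact: (bounded_trace_word haarV)].
have DF : (fun w => \tr (word_val (U w) L) * Num.conj (\tr (word_val (U w) L))) = (fun w => D w + F w).
  by apply/funext => w; rewrite /D /F tadj -mulrDl -mxtrace_complement.
(* [K t <= K^2 + t^2 / 4] for [t >= 0]: the second moment is absorbed on the left. *)
have ED : N (E D) <= K ^+ 2 + 4^-1 * x.
  apply: le_trans (normc_expC_le Pr bD) _.
  rewrite -(expR_cst Pr (K ^+ 2)) -expRZ; last exact: bounded_mRX.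
  rewrite -expRD; [|exact: bounded_mR_cst|by apply: (bounded_mRM (bounded_mR_cst _ _)); exact: bounded_mRX].
  apply: expR_le => [||w].
  - exact: bounded_mR_normc.
  - apply: bounded_mRD; first exact: bounded_mR_cst.
    by apply: (bounded_mRM (bounded_mR_cst _ _)); exact: bounded_mRX.
  rewrite /D ComplexField.Normc.normcM normc_conj.
  have := opbound_entry 0 0 (wK w); have := normc_ge0 (\tr (word_val (U w) L)).
  move: (N _) (N (word_val _ _ _ _)) => t z t0 zK.
  have : z * t <= K * t by apply: ler_wpM2r.
  have : 0 <= (K - t / 2) ^+ 2 by exact: sqr_ge0.
  by move=> h1 h2; nra.
have nr : rotated L 0 != rotated L n.
  by rewrite (@rotated_alternating _ _ _ n gL.1) ?sL // on; case: (rotated L 0).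
have := loop_bound haarV (adj_word L) sL nr; rewrite -/F.
set Sg := \sum_(k < n) _.
set Z := (X in _ <= Sg + X) => EF.
have SK : Sg <= q%:R * (n%:R * (2 * K * (2 * c + 2 * K ^+ 2))).
  have -> : q%:R * (n%:R * (2 * K * (2 * c + 2 * K ^+ 2))) =
      \sum_(k < n) q%:R * (2 * K * (2 * c + 2 * K ^+ 2)).
    by rewrite sumr_const card_ord -[RHS]mulr_natl mulrCA.
  apply: ler_sum => k _.
  have bc := bounded_mR_normc (bounded_cut haarV L k.+1).
  have bta := bounded_mR_normc (bounded_trace_word haarV (adj_word L)).
  apply: (@le_trans _ _ (Er (fun w => (2 * q%:R * K) * N (cut V w L k.+1)))).
    apply: expR_le => [||w]; first exact: bounded_mRM.
      exact: (bounded_mRM (bounded_mR_cst _ _)).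
    rewrite mulrC; apply: ler_wpM2r; first exact: normc_ge0.
    rewrite tadj normc_conj; apply: le_trans (tK w) _; apply: ler_wpM2r => //.
    by rewrite -natrM ler_nat; lia.
  have -> : q%:R * (2 * K * (2 * c + 2 * K ^+ 2)) = (2 * q%:R * K) * (2 * c + 2 * K ^+ 2).
    by move: (q%:R : R) (2 * c + 2 * K ^+ 2) => a b; ring.
  rewrite expRZ //; apply: ler_wpM2l; first by rewrite !mulr_ge0.
  by apply: (expR_cut_le M1 gL q0 sL) => //; rewrite sL !ltnS /=.
have ZK : Z <= q%:R * (K * (2 * K *+ n.+1)).
  rewrite -(expR_cst Pr (q%:R * _)); apply: expR_le => [||w].
  - exact/bounded_mR_normc/(bounded_cross_term haarV).
  - exact: bounded_mR_cst.
  have sa : size (adj_word L) = n.+1 by rewrite /adj_word size_rev size_map.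
  have := @normc_cross_term _ _ _ Pr q V haarV M L (adj_word L) w M1.
  rewrite sL sa; apply; first by move=> l /gL.2 [].
  move=> l; rewrite /adj_word mem_rev => /mapP [l' /gL.2 [h _] ->]; exact: opbound_adj.
have qp : 0 < q%:R :> R by rewrite ltr0n.
have EFK : N (E F) <= n%:R * (2 * K * (2 * c + 2 * K ^+ 2)) + K * (2 * K *+ n.+1).
  rewrite -(ler_pM2l qp) mulrDr; apply: le_trans EF _; exact: lerD.
have : x <= N (E D) + N (E F) by rewrite x_eq DF expCD //; exact: normcD.
have x0 : 0 <= x by apply: expR_ge0 => w; exact: sqr_ge0.
by move: ED EFK; set a := N (E D); set b := N (E F) => h1 h2 h3; lra.
Qed.

Lemma letter_val_merge w (l l' : letter R q.+1) : l.1 = l'.1 ->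
  letter_val (U w) l *m letter_val (U w) l' = letter_val (U w) (l.1, l.2 *m l'.2).
Proof.
have uU := haar_fix_first_unitary haarV w.
rewrite /letter_val /= => <-; case: l.1 => //.
rewrite -!mulmxA; congr (_ *m (_ *m _)); rewrite !mulmxA.
have -> : (U w)^t* *m U w = 1%:M.
  by rewrite -trmxC_unitary in uU; move/unitarymxP: uU; rewrite adjmxK.
by rewrite mul1mx.
Qed.

Lemma letter_val_sub w b (M : 'M[C]_q.+1) t :
  letter_val (U w) (b, M - t%:M) = letter_val (U w) (b, M) - t%:M.
Proof.
have uU := haar_fix_first_unitary haarV w.
rewrite /letter_val /=; case: b => //.
rewrite mulmxBr mulmxBl -scalemx1 -scalemxAr mulmx1 -scalemxAl.
by move/unitarymxP: uU => ->.
Qed.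

Lemma trace_letter w (l : letter R q.+1) : \tr (letter_val (U w) l) = \tr l.2.
Proof.
have uU := haar_fix_first_unitary haarV w.
rewrite /letter_val; case: l.1 => //; rewrite mxtrace_mulC mulmxA.
rewrite -trmxC_unitary in uU; move/unitarymxP: uU; rewrite adjmxK => ->.
by rewrite mul1mx.
Qed.

(** An odd word starts and ends on the same side, so that under the trace its
    two end letters merge; centring the product leaves shorter words. *)
Lemma second_moment_odd (M c : R) L n : 1 <= M -> good_word M L -> (0 < q)%N ->
  size L = n.+1 -> ~~ odd n -> (0 < n)%N -> trace_moment_bound n (2 * M ^+ 2) c ->
  Er (fun w => N (\tr (word_val (U w) L)) ^+ 2) <= 2 * c + 2 * M ^+ 4 * c.
Proof.
move=> M1 gL q0 sL en n0 hc.
have [l [L3 [l' eL]]] : exists l L3 l', L = l :: rcons L3 l'.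
  case: L sL {gL} => // l L; case/lastP: L => [|L3 l'] //= => [[h]|_]; last by exists l, L3, l'.
  by rewrite -h in n0.
have M2 : M <= 2 * M ^+ 2 by nra.
have s3 : size L3 = n.-1 by move: sL; rewrite eL /= size_rcons; lia.
have [n' nE] : exists n', n = n'.+2 by exists n.-2; lia.
have ll' : l'.1 = l.1.
  have h := rotated_alternating gL.1; have := h n; rewrite sL ltnSn => /(_ isT).
  by rewrite (negbTE en) addbF eL /rotated /= nE /= nth_rcons s3 nE ltnn eqxx.
have hl : opbound M l.2 by apply: (gL.2 l _).1; rewrite eL mem_head.
have hl' : opbound M l'.2 by apply: (gL.2 l' _).1; rewrite eL inE mem_rcons mem_head orbT.
pose P := l'.2 *m l.2; pose t : C := \tr P / q.+1%:R.
have q1 : q.+1%:R != 0 :> C by rewrite pnatr_eq0.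
have hP : opbound (M ^+ 2) P by rewrite expr2; exact: opboundM.
have tM : N t <= M ^+ 2.
  rewrite /t ComplexField.Normc.normcM ComplexField.Normc.normcV normc_nat.
  by rewrite ler_pdivrMr ?ltr0n // mulrC; exact: opbound_trace.
pose L1 := (l.1, P - t%:M) :: L3.
have gd1 : good_word M L3.
  have -> : L3 = take n.-1 (drop 1 L) by rewrite eL /= drop0 -cats1 -s3 take_size_cat.
  exact/good_word_take/good_word_drop.
have g3 : good_word (2 * M ^+ 2) L3 by exact: good_word_le gd1.
have g1 : good_word (2 * M ^+ 2) L1.
  split.
    have : alternating_word (l :: L3).
      have -> : l :: L3 = take n L by rewrite eL nE /= -cats1 take_cat s3 nE ltnn subnn take0 cats0.
      exact/alternating_take/gL.1.
    by rewrite /L1; case: (L3) => //= l2 L4 /andP[-> ->].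
  move=> l2; rewrite inE => /orP [/eqP -> /=|/g3.2 //]; split.
    have -> : 2 * M ^+ 2 = M ^+ 2 + M ^+ 2 by ring.
    by apply: (opboundB hP); apply: opbound_le tM (opbound_scalar _ _).
  have -> : \tr (P - t%:M) = 0.
    by rewrite raddfB /= mxtrace_scalar /t -[_ *+ _]mulr_natr mulfVK // subrr.
  rewrite ComplexField.Normc.normc0.
  by rewrite mulr_ge0 // exprn_ge0 // (le_trans ler01).
have trE w : \tr (word_val (U w) L) = \tr (word_val (U w) L1) + t * \tr (word_val (U w) L3).
  rewrite eL /= -cats1 word_val_cat /= mulmx1 mulmxA mxtrace_mulC mulmxA letter_val_merge //.
  rewrite ll' letter_val_sub mulmxBl raddfB /= -/P.
  by rewrite mul_scalar_mx mxtraceZ subrK.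
have b1 := bounded_mR_normc (bounded_trace_word haarV L1).
have b3 := bounded_mR_normc (bounded_trace_word haarV L3).
have h1 := hc q V haarV q0 L1 _ g1; have h3 := hc q V haarV q0 L3 _ g3.
have {}h1 := h1 ltac:(by rewrite /= s3 nE).
have {}h3 := h3 ltac:(by rewrite s3 nE /= leqnSn).
have bs1 : bounded_mR (fun w => 2 * N (\tr (word_val (U w) L1)) ^+ 2).
  by apply: (bounded_mRM (bounded_mR_cst _ _)); exact: bounded_mRX.
have bs3 : bounded_mR (fun w => 2 * M ^+ 4 * N (\tr (word_val (U w) L3)) ^+ 2).
  by apply: (bounded_mRM (bounded_mR_cst _ _)); exact: bounded_mRX.
apply: (@le_trans _ _ (Er (fun w => 2 * N (\tr (word_val (U w) L1)) ^+ 2 +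
    2 * M ^+ 4 * N (\tr (word_val (U w) L3)) ^+ 2))); last first.
  rewrite expRD // !expRZ; [|exact: bounded_mRX..].
  by apply: lerD; apply: ler_wpM2l => //; rewrite mulr_ge0 // exprn_ge0 // (le_trans ler01).
apply: expR_le => [||w].
- exact/bounded_mRX/bounded_mR_normc/(bounded_trace_word haarV).
- exact: bounded_mRD.
rewrite trE; have := normcD (\tr (word_val (U w) L1)) (t * \tr (word_val (U w) L3)).
rewrite ComplexField.Normc.normcM.
have := normc_ge0 (\tr (word_val (U w) L1) + t * \tr (word_val (U w) L3)).
move: (normc_ge0 (\tr (word_val (U w) L3))) (normc_ge0 t).
move: (N (_ + _)) (N (\tr (word_val (U w) L1))) (N (\tr (word_val (U w) L3))) (N t) tM.
move=> x a b s sM b0 s0 x0 hx.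
have h : x ^+ 2 <= (a + s * b) ^+ 2 by rewrite ler_pXn2r ?nnegrE //; exact: le_trans hx.
have h2 : (s * b) ^+ 2 <= M ^+ 4 * b ^+ 2.
  have -> : M ^+ 4 = (M ^+ 2) ^+ 2 by ring.
  rewrite exprMn ler_wpM2r ?sqr_ge0 // ler_pXn2r ?nnegrE //.
  by rewrite exprn_ge0 // (le_trans ler01).
have : 0 <= (a - s * b) ^+ 2 by exact: sqr_ge0.
by move: (s * b) (M ^+ 4) h h2 => y m hy hm h0; nra.
Qed.

End EvenWords.

(** As soon as the letters of an alternating word have unnormalised traces of
    order one, so has the word: this is the strong form of asymptotic freeness
    that yields the rate of convergence. *)
Lemma trace_moments n (M : R) : 1 <= M -> exists c, trace_moment_bound n M c.
Proof.
elim: n M => [|n IH] M M1; first by exists 0 => q V _ _ [].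
have [c hc] := IH M M1.
have M2 : 1 <= 2 * M ^+ 2 by nra.
have [c' hc'] := IH _ M2.
pose K := M ^+ n.+1.
pose ce := 2 * (K ^+ 2 + n%:R * (2 * K * (2 * c + 2 * K ^+ 2)) + K * (2 * K *+ n.+1)).
pose co := 2 * c' + 2 * M ^+ 4 * c'.
exists (Num.max (Num.max c ce) (Num.max co (M ^+ 2))) => q V haarV q0 L /andP[s0 sn] gL.
rewrite !le_max; move: sn; rewrite leq_eqVlt => /orP [/eqP sL|sn]; last first.
  by rewrite (hc q V haarV q0 L) // s0.
have [on|en] := boolP (odd n).
  by rewrite [X in (_ || X) || _](second_moment_even haarV M1 gL q0 sL on hc) orbT.
have [n_eq0|n_gt0] := posnP n; last first.
  by rewrite [X in _ || (X || _)](second_moment_odd haarV M1 gL q0 sL en n_gt0 hc') orbT.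
apply/orP; right; apply/orP; right.
case: L s0 sL gL => // l [|l' L]; rewrite ?n_eq0 // => _ _ gL.
rewrite -(expR_cst Pr (M ^+ 2)); apply: expR_le => [||w].
- exact/bounded_mRX/bounded_mR_normc/(bounded_trace_word haarV).
- exact: bounded_mR_cst.
rewrite /= mulmx1 (trace_letter haarV) ler_pXn2r ?nnegrE ?normc_ge0 //; last exact: le_trans M1.
by have [] := gL.2 l (mem_head _ _).
Qed.

End SecondMoments.

(** * The corner entry of an alternating word *)

Section CornerEstimate.
Context (R : realType).
Local Notation C := R[i].
Local Notation N := (@ComplexField.Normc.normc R).
Context (disp : measure_display) (T : measurableType disp).
Variable Pr : probability T R.
Local Notation Er f := (\int[Pr]_w f w)%R.
Local Notation E := (expectationC Pr).

Section FixedVector.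
Variables (q : nat).
Local Notation e0 := (delta_mx 0 0 : 'M[C]_q.+1).
Local Notation shift i := (rshift 1 i : 'I_q.+1).

Lemma fix_first_row0 (X : 'M[C]_q) j : fix_first X 0 j = (j == 0)%:R.
Proof.
rewrite /fix_first /block_mx mxE; case: splitP => i' /= ei; last by [].
rewrite mxE; case: splitP => j' /= ej; rewrite mxE.
  by rewrite !ord1 /= mulr1n; case: eqP => // h; case: h; apply: val_inj; rewrite /= ej ord1.
by case: eqP => // h; move: ej; rewrite h.
Qed.

Lemma fix_first_col0 (X : 'M[C]_q) i : fix_first X i 0 = (i == 0)%:R.
Proof.
have h := fix_first_row0 (X^t*) i; rewrite -fix_first_adj in h.
move: (fix_first X) h => Y; rewrite !mxE => h.
by rewrite -[LHS]conjCK h rmorph_nat.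
Qed.

Lemma mul_fix_first_row0 (X : 'M[C]_q) n (M : 'M[C]_(q.+1, n)) j :
  (fix_first X *m M) 0 j = M 0 j.
Proof.
rewrite mxE (bigD1 0) //= fix_first_row0 eqxx mul1r big1 ?addr0 // => k /negbTE nk.
by rewrite fix_first_row0 nk mul0r.
Qed.

Lemma mul_fix_first_col0 (X : 'M[C]_q) m (M : 'M[C]_(m, q.+1)) i :
  (M *m fix_first X) i 0 = M i 0.
Proof.
rewrite mxE (bigD1 0) //= fix_first_col0 eqxx mulr1 big1 ?addr0 // => k /negbTE nk.
by rewrite fix_first_col0 nk mulr0.
Qed.

Lemma delta_fix_first (X : 'M[C]_q) : e0 *m fix_first X = e0.
Proof.
apply/matrixP => i j; rewrite !mxE (bigD1 0) //= big1 ?addr0 => [|k /negbTE nk].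
  by rewrite mxE eqxx andbT fix_first_row0 -natrM mulnb.
by rewrite mxE nk andbF mul0r.
Qed.

Lemma fix_first_delta (X : 'M[C]_q) : fix_first X *m e0 = e0.
Proof.
apply/matrixP => i j; rewrite !mxE (bigD1 0) //= big1 ?addr0 => [|k /negbTE nk].
  by rewrite [e0 _ _]mxE fix_first_col0 eqxx /= -natrM mulnb.
by rewrite [e0 _ _]mxE nk mulr0.
Qed.

Lemma letter_val_00 (X : 'M[C]_q) (l : letter R q.+1) :
  letter_val (fix_first X) l 0 0 = l.2 0 0.
Proof.
rewrite /letter_val; case: l.1 => //.
by rewrite fix_first_adj mul_fix_first_col0 mul_fix_first_row0.
Qed.

Lemma letter_val_delta (X : 'M[C]_q) (l : letter R q.+1) :
  letter_val (fix_first X) (l.1, e0 *m l.2) = e0 *m letter_val (fix_first X) l.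
Proof.
rewrite /letter_val /=; case: l.1 => //.
by rewrite !mulmxA fix_first_delta delta_fix_first.
Qed.

Lemma complement_trace_delta (A B : 'M[C]_q.+1) :
  complement_trace (A *m (e0 *m B)) = (B *m A) 0 0 - B 0 0 * A 0 0.
Proof.
rewrite /complement_trace mxE big_ord_recl addrC addKr; apply: eq_bigr => j _.
rewrite mulmxA mul_delta_entry mulrC.
by have -> : lift ord0 j = shift j by apply: val_inj.
Qed.

(** The only loss when the first letter is split off from the corner entry of a
    word is a compressed trace of the remaining word closed up by the first
    row of that letter. *)
Lemma word_00_split (X : 'M[C]_q) (l : letter R q.+1) s :
  word_val (fix_first X) (l :: s) 0 0 =
  l.2 0 0 * word_val (fix_first X) s 0 0 +
  complement_trace (word_val (fix_first X) (rcons s (l.1, e0 *m l.2))).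
Proof.
rewrite -cats1 word_val_cat /= mulmx1 letter_val_delta complement_trace_delta.
by rewrite letter_val_00 addrC subrK.
Qed.

End FixedVector.

(** The closing letter has rank one, the first basis vector being its range. In
    the loop equation with a trivial second word, every cut is the trace
    of a shorter word, of order one in mean, times a bounded compressed trace. *)
Lemma complement_trace_small n (M : R) : 1 <= M -> exists c, 0 <= c /\
  forall q (V : T -> 'M[C]_q), haar_unitary Pr V -> (0 < q)%N ->
  forall (l : letter R q.+1) s, good_word M (l :: s) -> (size s <= n)%N ->
  q%:R * N (E (fun w => complement_trace (word_val (fix_first (V w))
     (rcons s (l.1, delta_mx 0 0 *m l.2))))) <= c.
Proof.
move=> M1; have [c hc] := trace_moments Pr n M1.
pose K := M ^+ n; have M0 : 0 <= M by exact: le_trans M1.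
have K0 : 0 <= K by rewrite exprn_ge0.
pose c' := n%:R * ((2 * M * K) * (1 + `|c| + K)).
have c'0 : 0 <= c'.
  by rewrite /c' !mulr_ge0 // addr_ge0 // addr_ge0.
exists c'; split=> // q V haarV q0 l s gs sn.
have [s_nil|s_gt0] := posnP (size s).
  move/eqP/nilP: s_nil => ->.
  have -> : (fun w => complement_trace (word_val (fix_first (V w))
      (rcons [::] (l.1, delta_mx 0 0 *m l.2)))) = (fun=> 0).
    apply/funext => w; rewrite /= mulmx1 letter_val_delta -[delta_mx 0 0 *m _]mul1mx.
    by rewrite complement_trace_delta mulmx1 mxE eqxx mulr1 subrr.
  by rewrite expC_cst ComplexField.Normc.normc0 mulr0.
set L := rcons s _; set m := size s in s_gt0 sn *.
have sL : size L = m.+1 by rewrite size_rcons.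
have gs' : good_word M s.
  by have := good_word_drop 1 gs; rewrite /= drop0.
have nr : rotated L 0 != rotated L m.
  rewrite /rotated /L !nth_rcons ltnn eqxx s_gt0 /=.
  by rewrite /m in s_gt0 *; case: s gs {sn L sL gs' m} s_gt0 => // l' s [/= /andP[h _] _] _; rewrite eq_sym.
have := loop_bound haarV [::] sL nr.
have cross0 : (fun w => N (cross_term V L [::] w)) = (fun=> 0).
  apply/funext => w; rewrite /cross_term big1 ?ComplexField.Normc.normc0 // => i _.
  by rewrite big1 // => j _; rewrite /cyclic_deriv big_ord0 mxE mulr0.
rewrite cross0 expR_cst addr0.
have tr1 w : \tr (word_val (fix_first (V w)) [::]) = q.+1%:R by exact: mxtrace1.
have bF : bounded_mC (fun w => complement_trace (word_val (fix_first (V w)) L)).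
  exact: (bounded_complement_word haarV).
have -> : (fun w => complement_trace (word_val (fix_first (V w)) L) *
     \tr (word_val (fix_first (V w)) [::])) = (fun w => q.+1%:R * complement_trace (word_val (fix_first (V w)) L)).
  by apply/funext => w; rewrite tr1 mulrC.
rewrite (expCZ Pr _ bF) ComplexField.Normc.normcM normc_nat mulrCA => h.
have qp : 0 < q.+1%:R :> R by rewrite ltr0n.
rewrite -(ler_pM2l qp); apply: le_trans h _.
have -> : q.+1%:R * c' = \sum_(k < n) q.+1%:R * ((2 * M * K) * (1 + `|c| + K)).
  by rewrite sumr_const card_ord -[RHS]mulr_natl mulrCA.
apply: (@le_trans _ _ (\sum_(k < m) q.+1%:R * ((2 * M * K) * (1 + `|c| + K)))); last first.
  rewrite !sumr_const !card_ord ler_wpMn2l // !mulr_ge0 // addr_ge0 // addr_ge0 //.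
apply: ler_sum => k _.
have bt := bounded_trace_word haarV (take k.+1 s).
have bn := bounded_mR_normc bt.
have bc := bounded_mR_normc (bounded_cut haarV L k.+1).
have gt : good_word M (take k.+1 s) by exact: good_word_take.
have gd : good_word M (drop k.+1 s) by exact: good_word_drop.
have moment : Er (fun w => N (\tr (word_val (fix_first (V w)) (take k.+1 s)))) <= 1 + `|c|.
  apply: expR_norm_le => //; apply: le_trans (ler_norm c); apply: hc => //.
  by rewrite size_takel //; apply: leq_trans (ltn_ord k) sn.
have bK : bounded_mR (fun w => N (\tr (word_val (fix_first (V w)) (take k.+1 s))) + K).
  by apply: bounded_mRD => //; exact: bounded_mR_cst.
apply: (@le_trans _ _ (Er (fun w => (q.+1%:R * (2 * M * K)) *
   (N (\tr (word_val (fix_first (V w)) (take k.+1 s))) + K)))); last first.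
  rewrite expRZ // [X in _ <= X]mulrA; apply: ler_wpM2l; first by rewrite !mulr_ge0.
  by rewrite expRD ?expR_cst ?lerD2r //; exact: bounded_mR_cst.
apply: expR_le => [||w].
- by apply: bounded_mRM => //; exact: bounded_mR_normc (bounded_trace_word haarV _).
- by apply: bounded_mRM => //; exact: bounded_mR_cst.
rewrite tr1 normc_nat [N (cut _ _ _ _) * _]mulrC -mulrA; apply: ler_wpM2l; first exact: ler0n.
rewrite /cut ComplexField.Normc.normcM mulrC.
have -> : take k.+1 L = take k.+1 s by rewrite /L -cats1 takel_cat.
have -> : drop k.+1 L = rcons (drop k.+1 s) (l.1, delta_mx 0 0 *m l.2) by rewrite /L drop_rcons.
apply: ler_pM; rewrite ?normc_ge0 //; last first.
  apply: normc_complement_trace; apply: (opbound_good_word haarV) => //.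
  by rewrite size_takel //; apply: leq_trans (ltn_ord k) sn.
rewrite -cats1 word_val_cat /= mulmx1 letter_val_delta complement_trace_delta.
have ov : opbound K (word_val (fix_first (V w)) (drop k.+1 s)).
  by apply: (opbound_good_word haarV) => //; rewrite size_drop; exact: leq_trans (leq_subr _ _) sn.
have ol : opbound M (letter_val (fix_first (V w)) l).
  apply: opbound_letter; first exact: (haar_fix_first_unitary haarV).
  by have [] := gs.2 l (mem_head _ _).
apply: le_trans (normcB _ _) _.
have -> : 2 * M * K = M * K + M * K by ring.
apply: lerD; first exact/opbound_entry/opboundM.
by rewrite ComplexField.Normc.normcM; apply: ler_pM; rewrite ?normc_ge0 //; exact: opbound_entry.
Qed.

Lemma expC_word_nil q (V : T -> 'M[C]_q) :
  E (fun w => word_val (fix_first (V w)) [::] 0 0) = 1.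
Proof. by rewrite -[RHS](expC_cst Pr 1); congr E; apply/funext => w; rewrite mxE. Qed.

(** Since the unitary fixes the first basis vector, the corner of each letter is
    deterministic, and splitting off the letters one by one costs [O(1/q)] each
    time. *)
Lemma corner_estimate n (M : R) : 1 <= M -> exists c, 0 <= c /\
  forall q (V : T -> 'M[C]_q), haar_unitary Pr V -> (0 < q)%N ->
  forall s : seq (letter R q.+1), good_word M s -> (size s <= n)%N ->
  N (E (fun w => word_val (fix_first (V w)) s 0 0) - \prod_(l <- s) l.2 0 0)
    <= c / q.+1%:R.
Proof.
move=> M1; elim: n => [|n [c [c0 IH]]].
  exists 0; split=> // q V _ _ [|//] _ _; rewrite big_nil expC_word_nil subrr.
  by rewrite ComplexField.Normc.normc0 mul0r.
have [c' [c'0 hc']] := complement_trace_small n M1.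
exists (M * c + 2 * c'); split.
  by rewrite addr_ge0 // mulr_ge0 // (le_trans ler01).
move=> q V haarV q0 [|l s] gs sn.
  rewrite big_nil expC_word_nil subrr ComplexField.Normc.normc0.
  by rewrite divr_ge0 // addr_ge0 // mulr_ge0 // (le_trans ler01).
have gs' : good_word M s by have := good_word_drop 1 gs; rewrite /= drop0.
have b0 : bounded_mC (fun w => word_val (fix_first (V w)) s 0 0).
  exact: (bounded_mC_entry _ _ (bounded_mx_haar_word haarV s)).
have bc : bounded_mC (fun w => complement_trace (word_val (fix_first (V w))
    (rcons s (l.1, delta_mx 0 0 *m l.2)))) by exact: (bounded_complement_word haarV).
have bl : bounded_mC (fun w => l.2 0 0 * word_val (fix_first (V w)) s 0 0).
  exact: (bounded_mCM (bounded_mC_cst _ _)).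
under eq_fun do rewrite word_00_split.
rewrite (expCD Pr bl bc) (expCZ Pr _ b0) big_cons addrAC -mulrBr.
apply: le_trans (normcD _ _) _; rewrite mulrDl; apply: lerD.
  rewrite ComplexField.Normc.normcM -mulrA; apply: ler_pM; rewrite ?normc_ge0 //; last exact: IH.
  by apply: opbound_entry; have [] := gs.2 l (mem_head _ _).
have := hc' q V haarV q0 l s gs sn; set x := N _ => hx.
have x0 : 0 <= x by exact: normc_ge0.
rewrite ler_pdivlMr ?ltr0n // -natr1.
have : 1 <= q%:R :> R by rewrite ler1n.
by nra.
Qed.

End CornerEstimate.

(** * From scalar words to block words *)

Section BlockEstimate.
Context (R : realType).
Local Notation C := R[i].
Local Notation N := (@ComplexField.Normc.normc R).

Section Slices.
Variables (d : nat).

(** Slices are the blocks for the other order of the two tensor factors. The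
    unitary acts on each slice by conjugation, and a product of block matrices is
    a sum of products of slices. *)
Definition slice p r (a b : 'I_d) (M : 'M[C]_(p * d, r * d)) : 'M[C]_(p, r) :=
  mxsub (fun i => mxtens_index (i, a)) (fun j => mxtens_index (j, b)) M.

Lemma mxtens_index_inj p (a : 'I_d) : injective (fun i : 'I_p => mxtens_index (i, a)).
Proof. by move=> i j /(can_inj (@mxtens_indexK p d)) []. Qed.

Lemma opbound_slice p r c a b (M : 'M[C]_(p * d, r * d)) :
  opbound c M -> opbound c (slice a b M).
Proof. by apply: opbound_mxsub; exact: mxtens_index_inj. Qed.

Lemma blockE p (M : 'M[C]_(p * d)) i j a b : block M i j a b = slice a b M i j.
Proof. by rewrite !mxE. Qed.

Lemma sum_mxtens_index (W : nmodType) p (F : 'I_(p * d) -> W) :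
  \sum_k F k = \sum_(g < d) \sum_(i < p) F (mxtens_index (i, g)).
Proof.
rewrite exchange_big pair_big /= (reindex (@mxtens_index p d)) /=; last first.
  by exists (@mxtens_unindex p d) => ? _; [exact: mxtens_indexK|exact: mxtens_unindexK].
by apply: eq_bigr => [[i g]] _.
Qed.

Lemma sliceM p r s a b (M : 'M[C]_(p * d, r * d)) (M' : 'M[C]_(r * d, s * d)) :
  slice a b (M *m M') = \sum_(g < d) slice a g M *m slice g b M'.
Proof.
apply/matrixP => i j; rewrite summxE mxE mxE sum_mxtens_index.
apply: eq_bigr => g _; rewrite mxE; apply: eq_bigr => k _; by rewrite !mxE.
Qed.

Lemma slice_tens p r a b (X : 'M[C]_(p, r)) (m : 'M[C]_d) :
  slice a b (X *t m) = m a b *: X.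
Proof. by apply/matrixP => i j; rewrite mxE tensmxE mxE mulrC. Qed.

Lemma slice1 p a b : slice a b (1%:M : 'M[C]_(p * d)) = (a == b)%:R%:M.
Proof.
apply/matrixP => i j; rewrite !mxE (inj_eq (can_inj (@mxtens_indexK p d))) xpair_eqE.
by rewrite andbC; case: (a == b); rewrite ?mul0rn.
Qed.

Lemma slice_tens1M p r s a b (X : 'M[C]_(p, r)) (M : 'M[C]_(r * d, s * d)) :
  slice a b ((X *t (1%:M : 'M[C]_d)) *m M) = X *m slice a b M.
Proof.
rewrite sliceM (bigD1 a) //= big1 ?addr0 => [|g /negbTE ng]; rewrite slice_tens mxE.
  by rewrite eqxx scale1r.
by rewrite eq_sym ng scale0r mul0mx.
Qed.

Lemma sliceM_tens1 p r s a b (M : 'M[C]_(p * d, r * d)) (X : 'M[C]_(r, s)) :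
  slice a b (M *m (X *t (1%:M : 'M[C]_d))) = slice a b M *m X.
Proof.
rewrite sliceM (bigD1 b) //= big1 ?addr0 => [|g /negbTE ng]; rewrite slice_tens mxE.
  by rewrite eqxx scale1r.
by rewrite ng scale0r mulmx0.
Qed.

Lemma slice_act p a b (U : 'M[C]_p) (M : 'M[C]_(p * d)) :
  slice a b (act U M) = U *m slice a b M *m U^t*.
Proof. by rewrite /act sliceM_tens1 slice_tens1M. Qed.

Lemma slice_inj p r (M M' : 'M[C]_(p * d, r * d)) :
  (forall a b, slice a b M = slice a b M') -> M = M'.
Proof.
move=> h; apply/matrixP => s t; case: (mxtens_indexP s) => i a; case: (mxtens_indexP t) => j b.
by have := h a b => /matrixP /(_ i j); rewrite !mxE.
Qed.

Definition block_letter p := (bool * 'M[C]_(p * d))%type.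

Definition block_letter_val p (U : 'M[C]_p) (l : block_letter p) :=
  if l.1 then act U l.2 else l.2.

Definition block_word p (U : 'M[C]_p) (L : seq (block_letter p)) : 'M[C]_(p * d) :=
  foldr (fun l M => block_letter_val U l *m M) 1%:M L.

Lemma slice_letter p (U : 'M[C]_p) l a b :
  slice a b (block_letter_val U l) = letter_val U (l.1, slice a b l.2).
Proof. by rewrite /block_letter_val /letter_val /=; case: l.1 => //; rewrite slice_act. Qed.

End Slices.

Context (disp : measure_display) (T : measurableType disp).
Variable Pr : probability T R.
Local Notation E := (expectationC Pr).

Lemma bounded_slice_block_word q d (V : T -> 'M[C]_q) (L : seq (block_letter d q.+1)) a b :
  haar_unitary Pr V -> bounded_mx (fun w => slice a b (block_word (fix_first (V w)) L)).
Proof.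
move=> haarV; elim: L a => [|l L IH] a /=.
  by under eq_fun do rewrite slice1; exact: bounded_mx_cst.
under eq_fun do rewrite sliceM.
apply: bounded_mx_sum => g; apply: bounded_mxM => //.
under eq_fun do rewrite slice_letter -[letter_val _ _]mulmx1.
exact: (bounded_mx_haar_word haarV [:: (l.1, slice a g l.2)]).
Qed.

(** Expanding the products of slices over all paths of intermediate indices,
    each path is an alternating word of scalar matrices, to which the scalar
    estimate applies. *)
Lemma block_corner_estimate d n (M : R) : 1 <= M -> exists c, 0 <= c /\
  forall q (V : T -> 'M[C]_q), haar_unitary Pr V -> (0 < q)%N ->
  forall L : seq (block_letter d q.+1),
    sorted (fun l l' => l.1 != l'.1) L ->
    {in L, forall l, opbound M l.2 /\ forall a b, N (\tr (slice a b l.2)) <= M} ->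
    (size L <= n)%N ->
  forall a b, N (E (fun w => block (block_word (fix_first (V w)) L) ord0 ord0 a b) -
     (\prod_(l <- L) block l.2 ord0 ord0) a b) <= c / q.+1%:R.
Proof.
move=> M1; have [c [c0 hc]] := corner_estimate Pr n M1.
exists (d%:R ^+ n * c); split; first by rewrite mulr_ge0 // exprn_ge0.
move=> q V haarV q0 L.
(* [s] is the part of the path that has already been chosen. *)
pose alt (b : seq bool) := sorted (fun x y => x != y) b.
have main (s : seq (letter R q.+1)) (L1 : seq (block_letter d q.+1)) a b :
    alt (map fst s ++ map fst L1) ->
    {in s, forall l, opbound M l.2 /\ N (\tr l.2) <= M} ->
    {in L1, forall l, opbound M l.2 /\ forall a b, N (\tr (slice a b l.2)) <= M} ->
    (size s + size L1 <= n)%N ->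
  N (E (fun w => (word_val (fix_first (V w)) s *m
         slice a b (block_word (fix_first (V w)) L1)) 0 0) -
     (\prod_(l <- s) l.2 0 0) * (\prod_(l <- L1) block l.2 ord0 ord0) a b)
   <= d%:R ^+ size L1 * (c / q.+1%:R).
  elim: L1 s a => [|l L1 IH] s a es hs hL sn.
    rewrite expr0 mul1r big_nil mxE.
    rewrite cats0 in es; rewrite addn0 in sn.
    have gs : good_word M s by split=> //; rewrite /alternating_word; rewrite /alt sorted_map in es.
    have [->|nab] := eqVneq a b.
      rewrite mulr1; under eq_fun do rewrite slice1 eqxx mulmx1; exact: hc.
    under eq_fun do rewrite /= slice1 (negbTE nab) raddf0 mulmx0 mxE.
    by rewrite expC_cst mulr0 subrr ComplexField.Normc.normc0 divr_ge0.
  have bw g : bounded_mC (fun w => (word_val (fix_first (V w)) (rcons s (l.1, slice a g l.2)) *m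
      slice g b (block_word (fix_first (V w)) L1)) 0 0).
    apply: bounded_mC_entry; apply: bounded_mxM.
      exact: (bounded_mx_haar_word haarV).
    exact: (bounded_slice_block_word _ _ _ haarV).
  have -> : (fun w => (word_val (fix_first (V w)) s *m
         slice a b (block_word (fix_first (V w)) (l :: L1))) 0 0) =
     (fun w => \sum_(g < d) (word_val (fix_first (V w)) (rcons s (l.1, slice a g l.2)) *m
      slice g b (block_word (fix_first (V w)) L1)) 0 0).
    apply/funext => w; rewrite /= sliceM mulmx_sumr summxE; apply: eq_bigr => g _.
    by rewrite -cats1 word_val_cat /= mulmx1 slice_letter mulmxA.
  rewrite (expC_sum Pr _ bw) big_cons [X in _ * X]mxE mulr_sumr -sumrB.
  apply: le_trans (normc_sum _ _ _) _.
  have -> : d%:R ^+ size (l :: L1) * (c / q.+1%:R) = \sum_(g < d) d%:R ^+ size L1 * (c / q.+1%:R).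
    by rewrite sumr_const card_ord [size _]/= exprS -mulrA mulr_natl.
  apply: ler_sum => g _; rewrite mulrA blockE.
  have -> : (\prod_(l <- s) l.2 0 0) * slice a g l.2 ord0 ord0 =
      \prod_(l <- rcons s (l.1, slice a g l.2)) l.2 0 0 by rewrite -cats1 big_cat big_seq1.
  apply: IH.
  - by rewrite map_rcons cat_rcons.
  - move=> l'; rewrite mem_rcons inE => /orP [/eqP -> /=|/hs //].
    by have [h1 h2] := hL l (mem_head _ _); split=> //; exact: opbound_slice.
  - by move=> l' hl'; apply: hL; rewrite inE hl' orbT.
  - by rewrite size_rcons addSnnS.
move=> sL hL sn a b.
have es : alt (map fst ([::] : seq (letter R q.+1)) ++ map fst L) by rewrite /alt sorted_map.
have := main [::] L a b es (fun _ h => match notF h with end) hL sn.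
rewrite big_nil mul1r.
have -> : (fun w => (word_val (fix_first (V w)) [::] *m
      slice a b (block_word (fix_first (V w)) L)) 0 0) =
    (fun w => block (block_word (fix_first (V w)) L) ord0 ord0 a b).
  by apply/funext => w; rewrite mul1mx blockE.
move=> h; apply: le_trans h _.
rewrite mulrA; apply: ler_wpM2r; first by rewrite invr_ge0.
have d0 : (0 < d)%N := leq_ltn_trans (leq0n a) (ltn_ord a).
by apply: ler_wpM2r => //; rewrite ler_weXn2l // ler1n.
Qed.

End BlockEstimate.

(** * Noncommutative polynomials and their evaluations *)

Section NoncommutativePolynomials.
Context (R : realType) (d : nat).
Local Notation C := R[i].
Local Notation B := 'M[C]_d.
Local Notation ncpoly := (ncpoly R d).

Section Words.
Context (I J : Type).
Local Notation factor := (Defs.factor R d I J).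
Implicit Types (u s t : seq factor) (X Y : ncpoly (I + J)).

Definition word_mul u X : ncpoly (I + J) := foldr (fun F P => Mul (embed F) P) X u.

Lemma ncprod_cat s t : ncprod (s ++ t) = word_mul s (ncprod t).
Proof. by rewrite /ncprod foldr_cat. Qed.

Lemma word_mul_rcons u F X : word_mul (rcons u F) X = word_mul u (Mul (embed F) X).
Proof. by rewrite /word_mul foldr_rcons. Qed.

Lemma nceq_word_mul u X Y : nceq X Y -> nceq (word_mul u X) (word_mul u Y).
Proof. by move=> h; elim: u => //= F u IH; apply: nceq_Mul => //; exact: nceq_refl. Qed.

Lemma nceq_word_mulD u X Y :
  nceq (word_mul u (Add X Y)) (Add (word_mul u X) (word_mul u Y)).
Proof.
elim: u => [|F u IH] /=; first exact: nceq_refl.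
apply: nceq_trans (nceq_Mul (nceq_refl _) IH) _; exact: nceq_mulDr.
Qed.

Lemma nceq_word_mulM u X Y : nceq (word_mul u (Mul X Y)) (Mul (word_mul u X) Y).
Proof.
elim: u => [|F u IH] /=; first exact: nceq_refl.
apply: nceq_trans (nceq_Mul (nceq_refl _) IH) _; exact: nceq_mulA.
Qed.

(** Products of elements of the two algebras span: a property that is stable
    under the congruence and under sums holds everywhere as soon as it holds for
    such products. The right factor is carried along as an arbitrary element, so
    that the induction is on the left factor only. *)
Lemma ncpoly_word_ind (Q : ncpoly (I + J) -> Prop) :
  (forall X Y, nceq X Y -> Q X -> Q Y) ->
  (forall X Y, Q X -> Q Y -> Q (Add X Y)) ->
  (forall s, Q (ncprod s)) -> forall P, Q P.
Proof.
move=> Qeq Qadd Qword P.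
have main P' : forall X, (forall u, Q (word_mul u X)) -> forall u, Q (word_mul u (Mul P' X)).
  elim: P' => [m|[x|y]|P1 IH1 P2 IH2|P1 IH1 P2 IH2] X hX u.
  - by have := hX (rcons u (inl (Coef m))); rewrite word_mul_rcons.
  - by have := hX (rcons u (inl (Var x))); rewrite word_mul_rcons.
  - by have := hX (rcons u (inr (Var y))); rewrite word_mul_rcons.
  - have h := Qadd _ _ (IH1 X hX u) (IH2 X hX u); apply: Qeq h.
    apply: nceq_trans (nceq_sym (nceq_word_mulD _ _ _)) _; apply: nceq_word_mul.
    exact: nceq_sym (nceq_mulDl _ _ _).
  - apply: Qeq (IH1 _ (IH2 X hX) u); apply: nceq_word_mul; exact: nceq_mulA.
have h : Q (word_mul [::] (Mul P (Coef 1%:M))).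
  by apply: main => u; have := Qword (u ++ [::]); rewrite ncprod_cat.
by apply: Qeq h; exact: nceq_mul1r.
Qed.

End Words.

Section Evaluation.
Variables (I : Type) (p : nat).
Implicit Types X : I -> 'M[C]_(p * d).

Lemma tens1M (m n : B) :
  ((1%:M : 'M[C]_p) *t m) *m ((1%:M : 'M[C]_p) *t n) = (1%:M : 'M[C]_p) *t (m *m n).
Proof. by rewrite tensmx_mul mul1mx. Qed.

Lemma tens1D (m n : B) :
  (1%:M : 'M[C]_p) *t (m + n) = (1%:M : 'M[C]_p) *t m + (1%:M : 'M[C]_p) *t n.
Proof. by apply/matrixP => s t; rewrite !mxE mulrDr. Qed.

Lemma tens1_scalar (c : C) : (1%:M : 'M[C]_p) *t (c%:M : B) = c%:M.
Proof.
apply: slice_inj => a b; rewrite slice_tens -[in RHS](mulmx1 (c%:M)) mul_scalar_mx.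
have -> : slice a b (c *: (1%:M : 'M[C]_(p * d))) = c *: slice a b 1%:M.
  by apply/matrixP => i j; rewrite !mxE.
by rewrite slice1 mxE !scale_scalar_mx mulr1 mulr_natr.
Qed.

Lemma nceval_nceq X P Q : nceq P Q -> nceval X P = nceval X Q.
Proof.
elim=> //= {P Q}.
- by move=> P Q S _ -> _ ->.
- by move=> P P' Q Q' _ -> _ ->.
- by move=> P P' Q Q' _ -> _ ->.
- by move=> P Q S; rewrite addrA.
- by move=> P Q; rewrite addrC.
- by move=> P; rewrite tensmx0 add0r.
- move=> P; have -> : - 1%:M = (-1)%:M :> B by rewrite raddfN.
  by rewrite tens1_scalar mul_scalar_mx scaleN1r tensmx0 subrr.
- by move=> P Q S; rewrite mulmxA.
- by move=> P; rewrite tens1_scalar mul1mx.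
- by move=> P; rewrite tens1_scalar mulmx1.
- by move=> P Q S; rewrite mulmxDl.
- by move=> P Q S; rewrite mulmxDr.
- by move=> m n; rewrite tens1D.
- by move=> m n; rewrite tens1M.
- by move=> c x; rewrite tens1_scalar mul_scalar_mx mul_mx_scalar.
Qed.

Lemma nceval_ncmap J (f : J -> I) X P : nceval X (ncmap f P) = nceval (X \o f) P.
Proof. by elim: P => //= P -> Q ->. Qed.

Lemma nceval_act X (U : 'M[C]_p) P : U \is unitarymx ->
  nceval (fun x => act U (X x)) P = act U (nceval X P).
Proof.
move=> uU; have UU : U^t* *m U = 1%:M.
  by rewrite -trmxC_unitary in uU; move/unitarymxP: uU; rewrite adjmxK.
elim: P => [m|x|P IHP Q IHQ|P IHP Q IHQ] //=.
- rewrite /act !tensmx_mul mulmx1 mulmx1 mul1mx; congr (_ *t _); symmetry; exact/unitarymxP.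
- by rewrite IHP IHQ /act mulmxDr mulmxDl.
- have hW : (U^t* *t (1%:M : B)) *m (U *t (1%:M : B)) = 1%:M.
    by rewrite tensmx_mul UU mul1mx tens1_scalar.
  rewrite IHP IHQ /act; move: (U^t* *t _) (U *t _) hW => W' W hW.
  by rewrite -!mulmxA (mulmxA W') hW mul1mx.
Qed.

Lemma block_bimodule (m n : B) (M : 'M[C]_(p * d)) i j :
  block ((1%:M *t m) *m M *m (1%:M *t n)) i j = m *m block M i j *m n.
Proof.
have slice1M a b (M' : 'M[C]_(p * d)) :
    slice a b ((1%:M *t m) *m M') = \sum_g m a g *: slice g b M'.
  rewrite sliceM; apply: eq_bigr => g _.
  by rewrite slice_tens -scalemxAl mul1mx.
have sliceM1 a b (M' : 'M[C]_(p * d)) :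
    slice a b (M' *m (1%:M *t n)) = \sum_g n g b *: slice a g M'.
  rewrite sliceM; apply: eq_bigr => g _.
  by rewrite slice_tens -scalemxAr mulmx1.
apply/matrixP => a b; rewrite blockE sliceM1 summxE mxE; apply: eq_bigr => g _.
rewrite mxE slice1M summxE mxE mulrC; congr (_ * _); apply: eq_bigr => h _.
by rewrite mxE blockE.
Qed.

End Evaluation.
End NoncommutativePolynomials.

Section Functionals.
Context (R : realType) (d : nat).
Local Notation C := R[i].
Local Notation N := (@ComplexField.Normc.normc R).
Local Notation B := 'M[C]_d.
Context (disp : measure_display) (T : measurableType disp).
Variable Pr : probability T R.
Local Notation E := (expectationC Pr).

Lemma bounded_mx_nceval (I : Type) p (X : I -> T -> 'M[C]_(p * d)) P :
  (forall x, bounded_mx (X x)) -> bounded_mx (fun w => nceval (X^~ w) P).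
Proof.
move=> bX; elim: P => [m|x|P IHP Q IHQ|P IHP Q IHQ] /=.
- exact: bounded_mx_cst.
- exact: bX.
- exact: bounded_mxD.
- exact: bounded_mxM.
Qed.

Lemma bounded_mx_act q (V : T -> 'M[C]_q) (M : 'M[C]_(q.+1 * d)) :
  haar_unitary Pr V -> bounded_mx (fun w => act (fix_first (V w)) M).
Proof.
move=> haarV; have bU := bounded_mx_fix_first haarV.
have [_ [c hc]] := bounded_mx_cst T M.
split.
  move=> s t; case: (mxtens_indexP s) => i a; case: (mxtens_indexP t) => j b.
  rewrite (_ : (fun w => _) = (fun w => (fix_first (V w) *m slice a b M *m (fix_first (V w))^t*) i j)).
    apply: measurable_mxCM; last exact: measurable_mxC_adj bU.1.
    by apply: measurable_mxCM; [exact: bU.1|exact: measurable_mxC_cst].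
  by apply/funext => w; rewrite -slice_act [RHS]mxE.
exists (1 * c * 1) => w.
have uU := haar_fix_first_unitary haarV w.
have uW : opbound 1 (fix_first (V w) *t (1%:M : B)).
  apply/opbound_unitary/unitarymxP.
  have -> : (fix_first (V w) *t (1%:M : B))^t* = (fix_first (V w))^t* *t (1%:M : B).
    by rewrite trmx_tens map_mxT trmx1 map_mx1.
  by rewrite tensmx_mul mul1mx; move/unitarymxP: uU => ->; rewrite tens1_scalar.
have eW : (fix_first (V w) *t (1%:M : B))^t* = (fix_first (V w))^t* *t (1%:M : B).
  by rewrite trmx_tens map_mxT trmx1 map_mx1.
rewrite /act -eW; apply: opboundM; last exact: opbound_adj.
exact: (opboundM uW (hc w)).
Qed.

Lemma phi_of_bimodule (I : Type) q (X : I -> T -> 'M[C]_(q.+1 * d)) :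
  (forall x, bounded_mx (X x)) -> bimodule_map (phi_of Pr X).
Proof.
move=> bX.
have bP P a b : bounded_mC (fun w => block (nceval (X^~ w) P) ord0 ord0 a b).
  under eq_fun do rewrite mxE; exact: (bounded_mC_entry _ _ (bounded_mx_nceval P bX)).
split.
- move=> P Q PQ; apply/matrixP => a b; rewrite !mxE; congr E; apply/funext => w.
  by rewrite (nceval_nceq _ PQ).
- move=> P Q; apply/matrixP => a b; rewrite !mxE -expCD //.
  by congr E; apply/funext => w; rewrite !mxE.
- move=> m n P; apply/matrixP => a b; rewrite !mxE.
  have -> : (fun w => block (nceval (X^~ w) (Mul (Mul (Coef m) P) (Coef n))) ord0 ord0 a b) =
     (fun w => \sum_g \sum_h (m a h * n g b) * block (nceval (X^~ w) P) ord0 ord0 h g).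
    apply/funext => w; rewrite /= block_bimodule mxE; apply: eq_bigr => g _.
    rewrite mxE mulr_suml; apply: eq_bigr => h _; by rewrite mulrAC.
  have bZ c g h : bounded_mC (fun w => c * block (nceval (X^~ w) P) ord0 ord0 h g).
    exact: (bounded_mCM (bounded_mC_cst _ _)).
  rewrite (expC_sum Pr); last by move=> g; apply: bounded_mC_sum => h; exact: bZ.
  apply: eq_bigr => g _; rewrite (expC_sum Pr) // mxE mulr_suml; apply: eq_bigr => h _.
  by rewrite (expCZ Pr _ (bP _ _ _)) mxE mulrAC.
Qed.

Lemma phi_of_cst (I : Type) q (X : I -> 'M[C]_(q.+1 * d)) P :
  phi_of Pr (fun k _ => X k) P = block (nceval X P) ord0 ord0.
Proof. by apply/matrixP => a b; rewrite mxE expC_cst. Qed.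

Lemma psi_of_cst (I : Type) q (X : I -> 'M[C]_(q.+1 * d)) P :
  psi_of Pr (fun k _ => X k) P = q.+1%:R^-1 *: \sum_k block (nceval X P) k k.
Proof. by apply/matrixP => a b; rewrite mxE expC_cst. Qed.

(** The entries of the conditional expectation [psi] are the normalised traces of
    the slices, so centring makes the traces of all slices vanish. *)
Lemma sum_block_diag p (M : 'M[C]_(p * d)) a b :
  (\sum_k block M k k) a b = \tr (slice a b M).
Proof. by rewrite summxE /mxtrace; apply: eq_bigr => k _; rewrite blockE. Qed.

Section MixedWords.
Variables (I J : Type) (q : nat) (X : I -> 'M[C]_(q.+1 * d)) (Y : J -> 'M[C]_(q.+1 * d)).
Variable V : T -> 'M[C]_q.
Hypothesis haarV : haar_unitary Pr V.
Local Notation factor := (Defs.factor R d I J).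

Definition mixed_family (x : I + J) (w : T) : 'M[C]_(q.+1 * d) :=
  sum_family (fun k _ => X k) (fun k w' => act (fix_first (V w')) (Y k)) x w.

Definition factor_val (F : factor) : 'M[C]_(q.+1 * d) :=
  match F with inl P => nceval X P | inr Q => nceval Y Q end.

Definition factor_letter (F : factor) : block_letter R d q.+1 := (~~ Defs.is_left F, factor_val F).

Lemma nceval_embed w F :
  nceval (mixed_family^~ w) (embed F) = block_letter_val (fix_first (V w)) (factor_letter F).
Proof.
case: F => [P|Q]; rewrite /embed nceval_ncmap /block_letter_val //=.
exact: (nceval_act Y Q (haar_fix_first_unitary haarV w)).
Qed.

Lemma nceval_ncprod w s :
  nceval (mixed_family^~ w) (ncprod s) =
  block_word (fix_first (V w)) (map factor_letter s).
Proof.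
elim: s => [|F s IH] /=; first by rewrite tens1_scalar.
by rewrite IH nceval_embed.
Qed.

Lemma bounded_mixed_family x : bounded_mx (mixed_family x).
Proof. by case: x => k; [exact: bounded_mx_cst|exact: bounded_mx_act]. Qed.

Lemma block_letter_00 U (l : block_letter R d q.+1) :
  block (block_letter_val (fix_first U) l) ord0 ord0 = block l.2 ord0 ord0.
Proof.
apply/matrixP => a b; rewrite !blockE slice_letter.
exact: (letter_val_00 U (l.1, slice a b l.2)).
Qed.

Lemma phi_of_embed F : phi_of Pr mixed_family (embed F) = block (factor_val F) ord0 ord0.
Proof.
apply/matrixP => a b; rewrite mxE -[RHS](expC_cst Pr); congr E; apply/funext => w.
by rewrite nceval_embed block_letter_00.
Qed.

End MixedWords.

(** Evaluating a word of polynomials gives a word of block matrices; because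
    [nceval] commutes with the action of the unitary, the factors of the second
    algebra are conjugated as a whole. *)
Lemma mixed_moment_estimate (I J : Type) n (M : R) : 1 <= M -> exists c, 0 <= c /\
  forall q (X : I -> 'M[C]_(q.+1 * d)) (Y : J -> 'M[C]_(q.+1 * d)) (V : T -> 'M[C]_q),
    haar_unitary Pr V -> (0 < q)%N ->
  forall s : seq (Defs.factor R d I J), Defs.alternating s -> (size s <= n)%N ->
    List.Forall (fun F => opbound M (factor_val X Y F) /\
      forall a b, N (\tr (slice a b (factor_val X Y F))) <= M) s ->
  forall a b, N ((phi_of Pr (mixed_family X Y V) (ncprod s) -
     \prod_(F <- s) block (factor_val X Y F) ord0 ord0) a b) <= c / q.+1%:R.
Proof.
move=> M1; have [c [c0 hc]] := block_corner_estimate Pr d n M1.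
exists c; split=> // q X Y V haarV q0 s alt sn hs a b.
have sl : sorted (fun l l' => l.1 != l'.1) (map (factor_letter X Y) s).
  rewrite sorted_map; move: alt; rewrite /Defs.alternating; apply: sub_sorted => F G /=.
  by rewrite (inj_eq negb_inj).
have hl : {in map (factor_letter X Y) s, forall l, opbound M l.2 /\
    forall a b, N (\tr (slice a b l.2)) <= M}.
  elim: hs => {s alt sn sl} [|F s hF _ IH] l //=; rewrite inE => /orP [/eqP ->|]; [exact: hF|exact: IH].
have := hc q V haarV q0 _ sl hl; rewrite size_map => /(_ sn a b).
rewrite big_map !mxE.
by under eq_fun do rewrite -(nceval_ncprod X Y haarV).
Qed.

End Functionals.

(** * Reduction to alternating centred words *)

Section Reduction.
Context (R : realType) (d : nat).
Local Notation C := R[i].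
Local Notation N := (@ComplexField.Normc.normc R).
Local Notation B := 'M[C]_d.
Local Notation ncpoly := (ncpoly R d).

(** What the reduction needs to know about operator bounds of evaluations: they
    are compatible with the algebra operations and control [psi]. Keeping them
    abstract allows bounds on one or on several evaluations at once. *)
Definition size_predicate (I : Type) (psi : ncpoly I -> B) (S : R -> ncpoly I -> Prop) : Prop :=
  [/\ forall c c' P, c <= c' -> S c P -> S c' P,
      forall c c' P Q, S c P -> S c' Q -> S (c + c') (Add P Q),
      forall c c' P Q, S c P -> S c' Q -> S (c * c') (Mul P Q),
      forall c (m : B), 0 <= c -> (forall a b, N (m a b) <= c) -> S (d%:R * d%:R * c) (Coef m) &
      forall c P, S c P -> forall a b, N ((psi P : B) a b) <= c].

Lemma size_predicateI (I : Type) (psi psi' : ncpoly I -> B) S S' :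
  size_predicate psi S -> size_predicate psi' S' ->
  size_predicate psi (fun c P => S c P /\ S' c P).
Proof.
move=> [l1 a1 p1 m1 s1] [l2 a2 p2 m2 _]; split.
- by move=> c c' P cc' [h1 h2]; split; [exact: l1 h1|exact: l2 h2].
- by move=> c c' P Q [h1 h2] [h3 h4]; split; [exact: a1|exact: a2].
- by move=> c c' P Q [h1 h2] [h3 h4]; split; [exact: p1|exact: p2].
- by move=> c m c0 hm; split; [exact: m1|exact: m2].
- by move=> c P [h1 _]; exact: s1.
Qed.

Definition shift_equivariant (I : Type) (psi : ncpoly I -> B) : Prop :=
  forall P m, psi (Add P (Coef m)) = psi P + m.

Lemma Forall_cat (U : Type) (Q : U -> Prop) s t :
  List.Forall Q (s ++ t) <-> List.Forall Q s /\ List.Forall Q t.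
Proof.
elim: s => [|x s IH] /=; first by split=> [h|[]//]; split.
split=> [h|[h1 h2]].
  by inversion h; subst; have [h1 h2] := IH.1 H2; split=> //; constructor.
by inversion h1; subst; constructor=> //; apply/IH.
Qed.

Lemma Forall_cons (U : Type) (Q : U -> Prop) x s :
  List.Forall Q (x :: s) <-> Q x /\ List.Forall Q s.
Proof. by split=> [h|[h1 h2]]; [inversion h|constructor]. Qed.

Context (I J : Type).
Local Notation factor := (Defs.factor R d I J).
Implicit Types (s u v : seq factor) (F G : factor).

Section Factors.
Variables (psi1 : ncpoly I -> B) (psi2 : ncpoly J -> B).
Variables (S1 : R -> ncpoly I -> Prop) (S2 : R -> ncpoly J -> Prop).

Definition factor_size c F : Prop := match F with inl P => S1 c P | inr Q => S2 c Q end.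

Definition factor_mean F : B := match F with inl P => psi1 P | inr Q => psi2 Q end.

Definition recenter F : factor :=
  match F with
  | inl P => inl (Add P (Coef (- psi1 P)))
  | inr Q => inr (Add Q (Coef (- psi2 Q)))
  end.

Definition scale_factor (m : B) F : factor :=
  match F with inl P => inl (Mul (Coef m) P) | inr Q => inr (Mul (Coef m) Q) end.

Definition merge_factor F G : factor :=
  match F, G with
  | inl P, inl Q => inl (Mul P Q)
  | inr P, inr Q => inr (Mul P Q)
  | _, _ => F
  end.

Lemma nceq_recenter F :
  nceq (embed F) (Add (embed (recenter F)) (Coef (factor_mean F))).
Proof.
suff h (K : Type) (P : ncpoly K) m : nceq P (Add (Add P (Coef (- m))) (Coef m)).
  by case: F => P /=; exact: h.
apply: nceq_sym; apply: nceq_trans (nceq_sym (nceq_addA _ _ _)) _.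
apply: nceq_trans (nceq_addC _ _) _.
apply: nceq_trans (nceq_Add (nceq_sym (nceq_CoefD _ _ _)) (nceq_refl _)) _.
by rewrite addNr; exact: nceq_add0.
Qed.

Lemma nceq_word_recenter u F v :
  nceq (ncprod (u ++ F :: v))
    (Add (ncprod (rcons u (recenter F) ++ v))
         (word_mul u (Mul (Coef (factor_mean F)) (ncprod v)))).
Proof.
rewrite cat_rcons !ncprod_cat.
apply: nceq_trans (nceq_word_mul _ _) (nceq_word_mulD _ _ _) => /=.
apply: nceq_trans (nceq_Mul (nceq_recenter F) (nceq_refl _)) _.
exact: nceq_mulDl.
Qed.

Lemma nceq_word_scale u m G v :
  nceq (word_mul u (Mul (Coef m) (ncprod (G :: v)))) (ncprod (u ++ scale_factor m G :: v)).
Proof.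
rewrite ncprod_cat; apply: nceq_word_mul => /=.
apply: nceq_trans (nceq_mulA _ _ _) _; apply: nceq_Mul; last exact: nceq_refl.
by case: G => P /=; exact: nceq_refl.
Qed.

Lemma nceq_word_coef u m :
  nceq (word_mul u (Mul (Coef m) (ncprod ([::] : seq factor))))
       (Mul (Mul (Coef 1%:M) (ncprod u)) (Coef m)).
Proof.
have e : ncprod u = word_mul u (ncprod [::]) by rewrite -ncprod_cat cats0.
apply: nceq_trans (nceq_word_mul u (Y := Mul (ncprod [::]) (Coef m)) _) _.
  apply: nceq_trans (nceq_mul1r _) _; exact: nceq_sym (nceq_mul1l _).
apply: nceq_trans (nceq_word_mulM _ _ _) _; rewrite -e; apply: nceq_Mul; last exact: nceq_refl.
exact: nceq_sym (nceq_mul1l _).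
Qed.

Lemma nceq_word_merge u F G v : Defs.is_left F = Defs.is_left G ->
  nceq (ncprod (u ++ F :: G :: v)) (ncprod (u ++ merge_factor F G :: v)).
Proof.
move=> FG; rewrite !ncprod_cat; apply: nceq_word_mul => /=.
apply: nceq_trans (nceq_mulA _ _ _) _; apply: nceq_Mul; last exact: nceq_refl.
by case: F G FG => P [Q|Q] //= _; exact: nceq_refl.
Qed.

Lemma not_alternating s : ~~ Defs.alternating s ->
  exists u F G v, s = u ++ F :: G :: v /\ Defs.is_left F = Defs.is_left G.
Proof.
elim: s => [|F [|G s] IH] //=; rewrite /Defs.alternating /= negb_and negbK.
case/orP => [/eqP FG|/IH [u [F' [G' [v [e h]]]]]].
  by exists [::], F, G, s.
by exists (F :: u), F', G', v; rewrite e.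
Qed.

Hypothesis sz1 : size_predicate psi1 S1.
Hypothesis sz2 : size_predicate psi2 S2.
Hypothesis sh1 : shift_equivariant psi1.
Hypothesis sh2 : shift_equivariant psi2.

Lemma factor_size_le c c' F : c <= c' -> factor_size c F -> factor_size c' F.
Proof. by case: sz1 sz2 => h1 _ _ _ _ [h2 _ _ _ _]; case: F => P /=; [exact: h1|exact: h2]. Qed.

Lemma Forall_size_le c c' s : c <= c' -> List.Forall (factor_size c) s -> List.Forall (factor_size c') s.
Proof.
move=> cc'; elim: s => [|F s IH] //.
by move=> /Forall_cons [h1 h2]; apply/Forall_cons; split; [exact: factor_size_le h1|exact: IH].
Qed.

Lemma factor_mean_le c F a b : factor_size c F -> N (factor_mean F a b) <= c.
Proof. by case: sz1 sz2 => _ _ _ _ h1 [_ _ _ _ h2]; case: F => P /= h; [exact: h1|exact: h2]. Qed.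

Lemma recenter_size c F : 0 <= c -> factor_size c F ->
  factor_size (c + d%:R * d%:R * c) (recenter F).
Proof.
move=> c0 hF; have hm a b : N ((- factor_mean F) a b) <= c.
  by rewrite mxE normcN; exact: factor_mean_le.
case: sz1 sz2 => _ a1 _ m1 _ [_ a2 _ m2 _].
by case: F hF hm => P /= hF hm; [apply: a1 => //; exact: m1|apply: a2 => //; exact: m2].
Qed.

Lemma recenter_centered F : centered psi1 psi2 (recenter F).
Proof. by case: F => P /=; rewrite ?sh1 ?sh2 subrr. Qed.

Lemma scale_factor_size c c' (m : B) F : 0 <= c -> (forall a b, N (m a b) <= c) ->
  factor_size c' F -> factor_size (d%:R * d%:R * c * c') (scale_factor m F).
Proof.
move=> c0 hm; case: sz1 sz2 => _ _ p1 m1 _ [_ _ p2 m2 _].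
by case: F => P /= hF; [apply: p1 => //; exact: m1|apply: p2 => //; exact: m2].
Qed.

Lemma merge_factor_size c c' F G : Defs.is_left F = Defs.is_left G ->
  factor_size c F -> factor_size c' G -> factor_size (c * c') (merge_factor F G).
Proof.
case: sz1 sz2 => _ _ p1 _ _ [_ _ p2 _ _].
by case: F G => P [Q|Q] //= _; [exact: p1|exact: p2].
Qed.

End Factors.

Variable eta : nat -> R -> R.
Hypothesis eta_ge0 : forall k M, 0 <= eta k M.

Definition small_on_centered psi1 psi2 S1 S2 (D : ncpoly (I + J) -> B) (delta : R) : Prop :=
  forall k M s, 1 <= M -> Defs.alternating s -> List.Forall (centered psi1 psi2) s ->
    List.Forall (factor_size S1 S2 M) s -> (size s <= k)%N ->
  forall a b, N (D (ncprod s) a b) <= eta k M * delta.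

Definition reducible_data psi1 psi2 S1 S2 (D : ncpoly (I + J) -> B) (delta : R) : Prop :=
  (size_predicate psi1 S1 /\ size_predicate psi2 S2) /\
  (shift_equivariant psi1 /\ shift_equivariant psi2) /\
  0 <= delta /\ bimodule_map D /\ small_on_centered psi1 psi2 S1 S2 D delta.

(** The constant may depend on the length, the size of the factors and [eta],
    but not on the functionals: it has to be uniform in the dimension. *)
Definition word_bound k M c : Prop :=
  forall psi1 psi2 S1 S2 D delta, reducible_data psi1 psi2 S1 S2 D delta ->
  forall s, (size s <= k)%N -> List.Forall (factor_size S1 S2 M) s ->
  forall a b, N (D (ncprod s) a b) <= c * delta.

(** Smallness on alternating centred words propagates to all words, by
    induction on the length and on the number of factors not yet centred:
    centring a factor, or merging two neighbours from the same algebra, leaves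
    shorter words. *)
Lemma word_bound_exists k M : 1 <= M -> exists c, 0 <= c /\ word_bound k M c.
Proof.
elim: k M => [|k IHk] M M1.
  exists (eta 0 1); split=> // psi1 psi2 S1 S2 D delta [_ [_ [_ [_ small]]]] [|//] _ _ a b.
  by apply: small => //; constructor.
suff inner r : forall M, 1 <= M -> exists c, 0 <= c /\
    forall psi1 psi2 S1 S2 D delta, reducible_data psi1 psi2 S1 S2 D delta ->
    forall u v, (size (u ++ v) <= k.+1)%N -> (size v <= r)%N ->
      List.Forall (centered psi1 psi2) u -> List.Forall (factor_size S1 S2 M) (u ++ v) ->
    forall a b, N (D (ncprod (u ++ v)) a b) <= c * delta.
  have [c [c0 hc]] := inner k.+1 M M1; exists c; split=> //.
  move=> psi1 psi2 S1 S2 D delta data s sk hs a b.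
  by apply: (hc _ _ _ _ _ _ data [::] s) => //; constructor.
(* [v] is the part of the word that is not yet known to be centred. *)
elim: r {M M1} => [|r IHr] M M1.
  have MM : 1 <= M * M by nra.
  have le_MM : M <= M * M by nra.
  have [c [c0 hc]] := IHk _ MM.
  exists (eta k.+1 M + c); split; first by rewrite addr_ge0.
  move=> psi1 psi2 S1 S2 D delta data u [|//]; rewrite cats0 => su _ cu hu a b.
  have [[sz1 sz2] [[sh1 sh2] [d0 [[Deq _ _] small]]]] := data; rewrite mulrDl.
  have [alt|/not_alternating [u1 [F [G [v [eu FG]]]]]] := boolP (Defs.alternating u).
    by apply: ler_wpDr; [rewrite mulr_ge0|exact: small].
  apply: ler_wpDl; first by rewrite mulr_ge0.
  rewrite eu (Deq _ _ (nceq_word_merge u1 v FG)).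
  move: hu; rewrite eu => /Forall_cat [h1 /Forall_cons [hF /Forall_cons [hG hv]]].
  apply: (hc _ _ _ _ _ _ data).
    by move: su; rewrite eu !size_cat /= !addnS ltnS.
  apply/Forall_cat; split; first exact: (Forall_size_le sz1 sz2) h1.
  apply/Forall_cons; split; first exact: (merge_factor_size sz1 sz2).
  exact: (Forall_size_le sz1 sz2) hv.
have dd0 : 0 <= d%:R * d%:R :> R by rewrite mulr_ge0.
have M0 : 0 <= M by exact: le_trans M1.
pose K : R := d%:R * d%:R * M.
have K0 : 0 <= K by rewrite mulr_ge0.
have M'1 : 1 <= M + K by rewrite ler_wpDr.
have [c' [c'0 hc']] := IHr _ M'1.
have M2 : 1 <= M + K * M by rewrite ler_wpDr // mulr_ge0.
have [c [c0 hc]] := IHk _ M2.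
exists (c' + (c + d%:R * (c * M))); split.
  by rewrite !addr_ge0 // !mulr_ge0.
move=> psi1 psi2 S1 S2 D delta data u v suv sv cu huv a b.
have [[sz1 sz2] [[sh1 sh2] [d0 [[Deq Dadd Dbi] small]]]] := data.
have le1 : M <= M + K by rewrite lerDl.
have le2 : M <= M + K * M by rewrite lerDl mulr_ge0.
case: v suv sv huv => [|F v] suv sv huv.
  rewrite !mulrDl; apply: ler_wpDr; first by rewrite addr_ge0 // !mulr_ge0.
  apply: (hc' _ _ _ _ _ _ data u [::]) => //; exact: (Forall_size_le sz1 sz2) huv.
move: (huv) => /Forall_cat [hu /Forall_cons [hF hv]].
rewrite (Deq _ _ (nceq_word_recenter psi1 psi2 u F v)) Dadd mxE.
apply: le_trans (normcD _ _) _; rewrite mulrDl; apply: lerD.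
  apply: (hc' _ _ _ _ _ _ data).
  - by rewrite cat_rcons; move: suv; rewrite !size_cat.
  - exact: sv.
  - by rewrite -cats1; apply/Forall_cat; split=> //; apply/Forall_cons; split; [exact: recenter_centered|constructor].
  - apply/Forall_cat; split; last exact: (Forall_size_le sz1 sz2) hv.
    rewrite -cats1; apply/Forall_cat; split; first exact: (Forall_size_le sz1 sz2) hu.
    by apply/Forall_cons; split; [exact: recenter_size|constructor].
have hm a' b' : N (factor_mean psi1 psi2 F a' b') <= M by exact: (factor_mean_le sz1 sz2).
rewrite mulrDl; case: v suv sv huv hv => [|G v] suv sv huv hv.
  apply: ler_wpDl; first by rewrite mulr_ge0.
  rewrite (Deq _ _ (nceq_word_coef u _)) Dbi mul1mx mxE.
  apply: le_trans (normc_sum _ _ _) _.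
  have -> : d%:R * (c * M) * delta = \sum_(j < d) (c * delta) * M.
    by rewrite sumr_const card_ord -[RHS]mulr_natl -!mulrA (mulrC delta).
  apply: ler_sum => j _; rewrite ComplexField.Normc.normcM; apply: ler_pM; rewrite ?normc_ge0 //.
  apply: (hc _ _ _ _ _ _ data); last exact: (Forall_size_le sz1 sz2) hu.
  by move: suv; rewrite size_cat /= addn1 ltnS.
apply: ler_wpDr; first by rewrite !mulr_ge0.
rewrite (Deq _ _ (nceq_word_scale u _ G v)); apply: (hc _ _ _ _ _ _ data).
  by move: suv; rewrite !size_cat /= !addnS ltnS.
apply/Forall_cat; split; first exact: (Forall_size_le sz1 sz2) hu.
move/Forall_cons: hv => [hG hv].
apply/Forall_cons; split; last exact: (Forall_size_le sz1 sz2) hv.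
apply: (factor_size_le sz1 sz2) (scale_factor_size sz1 sz2 M0 hm hG).
by rewrite -/K lerDr.
Qed.

End Reduction.

(** * Amplification of a family of block matrices *)

Section Amplification.
Context (R : realType).
Local Notation C := R[i].
Local Notation N := (@ComplexField.Normc.normc R).

Lemma opbound_tens1 r p c (Z : 'M[C]_p) :
  opbound c Z -> opbound c ((1%:M : 'M[C]_r) *t Z).
Proof.
move=> [c0 hZ]; split=> // x.
pose col s : 'cV[C]_p := \col_t x (mxtens_index (s, t)) 0.
have n2 (y : 'cV[C]_(r * p)) : norm2 y = \sum_s norm2 (\col_t y (mxtens_index (s, t)) 0).
  rewrite /norm2 sum_mxtens_index exchange_big; apply: eq_bigr => s _.
  by apply: eq_bigr => t _; rewrite mxE.
rewrite n2 (n2 x) mulr_sumr; apply: ler_sum => s _.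
have -> : \col_t (((1%:M : 'M[C]_r) *t Z) *m x) (mxtens_index (s, t)) 0 = Z *m col s.
  apply/matrixP => t o; rewrite !mxE.
  rewrite sum_mxtens_index; apply: eq_bigr => t' _.
  rewrite (bigD1 s) //= big1 ?addr0 => [|s' /negbTE ns]; first by rewrite tensmxE !mxE eqxx mul1r.
  by rewrite tensmxE mxE eq_sym ns !mul0r.
exact: hZ.
Qed.

Lemma opbound_slices d p c (M : 'M[C]_(p * d)) :
  (forall a b, opbound c (slice a b M)) -> opbound (d%:R * d%:R * c) M.
Proof.
move=> hM; pose S (a : 'I_d) : 'M[C]_(p * d, p) := select_mx R (fun i => mxtens_index (i, a)).
have Siso a : (S a)^t* *m S a = 1%:M by apply: select_mx_isometry; exact: mxtens_index_inj.
have sl a b M' : slice a b M' = (S a)^t* *m M' *m S b by exact: mxsub_select.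
have Sorth a b : (S a)^t* *m S b = (a == b)%:R%:M.
  have [->|nab] := eqVneq a b; first exact: Siso.
  by rewrite -[(S a)^t*]mulmx1 -sl slice1 (negbTE nab).
have -> : M = \sum_a \sum_b S a *m slice a b M *m (S b)^t*.
  apply: slice_inj => a b; rewrite [RHS]sl mulmx_sumr mulmx_suml.
  rewrite (bigD1 a) //= [X in _ + X]big1 ?addr0 => [|a' na].
    rewrite mulmx_sumr mulmx_suml (bigD1 b) //= [X in _ + X]big1 ?addr0 => [|b' nb].
      by rewrite !mulmxA Siso mul1mx -mulmxA Siso mulmx1.
    by rewrite -!mulmxA Sorth (negbTE nb) raddf0 !mulmx0.
  rewrite mulmx_sumr mulmx_suml big1 // => b' _.
  by rewrite !mulmxA Sorth eq_sym (negbTE na) raddf0 !mul0mx.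
have -> : d%:R * d%:R * c = \sum_(a < d) \sum_(b < d) (1 * c * 1).
  by rewrite sumr_const card_ord sumr_const card_ord mul1r mulr1 -mulrA !mulr_natl.
apply: opbound_sum => a _; apply: opbound_sum => b _.
apply: opboundM; last exact/opbound_adj/opbound_isometry.
by apply: opboundM => //; exact: opbound_isometry.
Qed.

Section Spread.
Variables (q0 r p : nat).
Hypothesis le_rp : (r * q0.+1 <= p.+1)%N.

Definition copies : 'M[C]_(p.+1, r * q0.+1) := select_mx R (widen_ord le_rp).

Lemma copies_isometry : copies^t* *m copies = 1%:M.
Proof. by apply: select_mx_isometry => i j /(congr1 val) /= /val_inj. Qed.

Definition spread (Z : 'M[C]_q0.+1) : 'M[C]_p.+1 :=
  copies *m ((1%:M : 'M[C]_r) *t Z) *m copies^t*.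

(** [spread] is multiplicative but not unital; a scalar [z] on the coordinates
    not covered by the copies repairs this. *)
Definition spread_ext (Z : 'M[C]_q0.+1) (z : C) : 'M[C]_p.+1 :=
  spread Z + z *: (1%:M - spread 1%:M).

Lemma spreadD Z Z' : spread (Z + Z') = spread Z + spread Z'.
Proof.
rewrite /spread; have -> : (1%:M : 'M[C]_r) *t (Z + Z') = 1%:M *t Z + 1%:M *t Z'.
  by apply/matrixP => s t; rewrite !mxE mulrDr.
by rewrite mulmxDr mulmxDl.
Qed.

Lemma spreadZ a Z : spread (a *: Z) = a *: spread Z.
Proof.
rewrite /spread; have -> : (1%:M : 'M[C]_r) *t (a *: Z) = a *: (1%:M *t Z).
  by apply/matrixP => s t; rewrite !mxE mulrCA.
by rewrite -scalemxAr -scalemxAl.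
Qed.

Lemma spreadM Z Z' : spread (Z *m Z') = spread Z *m spread Z'.
Proof.
rewrite /spread -[X in X *t (Z *m Z')](mul1mx 1%:M) -tensmx_mul !mulmxA.
by rewrite -(mulmxA _ (copies^t*) copies) copies_isometry mulmx1.
Qed.

Lemma spread_extD Z Z' z z' : spread_ext (Z + Z') (z + z') = spread_ext Z z + spread_ext Z' z'.
Proof. by rewrite /spread_ext spreadD scalerDl addrACA. Qed.

Lemma spread_extM Z Z' z z' :
  spread_ext (Z *m Z') (z * z') = spread_ext Z z *m spread_ext Z' z'.
Proof.
rewrite /spread_ext spreadM; set Q := 1%:M - _.
have ZQ Z1 : spread Z1 *m Q = 0.
  by rewrite /Q mulmxBr mulmx1 -spreadM mulmx1 subrr.
have QZ Z1 : Q *m spread Z1 = 0.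
  by rewrite /Q mulmxBl mul1mx -spreadM mul1mx subrr.
have QQ : Q *m Q = Q by rewrite {2}/Q mulmxBr mulmx1 QZ subr0.
by rewrite mulmxDl !mulmxDr -!scalemxAl -!scalemxAr ZQ QZ QQ !scaler0 addr0 add0r scalerA.
Qed.

Lemma spread_ext0 : spread_ext 0 0 = 0.
Proof.
have h := spreadZ 0 0; rewrite !scale0r in h.
by rewrite /spread_ext h scale0r addr0.
Qed.

Lemma spread_ext_sum (K : Type) (s : seq K) (Z : K -> 'M[C]_q0.+1) (z : K -> C) :
  spread_ext (\sum_(k <- s) Z k) (\sum_(k <- s) z k) = \sum_(k <- s) spread_ext (Z k) (z k).
Proof.
elim: s => [|k s IH]; first by rewrite !big_nil spread_ext0.
by rewrite !big_cons spread_extD IH.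
Qed.

Lemma spread_ext_scalar a : spread_ext (a *: 1%:M) a = a *: 1%:M.
Proof. by rewrite /spread_ext spreadZ scalerBr addrC subrK. Qed.

Lemma opbound_spread c Z : opbound c Z -> opbound c (spread Z).
Proof.
move=> hZ; rewrite -[c]mul1r -[1 * c]mulr1.
have hJ : opbound 1 copies by exact/opbound_isometry/copies_isometry.
by apply: opboundM; [apply: opboundM => //; exact: opbound_tens1|exact: opbound_adj].
Qed.

Lemma opbound_spread_ext c Z z : opbound c Z -> N z <= c -> opbound (3 * c) (spread_ext Z z).
Proof.
move=> hZ hz; have -> : 3 * c = c + c * 2 by ring.
apply: opboundD; first exact: opbound_spread.
have h : opbound (1 + 1) (1%:M - spread 1%:M).
  by apply: opboundB; [exact: opbound1|apply: opbound_spread; exact: opbound1].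
apply: (@opbound_le _ _ _ (N z * (1 + 1))); last exact: opboundZ.
by rewrite -[1 + 1]/(2%:R) ler_wpM2r.
Qed.

Lemma trace_spread Z : \tr (spread Z) = r%:R * \tr Z.
Proof.
rewrite /spread mxtrace_mulC mulmxA copies_isometry mul1mx /mxtrace.
rewrite sum_mxtens_index mulr_sumr; apply: eq_bigr => t _.
under eq_bigr => s _ do rewrite tensmxE mxE eqxx mul1r.
by rewrite sumr_const card_ord -[LHS]mulr_natl.
Qed.

(** A traceless matrix stays nearly traceless: only the fewer than [q0.+1]
    uncovered coordinates contribute. *)
Lemma trace_spread_ext Z z :
  \tr Z = 0 -> (p.+1 < r * q0.+1 + q0.+1)%N -> N (\tr (spread_ext Z z)) <= q0.+1%:R * N z.
Proof.
move=> Z0 lt_p; rewrite /spread_ext mxtraceD trace_spread Z0 mulr0 add0r mxtraceZ.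
rewrite raddfB /= mxtrace1 trace_spread mxtrace1 -natrM -natrB //.
rewrite ComplexField.Normc.normcM normc_nat mulrC; apply: ler_wpM2r; first exact: normc_ge0.
by rewrite ler_nat; lia.
Qed.

Lemma spread_00 Z : (0 < r)%N -> spread Z 0 0 = Z 0 0.
Proof.
move=> r0; rewrite /spread.
have c0 (k : 'I_(r * q0.+1)) : copies 0 k = (k == mxtens_index (Ordinal r0, ord0))%:R.
  by rewrite mxE -!val_eqE /= mul0n addn0 eq_sym.
rewrite -mulmxA mxE (bigD1 (mxtens_index (Ordinal r0, ord0))) //= big1 ?addr0; last first.
  by move=> k /negbTE nk; rewrite c0 nk mul0r.
have c0' (k : 'I_(r * q0.+1)) : (copies^t*) k 0 = (k == mxtens_index (Ordinal r0, ord0))%:R.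
  by rewrite [LHS]mxE [X in Num.conj X]mxE c0 rmorph_nat.
rewrite c0 eqxx mul1r mxE (bigD1 (mxtens_index (Ordinal r0, ord0))) //= big1 ?addr0; last first.
  by move=> k /negbTE nk; rewrite c0' nk mulr0.
by rewrite c0' eqxx mulr1 tensmxE mxE eqxx mul1r.
Qed.

Lemma spread_ext_00 Z z : (0 < r)%N -> spread_ext Z z 0 0 = Z 0 0.
Proof.
move=> r0; rewrite /spread_ext; have := spread_00 Z r0; have := spread_00 1%:M r0.
by move: (spread _) (spread _) => A B hA hB; rewrite !mxE hA hB mxE subrr mulr0 addr0.
Qed.

Section AmplifiedFamily.
Variables (d : nat) (I : Type) (X : I -> 'M[C]_(q0.+1 * d)).

(** The amplification acts on the scalar factor only; the coefficient algebra is
    left alone. *)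
Definition amplify (x : I) : 'M[C]_(p.+1 * d) :=
  \matrix_(s, t) spread (slice (mxtens_unindex s).2 (mxtens_unindex t).2 (X x))
     (mxtens_unindex s).1 (mxtens_unindex t).1.

Lemma slice_amplify x a b : slice a b (amplify x) = spread (slice a b (X x)).
Proof. by apply/matrixP => i j; rewrite [LHS]mxE [LHS]mxE !mxtens_indexK. Qed.

(** The value at the origin of a polynomial, which is how it acts on the
    coordinates that are not covered by the copies. *)
Definition value_at_0 (P : ncpoly R d I) : 'M[C]_(1 * d) := nceval (fun=> 0) P.

Lemma slice_nceval_amplify P a b :
  slice a b (nceval amplify P) =
  spread_ext (slice a b (nceval X P)) (slice a b (value_at_0 P) 0 0).
Proof.
have sliceD n m (M M' : 'M[C]_(n * d, m * d)) a' b' :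
    slice a' b' (M + M') = slice a' b' M + slice a' b' M'.
  by apply/matrixP => i j; rewrite !mxE.
rewrite /value_at_0; elim: P a b => [m|x|P IHP Q IHQ|P IHP Q IHQ] a b /=.
- rewrite !slice_tens [X in spread_ext _ X]mxE mxE mulr1; symmetry; exact: spread_ext_scalar.
- by rewrite slice_amplify /spread_ext !mxE scale0r addr0.
- by rewrite !sliceD [X in spread_ext _ X]mxE spread_extD IHP IHQ.
- rewrite !sliceM summxE.
  have -> : \sum_g (slice a g (nceval (fun=> 0) P : 'M[C]_(1 * d)) *m
        slice g b (nceval (fun=> 0) Q : 'M[C]_(1 * d))) 0 0 =
      \sum_g slice a g (nceval (fun=> 0) P : 'M[C]_(1 * d)) 0 0 *
        slice g b (nceval (fun=> 0) Q : 'M[C]_(1 * d)) 0 0.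
    by apply: eq_bigr => g _; rewrite mxE big_ord1.
  rewrite spread_ext_sum; by apply: eq_bigr => g _; rewrite IHP IHQ spread_extM.
Qed.

End AmplifiedFamily.
End Spread.
End Amplification.

(** * Existence of the conditionally free product *)

Section Existence.
Context (R : realType) (d : nat).
Local Notation C := R[i].
Local Notation N := (@ComplexField.Normc.normc R).
Local Notation B := 'M[C]_d.
Local Notation ncpoly := (ncpoly R d).
Context (disp : measure_display) (T : measurableType disp).
Variable Pr : probability T R.

Lemma choose_constants (Q : nat -> R -> R -> Prop) :
  (forall k M, 1 <= M -> exists c, 0 <= c /\ Q k M c) ->
  exists eta : nat -> R -> R,
    (forall k M, 0 <= eta k M) /\ forall k M, 1 <= M -> Q k M (eta k M).
Proof.
move=> hQ; pose Q' (kM : nat * R) c := 0 <= c /\ (1 <= kM.2 -> Q kM.1 kM.2 c).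
have [kM|eta heta] := @boolp.choice _ _ Q'.
  have [M1|M1] := boolP (1 <= kM.2); last by exists 0; split=> // h; rewrite h in M1.
  by have [c [c0 hc]] := hQ kM.1 kM.2 M1; exists c.
exists (fun k M => eta (k, M)); split=> k M; first by have [] := heta (k, M).
by have [] := heta (k, M).
Qed.

(** Two-sided Cauchy estimates with an explicit rate give a limit with the same
    rate, the supremum of the lower barriers. *)
Lemma limit_with_rate (A : pred nat) (x delta : nat -> R) c : (exists m, A m) ->
  (forall m m', A m -> A m' -> `|x m - x m'| <= c * (delta m + delta m')) ->
  exists l, forall m, A m -> `|x m - l| <= c * delta m.
Proof.
move=> [m0 Am0] hx; pose L := [set x m - c * delta m | m in [set m | A m]].
have ub m : A m -> ubound L (x m + c * delta m).
  move=> Am _ [m' /= Am' <-]; have := hx m' m Am' Am.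
  by rewrite ler_norml => /andP[_ h]; rewrite mulrDr in h; lra.
have Lsup : has_sup L.
  by split; [exists (x m0 - c * delta m0), m0|exists (x m0 + c * delta m0); exact: ub].
exists (sup L) => m Am; rewrite ler_norml.
have h1 : x m - c * delta m <= sup L by apply: (sup_upper_bound Lsup); exists m.
have h2 : sup L <= x m + c * delta m by apply: ge_sup; [exact: Lsup.1|exact: ub].
by lra.
Qed.

Lemma limit_with_rateC (A : pred nat) (x : nat -> C) (delta : nat -> R) c : (exists m, A m) ->
  (forall m m', A m -> A m' -> N (x m - x m') <= c * (delta m + delta m')) ->
  exists l, forall m, A m -> N (x m - l) <= 2 * c * delta m.
Proof.
move=> A0 hx.
have ReB (y z : C) : complex.Re (y - z) = complex.Re y - complex.Re z by case: y z => ? ? [].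
have ImB (y z : C) : complex.Im (y - z) = complex.Im y - complex.Im z by case: y z => ? ? [].
have [lr hr] : exists l, forall m, A m -> `|complex.Re (x m) - l| <= c * delta m.
  apply: limit_with_rate A0 _ => m m' Am Am'; rewrite -ReB.
  exact: le_trans (normRe_le_normc _) (hx m m' Am Am').
have [li hi] : exists l, forall m, A m -> `|complex.Im (x m) - l| <= c * delta m.
  apply: limit_with_rate A0 _ => m m' Am Am'; rewrite -ImB.
  exact: le_trans (normIm_le_normc _) (hx m m' Am Am').
exists (lr +i* li) => m Am.
have -> : x m - (lr +i* li) = (complex.Re (x m) - lr)%:C + 'i * (complex.Im (x m) - li)%:C.
  by case: (x m) => a b; apply/eqP; rewrite eq_complex /=; apply/andP; split; apply/eqP; ring.
apply: le_trans (normcD _ _) _; rewrite ComplexField.Normc.normcM !normc_real.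
have -> : N 'i = 1 by rewrite /= expr0n add0r expr1n sqrtr1.
have := hr m Am; have := hi m Am; lra.
Qed.

Lemma opbound_coef p c (m : B) : 0 <= c -> (forall a b, N (m a b) <= c) ->
  opbound (d%:R * d%:R * c) ((1%:M : 'M[C]_p) *t m).
Proof.
move=> c0 hm; apply: opbound_slices => a b; rewrite slice_tens scalemx1.
exact: opbound_le (hm a b) (opbound_scalar _ _).
Qed.

Lemma psi_of_le (I : Type) q (X : I -> 'M[C]_(q.+1 * d)) c P :
  opbound c (nceval X P) -> forall a b, N (psi_of Pr (fun k _ => X k) P a b) <= c.
Proof.
move=> hc a b; rewrite psi_of_cst mxE sum_block_diag.
rewrite ComplexField.Normc.normcM ComplexField.Normc.normcV normc_nat mulrC.
by rewrite ler_pdivrMr ?ltr0n // mulrC; apply/opbound_trace/opbound_slice.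
Qed.

(** The average over the diagonal blocks is unital and additive. *)
Lemma psi_of_shift (I : Type) q (X : I -> 'M[C]_(q.+1 * d)) :
  shift_equivariant (psi_of Pr (fun k _ => X k)).
Proof.
move=> P m; rewrite !psi_of_cst /=.
have -> : \sum_k block (nceval X P + 1%:M *t m) k k =
    \sum_k block (nceval X P) k k + q.+1%:R *: m.
  have -> : q.+1%:R *: m = \sum_(k < q.+1) m by rewrite sumr_const card_ord scaler_nat.
  rewrite -big_split; apply: eq_bigr => k _; apply/matrixP => a b.
  by rewrite !mxE !mxtens_indexK /= eqxx mul1r.
rewrite scalerDr scalerA mulVf ?scale1r //; by rewrite pnatr_eq0.
Qed.

Lemma psi_of_centered (I : Type) q (X : I -> 'M[C]_(q.+1 * d)) P :
  psi_of Pr (fun k _ => X k) P = 0 -> forall a b, \tr (slice a b (nceval X P)) = 0.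
Proof.
rewrite psi_of_cst => /eqP; rewrite scaler_eq0 invr_eq0 pnatr_eq0 /= => /eqP h a b.
by rewrite -sum_block_diag h mxE.
Qed.

Lemma eval_size_predicate (I : Type) q (X : I -> 'M[C]_(q.+1 * d)) :
  size_predicate (psi_of Pr (fun k _ => X k)) (fun c P => opbound c (nceval X P)).
Proof.
split.
- by move=> c c' P; exact: opbound_le.
- by move=> c c' P Q; exact: opboundD.
- by move=> c c' P Q; exact: opboundM.
- by move=> c m; exact: opbound_coef.
- by move=> c P; exact: psi_of_le.
Qed.

Section FixedFunctionals.
Variables (I J : Type) (q0 : nat).
Variables (X : I -> 'M[C]_(q0.+1 * d)) (Y : J -> 'M[C]_(q0.+1 * d)).
Variables (q : nat -> nat) (V : forall m, T -> 'M[C]_(q m)).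
Hypothesis haarV : forall m, haar_unitary Pr (V m).
Hypothesis q_large : forall k, exists m0, forall m, (m0 <= m)%N -> (k <= q m)%N.

Let r m := ((q m).+1 %/ q0.+1)%N.
Let le_r m : (r m * q0.+1 <= (q m).+1)%N := leq_divM _ _.
(* [r m] is the largest number of copies that fit. *)
Let XA m := amplify (le_r m) X.
Let YA m := amplify (le_r m) Y.
Let moment m (P : ncpoly (I + J)) : B := phi_of Pr (mixed_family (XA m) (YA m) (V m)) P.
Let delta m : R := (q m).+1%:R^-1.
Let psiX := psi_of Pr (fun k (_ : T) => X k).
Let psiY := psi_of Pr (fun k (_ : T) => Y k).
Let sizeX c P := opbound c (nceval X P) /\ opbound c (value_at_0 P).
Let sizeY c P := opbound c (nceval Y P) /\ opbound c (value_at_0 P).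
Let large m := (0 < r m)%N && (0 < q m)%N.

Lemma block_amplify (K : Type) (Z : K -> 'M[C]_(q0.+1 * d)) m P : (0 < r m)%N ->
  block (nceval (amplify (le_r m) Z) P) ord0 ord0 = block (nceval Z P) ord0 ord0.
Proof.
by move=> r0; apply/matrixP => a b; rewrite !blockE slice_nceval_amplify spread_ext_00.
Qed.

Lemma opbound_amplify (K : Type) (Z : K -> 'M[C]_(q0.+1 * d)) m c P :
  opbound c (nceval Z P) -> opbound c (value_at_0 P) ->
  opbound (d%:R * d%:R * (3 * c)) (nceval (amplify (le_r m) Z) P).
Proof.
move=> h1 h2; apply: opbound_slices => a b; rewrite slice_nceval_amplify.
by apply: opbound_spread_ext; [exact: opbound_slice|apply/opbound_entry/opbound_slice].
Qed.

(** Centred polynomials are amplified to matrices with bounded traces, which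
    is why the estimates are stated for bounded rather than vanishing traces. *)
Lemma trace_amplify (K : Type) (Z : K -> 'M[C]_(q0.+1 * d)) m c P :
  opbound c (value_at_0 P) -> psi_of Pr (fun k _ => Z k) P = 0 ->
  forall a b, N (\tr (slice a b (nceval (amplify (le_r m) Z) P))) <= q0.+1%:R * c.
Proof.
move=> h2 /psi_of_centered tr0 a b; rewrite slice_nceval_amplify.
have lt_r : ((q m).+1 < r m * q0.+1 + q0.+1)%N.
  by rewrite {1}(divn_eq (q m).+1 q0.+1) ltn_add2l ltn_pmod.
apply: le_trans (trace_spread_ext (le_r m) _ (tr0 a b) lt_r) _.
by apply: ler_wpM2l => //; apply/opbound_entry/opbound_slice.
Qed.

Lemma amplified_estimate k (M : R) : 1 <= M -> exists c, 0 <= c /\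
  forall m, large m -> forall s : seq (Defs.factor R d I J),
    Defs.alternating s -> List.Forall (centered psiX psiY) s ->
    List.Forall (factor_size sizeX sizeY M) s -> (size s <= k)%N ->
  forall a b, N ((moment m (ncprod s) -
     \prod_(F <- s) block (factor_val X Y F) ord0 ord0) a b) <= c * delta m.
Proof.
move=> M1; pose M' : R := d%:R * d%:R * (3 * M) + q0.+1%:R * M.
have M0 : 0 <= M by exact: le_trans M1.
have q1 : 1 <= q0.+1%:R :> R by rewrite ler1n.
have dM : 0 <= d%:R * d%:R * (3 * M) by rewrite !mulr_ge0.
have M'1 : 1 <= M' by rewrite /M'; nra.
have [c [c0 hc]] := mixed_moment_estimate d Pr I J k M'1.
exists c; split=> // m /andP[r0 qm0] s alt cs hs sk a b.
have -> : \prod_(F <- s) block (factor_val X Y F) ord0 ord0 =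
    \prod_(F <- s) block (factor_val (XA m) (YA m) F) ord0 ord0.
  by apply: eq_bigr => [[P|Q]] _ /=; rewrite block_amplify.
apply: hc => // {alt sk}; elim: s cs hs => [|F s IH] //.
move=> /Forall_cons [cF cs] /Forall_cons [hF hs]; apply/Forall_cons; split; last exact: IH.
case: F cF hF => P /= cF [h1 h2]; (split=> [|a' b'];
  [apply: opbound_le (opbound_amplify m h1 h2)|apply: le_trans (trace_amplify m h2 cF a' b') _]).
all: by rewrite /M' ?lerDl ?lerDr // mulr_ge0.
Qed.

Let moment_bimodule m : bimodule_map (moment m).
Proof. by apply: phi_of_bimodule => x; exact: (bounded_mixed_family _ _ (haarV m)). Qed.

Lemma factor_size_exists (s : seq (Defs.factor R d I J)) :
  exists M, 1 <= M /\ List.Forall (factor_size sizeX sizeY M) s.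
Proof.
elim: s => [|F s [M [M1 hs]]]; first by exists 1; split=> //; constructor.
have [c hF] : exists c, factor_size sizeX sizeY c F.
  case: F => P.
    have [c1 h1] := opbound_exists (nceval X P); have [c2 h2] := opbound_exists (value_at_0 P).
    by exists (Num.max c1 c2); split; [apply: opbound_le h1|apply: opbound_le h2]; rewrite le_max lexx ?orbT.
  have [c1 h1] := opbound_exists (nceval Y P); have [c2 h2] := opbound_exists (value_at_0 P).
  by exists (Num.max c1 c2); split; [apply: opbound_le h1|apply: opbound_le h2]; rewrite le_max lexx ?orbT.
exists (Num.max c M); split; first by rewrite le_max M1 orbT.
have z1 := size_predicateI (eval_size_predicate X) (eval_size_predicate (fun=> 0 : 'M[C]_(1 * d))).
have z2 := size_predicateI (eval_size_predicate Y) (eval_size_predicate (fun=> 0 : 'M[C]_(1 * d))).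
apply/Forall_cons; split.
  by apply: (factor_size_le z1 z2) hF; rewrite le_max lexx.
by apply: (Forall_size_le z1 z2) hs; rewrite le_max lexx orbT.
Qed.

(** The difference of two mixed moment functionals is a bimodule map which is
    small on alternating centred words, since both are close to the same product
    of corners; by reduction it is small everywhere. *)
Lemma moment_cauchy P : exists c, 0 <= c /\ forall m m', large m -> large m' ->
  forall a b, N ((moment m P - moment m' P) a b) <= c * (delta m + delta m').
Proof.
have [eta [eta0 heta]] := choose_constants amplified_estimate.
have delta0 m : 0 <= delta m by rewrite invr_ge0.
have z1 := size_predicateI (eval_size_predicate X) (eval_size_predicate (fun=> 0 : 'M[C]_(1 * d))).
have z2 := size_predicateI (eval_size_predicate Y) (eval_size_predicate (fun=> 0 : 'M[C]_(1 * d))).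
have data m m' : large m -> large m' ->
    reducible_data eta psiX psiY sizeX sizeY
      (fun P => moment m P - moment m' P) (delta m + delta m').
  move=> lm lm'; split; first by split.
  split; first by split; exact: psi_of_shift.
  split; first by rewrite addr_ge0.
  have [e1 a1 b1] := moment_bimodule m; have [e2 a2 b2] := moment_bimodule m'.
  split.
    split=> [P1 Q1 PQ|P1 Q1|m1 n1 P1]; first by rewrite (e1 _ _ PQ) (e2 _ _ PQ).
      by rewrite a1 a2 opprD addrACA.
    by rewrite b1 b2 mulmxBr mulmxBl.
  move=> k M s M1 alt cs hs sk a b.
  have h1 := heta k M M1 m lm s alt cs hs sk a b.
  have h2 := heta k M M1 m' lm' s alt cs hs sk a b.
  set Z := \prod_(F <- s) _ in h1 h2.
  have -> : (moment m (ncprod s) - moment m' (ncprod s)) a b =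
     (moment m (ncprod s) - Z) a b - (moment m' (ncprod s) - Z) a b.
    rewrite !mxE; ring.
  by apply: le_trans (normcB _ _) _; rewrite mulrDr lerD.
move: P; apply: ncpoly_word_ind.
- move=> P Q PQ [c [c0 hc]]; exists c; split=> // m m' lm lm' a b.
  have [e1 _ _] := moment_bimodule m; have [e2 _ _] := moment_bimodule m'.
  by rewrite -(e1 _ _ PQ) -(e2 _ _ PQ); exact: hc.
- move=> P Q [c [c0 hc]] [c' [c'0 hc']]; exists (c + c'); split; first exact: addr_ge0.
  move=> m m' lm lm' a b; have [_ a1 _] := moment_bimodule m; have [_ a2 _] := moment_bimodule m'.
  rewrite a1 a2 opprD addrACA mxE mulrDl; apply: le_trans (normcD _ _) _.
  by apply: lerD; [exact: hc|exact: hc'].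
- move=> s; have [M [M1 hs]] := factor_size_exists s.
  have [c [c0 hc]] := word_bound_exists d I J eta0 (size s) M1.
  by exists c; split=> // m m' lm lm'; exact: (hc _ _ _ _ _ _ (data m m' lm lm') s).
Qed.

Let limit_of P (A : B) : Prop := exists c, 0 <= c /\ forall m, large m ->
  forall a b, N ((moment m P - A) a b) <= c * delta m.

(* Along the large indices [delta] tends to zero, so limits are unique. *)
Let large_unbounded k : exists m, large m /\ (k <= q m)%N.
Proof.
have [m0 hm0] := q_large (k + q0.+1); exists m0; have := hm0 m0 (leqnn _) => h.
split; last by lia.
by apply/andP; split; [rewrite divn_gt0 //; lia|lia].
Qed.

Let limit_exists P : exists A, limit_of P A.
Proof.
have [c [c0 hc]] := moment_cauchy P.
have [m1 [lm1 _]] := large_unbounded 0.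
have ex a b : exists l, forall m, large m -> N (moment m P a b - l) <= 2 * c * delta m.
  apply: limit_with_rateC; first by exists m1.
  by move=> m m' lm lm'; have := hc m m' lm lm' a b; rewrite !mxE.
have [l hl] : exists l : 'I_d * 'I_d -> C, forall ab, forall m, large m ->
    N (moment m P ab.1 ab.2 - l ab) <= 2 * c * delta m.
  by have [l hl] := boolp.choice (fun ab : 'I_d * 'I_d => ex ab.1 ab.2); exists l.
exists (\matrix_(a, b) l (a, b)), (2 * c); split; first by rewrite mulr_ge0.
move=> m lm a b; have -> : (moment m P - \matrix_(a, b) l (a, b)) a b = moment m P a b - l (a, b).
  by rewrite mxE; congr (_ + _); rewrite !mxE.
exact: (hl (a, b) m lm).
Qed.

Let limit_unique P A A' : limit_of P A -> limit_of P A' -> A = A'.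
Proof.
move=> [c [c0 hc]] [c' [c'0 hc']]; apply/matrixP => a b; apply/eqP; rewrite -subr_eq0 -normc_eq0.
set x := N _; have x0 : 0 <= x by exact: normc_ge0.
have hx m : large m -> x <= (c + c') * delta m.
  move=> lm; rewrite mulrDl addrC /x.
  have -> : A a b - A' a b = (moment m P - A') a b - (moment m P - A) a b.
    by rewrite !mxE; move: (moment m P a b) => z; ring.
  by apply: le_trans (normcB _ _) _; apply: lerD; [exact: hc'|exact: hc].
rewrite eq_le x0 andbT leNgt; apply/negP => xp.
have [m [lm hm]] := large_unbounded (Num.truncn ((c + c') / x)).
have := hx m lm; rewrite /delta ler_pdivlMr ?ltr0n // => h.
have : (c + c') / x < (q m).+1%:R.
  apply: lt_le_trans (truncnS_gt _) _; by rewrite ler_nat ltnS.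
by rewrite ltr_pdivrMr // mulrC => h'; have := le_lt_trans h h'; rewrite ltxx.
Qed.

(** The conditionally free product is the limit of the mixed moments of
    amplifications of the two families to larger and larger size: the estimates
    on alternating centred words show at the same time that the limit exists
    and that it factorises on such words. *)
Lemma cfree_product_exists : exists f,
  is_cfree_product (phi_of Pr (fun k (_ : T) => X k)) psiX psiY (phi_of Pr (fun k (_ : T) => Y k)) f.
Proof.
have [f hf] : exists f : ncpoly (I + J) -> B, forall P, limit_of P (f P).
  by have [f hf] := boolp.choice limit_exists; exists f.
have delta0 m : 0 <= delta m by rewrite invr_ge0.
have femb F : f (embed F) = block (factor_val X Y F) ord0 ord0.
  apply: limit_unique (hf _) _; exists 0; split=> // m lm a b.
  have /andP[r0 _] := lm.
  have -> : moment m (embed F) = block (factor_val X Y F) ord0 ord0.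
    by rewrite /moment (phi_of_embed _ _ (haarV m)); case: F => P /=; exact: block_amplify.
  by rewrite subrr mxE ComplexField.Normc.normc0 mul0r.
exists f; split.
- split=> [P Q PQ|P Q|m1 n1 P].
  + apply: limit_unique (hf P) _; have [c [c0 hc]] := hf Q; exists c; split=> // m lm a b.
    by have [e _ _] := moment_bimodule m; rewrite (e _ _ PQ); exact: hc.
  + apply: limit_unique (hf _) _; have [c [c0 hc]] := hf P; have [c' [c'0 hc']] := hf Q.
    exists (c + c'); split=> [|m lm a b]; first exact: addr_ge0.
    have [_ e _] := moment_bimodule m; rewrite e opprD addrACA mxE mulrDl.
    by apply: le_trans (normcD _ _) _; apply: lerD; [exact: hc|exact: hc'].
  + apply: limit_unique (hf _) _; have [c [c0 hc]] := hf P.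
    have [k1 h1] := opbound_exists m1; have [k2 h2] := opbound_exists n1.
    have k10 := opbound_ge0 h1; have k20 := opbound_ge0 h2.
    exists (d%:R * (d%:R * (k1 * c) * k2)); split; first by rewrite !mulr_ge0.
    move=> m lm a b; have [_ _ e] := moment_bimodule m.
    rewrite e -mulmxBl -mulmxBr mxE; apply: le_trans (normc_sum _ _ _) _.
    have -> : d%:R * (d%:R * (k1 * c) * k2) * delta m =
        \sum_(g < d) (\sum_(h < d) k1 * (c * delta m)) * k2.
      by rewrite !sumr_const !card_ord -[_ *+ d]mulr_natl -[k1 * _ *+ d]mulr_natl; ring.
    apply: ler_sum => g _; rewrite ComplexField.Normc.normcM.
    apply: ler_pM; rewrite ?normc_ge0 //; last exact: opbound_entry.
    rewrite mxE; apply: le_trans (normc_sum _ _ _) _; apply: ler_sum => h _.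
    rewrite ComplexField.Normc.normcM; apply: ler_pM; rewrite ?normc_ge0 //; last exact: hc.
    exact: opbound_entry.
- by move=> P; rewrite phi_of_cst; exact: (femb (inl P)).
- by move=> P; rewrite phi_of_cst; exact: (femb (inr P)).
- move=> s alt cs.
  have -> : \prod_(F <- s) f (embed F) = \prod_(F <- s) block (factor_val X Y F) ord0 ord0.
    by apply: eq_bigr => F _; rewrite femb.
  have [M [M1 hs]] := factor_size_exists s.
  have [c [c0 hc]] := amplified_estimate (size s) M1.
  apply: limit_unique (hf _) _; exists c; split=> // m lm; exact: hc.
Qed.

End FixedFunctionals.
End Existence.

(** * Rate of convergence of the mixed moments *)

Section RealisedEnsembles.
Context (R : realType) (d : nat).
Local Notation C := R[i].

Lemma l2normE n (x : 'cV[C]_n) : l2norm x = Num.sqrt (norm2 x).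
Proof. by []. Qed.

(** The supremum in [opnorm] bounds the values it ranges over only because some
    operator bound exists; rescaling reaches all vectors. *)
Lemma opbound_opnorm n c (M : 'M[C]_n) : opnorm M <= c -> opbound c M.
Proof.
move=> hc; have [k [k0 hk]] := opbound_exists M.
pose A := [set l2norm (M *m x) | x in [set x : 'cV[C]_n | l2norm x <= 1]].
have ubA : ubound A k.
  move=> _ [x /= hx <-]; rewrite l2normE -(@ger0_norm _ k) // -sqrtr_sqr.
  apply: ler_wsqrtr; apply: le_trans (hk x) _.
  rewrite -[leRHS]mulr1; apply: ler_wpM2l; first exact: sqr_ge0.
  by rewrite -(sqr_sqrtr (norm2_ge0 x)) -l2normE expr_le1 // sqrtr_ge0.
have Asup : has_sup A.
  split; last by exists k.
  exists (l2norm (M *m 0)); exists 0 => //=.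
  by rewrite l2normE /norm2 big1 ?sqrtr0 // => i _; rewrite mxE ComplexField.Normc.normc0 expr0n.
have hA x : l2norm x <= 1 -> l2norm (M *m x) <= c.
  by move=> hx; apply: le_trans hc; apply: (sup_upper_bound Asup); exists x.
have c0 : 0 <= c.
  apply: le_trans (hA 0 _); first exact: sqrtr_ge0.
  by rewrite l2normE /norm2 big1 ?sqrtr0 // => i _; rewrite mxE ComplexField.Normc.normc0 expr0n.
split=> // x.
have [x0|xn0] := eqVneq (norm2 x) 0.
  by apply: le_trans (hk x) _; rewrite x0 !mulr0.
pose t := Num.sqrt (norm2 x).
have tp : 0 < t by rewrite sqrtr_gt0 lt_def xn0 norm2_ge0.
have n2Z (a : R) (y : 'cV[C]_n) : norm2 (a%:C *: y) = a ^+ 2 * norm2 y.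
  rewrite /norm2 mulr_sumr; apply: eq_bigr => i _.
  by rewrite mxE ComplexField.Normc.normcM exprMn normc_real real_normK // num_real.
have e : norm2 x = t ^+ 2 by rewrite sqr_sqrtr // norm2_ge0.
have := hA ((t^-1)%:C *: x); rewrite -scalemxAr !l2normE !n2Z e -exprMn mulVf ?gt_eqF //.
rewrite expr1n sqrtr1 => /(_ (lexx _)).
rewrite -(@ler_pXn2r _ 2) ?nnegrE ?sqrtr_ge0 // sqr_sqrtr; last by rewrite mulr_ge0 ?sqr_ge0 ?norm2_ge0.
by rewrite exprVn mulrC ler_pdivrMr // exprn_gt0.
Qed.

(** The matrix of the change of basis is unitary. *)
Lemma opbound_identify p c (v : 'I_p -> 'I_d -> 'cV[C]_(p * d)) (M : 'M[C]_(p * d)) :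
  orthonormal_bases v -> opbound c M -> opbound c (identify v M).
Proof.
move=> hv hM; pose W : 'M[C]_(p * d) :=
  \matrix_(s, t) v (mxtens_unindex t).1 (mxtens_unindex t).2 s 0.
have colW t : col t W = v (mxtens_unindex t).1 (mxtens_unindex t).2.
  by apply/matrixP => s o; rewrite !mxE ord1.
have gram (M' : 'M[C]_(p * d)) s t :
    (W^t* *m M' *m W) s t = ((col s W)^t* *m M' *m col t W) 0 0.
  by rewrite !mxE; apply: eq_bigr => h _; rewrite !mxE; congr (_ * _);
     apply: eq_bigr => k _; rewrite !mxE.
have eW : identify v M = W^t* *m M *m W.
  by apply/matrixP => s t; rewrite gram mxE !colW.
have isoW : W^t* *m W = 1%:M.
  apply/matrixP => s t; rewrite -[W^t*]mulmx1 gram mulmx1 !colW hv mxE.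
  case: (mxtens_indexP s) => i a; case: (mxtens_indexP t) => j b.
  by rewrite !mxtens_indexK /= (inj_eq (can_inj (@mxtens_indexK _ _))) -pair_eqE.
rewrite eW -[c]mulr1 -[c]mul1r; apply: opboundM; last exact: opbound_isometry.
by apply: opboundM => //; apply/opbound_adj/opbound_isometry.
Qed.

Lemma opbound_nceval_uniform (K : Type) (p : nat -> nat)
    (X : forall n, K -> 'M[C]_(p n * d)) (c : K -> R) P :
  (forall n k, opbound (c k) (X n k)) -> exists M, forall n, opbound M (nceval (X n) P).
Proof.
move=> hX; elim: P => [m|x|P [c1 h1] Q [c2 h2]|P [c1 h1] Q [c2 h2]] /=.
- have [k hk] := opbound_exists m; exists k => n; exact: opbound_tens1.
- by exists (c x) => n; exact: hX.
- by exists (c1 + c2) => n; exact: opboundD.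
- by exists (c1 * c2) => n; exact: opboundM.
Qed.

End RealisedEnsembles.

Section Convergence.
Context (R : realType) (d : nat).
Local Notation C := R[i].
Local Notation N := (@ComplexField.Normc.normc R).
Local Notation B := 'M[C]_d.
Local Notation ncpoly := (ncpoly R d).
Context (disp : measure_display) (T : measurableType disp).
Variable Pr : probability T R.
Variables (I J : Type) (q : nat -> nat) (V : forall n, T -> 'M[C]_(q n)).
Hypothesis haarV : forall n, haar_unitary Pr (V n).
Hypothesis q_large : forall k, exists m0, forall m, (m0 <= m)%N -> (k <= q m)%N.
Variables (X : forall n, I -> 'M[C]_((q n).+1 * d)) (Y : forall n, J -> 'M[C]_((q n).+1 * d)).
Variables (cX : I -> R) (cY : J -> R).
Hypothesis X_bounded : forall n k, opbound (cX k) (X n k).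
Hypothesis Y_bounded : forall n k, opbound (cY k) (Y n k).

Let psiX n := psi_of Pr (fun k (_ : T) => X n k).
Let psiY n := psi_of Pr (fun k (_ : T) => Y n k).
Let moment n (P : ncpoly (I + J)) : B := phi_of Pr (mixed_family (X n) (Y n) (V n)) P.
Let free n : ncpoly (I + J) -> B :=
  cfree_product (phi_of Pr (fun k (_ : T) => X n k)) (psiX n) (psiY n)
    (phi_of Pr (fun k (_ : T) => Y n k)).
Let delta n : R := (q n).+1%:R^-1.
Let sizeX n c P := opbound c (nceval (X n) P).
Let sizeY n c P := opbound c (nceval (Y n) P).

Let freeP n : is_cfree_product (phi_of Pr (fun k (_ : T) => X n k)) (psiX n) (psiY n)
  (phi_of Pr (fun k (_ : T) => Y n k)) (free n).
Proof.
have [f hf] := cfree_product_exists (X n) (Y n) haarV q_large.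
by have := xgetI (fun=> 0) (hf : [set f | is_cfree_product _ _ _ _ f] f).
Qed.

Let free_embed n (F : Defs.factor R d I J) :
  free n (embed F) = block (factor_val (X n) (Y n) F) ord0 ord0.
Proof.
by have [_ fX fY _] := freeP n; case: F => P /=; rewrite ?fX ?fY phi_of_cst.
Qed.

Let centered_estimate k (M : R) : 1 <= M -> exists c, 0 <= c /\
  forall n, (0 < q n)%N -> forall s : seq (Defs.factor R d I J),
    Defs.alternating s -> List.Forall (centered (psiX n) (psiY n)) s ->
    List.Forall (factor_size (sizeX n) (sizeY n) M) s -> (size s <= k)%N ->
  forall a b, N ((moment n (ncprod s) - free n (ncprod s)) a b) <= c * delta n.
Proof.
move=> M1; have [c [c0 hc]] := mixed_moment_estimate d Pr I J k M1.
have M0 : 0 <= M by exact: le_trans M1.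
exists c; split=> // n qn0 s alt cs hs sk a b.
have [_ _ _ ->] := freeP n => //; under eq_bigr do rewrite free_embed.
apply: hc => // {alt sk}; elim: s cs hs => [|F s IH] //.
move=> /Forall_cons [cF cs] /Forall_cons [hF hs]; apply/Forall_cons; split; last exact: IH.
by case: F cF hF => P /= cF h1; split=> // a' b';
  rewrite (psi_of_centered cF) ComplexField.Normc.normc0.
Qed.

(** The difference of the mixed moments and of the conditionally free product is
    a bimodule map; on alternating centred words both are close to the product of
    the corners of the factors, the second one by its very definition. *)
Lemma mixed_moment_rate P : exists c, 0 <= c /\ forall n, (0 < q n)%N ->
  forall a b, N ((moment n P - free n P) a b) <= c * delta n.
Proof.
have [eta [eta0 heta]] := choose_constants centered_estimate.
have delta0 n : 0 <= delta n by rewrite invr_ge0.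
have bimod n : bimodule_map (fun P => moment n P - free n P).
  have [e1 a1 b1] : bimodule_map (moment n).
    by apply: phi_of_bimodule => x; exact: (bounded_mixed_family _ _ (haarV n)).
  have [[e2 a2 b2] _ _ _] := freeP n.
  split=> [P1 Q1 PQ|P1 Q1|m1 n1 P1]; first by rewrite (e1 _ _ PQ) (e2 _ _ PQ).
    by rewrite a1 a2 opprD addrACA.
  by rewrite b1 b2 mulmxBr mulmxBl.
move: P; apply: ncpoly_word_ind.
- move=> P Q PQ [c [c0 hc]]; exists c; split=> // n qn0 a b.
  by have [e _ _] := bimod n; rewrite -(e _ _ PQ); exact: hc.
- move=> P Q [c [c0 hc]] [c' [c'0 hc']]; exists (c + c'); split; first exact: addr_ge0.
  move=> n qn0 a b; have [_ e _] := bimod n.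
  rewrite e mxE mulrDl; apply: le_trans (normcD _ _) _.
  by apply: lerD; [exact: hc|exact: hc'].
- move=> s.
  have [M [M1 hs]] : exists M, 1 <= M /\
      forall n, List.Forall (factor_size (sizeX n) (sizeY n) M) s.
    elim: s => [|F s [M [M1 hs]]]; first by exists 1; split=> // n; constructor.
    have [c hF] : exists c, forall n, factor_size (sizeX n) (sizeY n) c F.
      case: F => P.
        by have [c hP] := opbound_nceval_uniform P X_bounded; exists c.
      by have [c hP] := opbound_nceval_uniform P Y_bounded; exists c.
    exists (Num.max c M); split=> [|n]; first by rewrite le_max M1 orbT.
    have z1 := eval_size_predicate Pr (X n); have z2 := eval_size_predicate Pr (Y n).
    apply/Forall_cons; split.
      by apply: (factor_size_le z1 z2) (hF n); rewrite le_max lexx.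
    by apply: (Forall_size_le z1 z2) (hs n); rewrite le_max lexx orbT.
  have [c [c0 hc]] := word_bound_exists d I J eta0 (size s) M1.
  exists c; split=> // n qn0; apply: (hc (psiX n) (psiY n) (sizeX n) (sizeY n)
      (fun P => moment n P - free n P) (delta n) _ s) => //.
  split; first by split; exact: eval_size_predicate.
  split; first by split; exact: psi_of_shift.
  split; first exact: delta0.
  by split; [exact: bimod|move=> k M2 s' M21 alt cs hs' sk; exact: heta].
Qed.

End Convergence.

(* Dimension p_N = (q n).+1 and size N = d p_N, along the sequence n -> oo.
   The expectations in phi and psi are taken over the Haar unitary (sample w'),
   the realisation w of the ensembles being frozen: U_N being independent of
   (A_N, B_N), this is the conditional expectation given (A_N, B_N), and
   "almost surely" refers to w. *)
Theorem proposition5p2p1 (R : realType) (d : nat) (d_gt0 : (0 < d)%N)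
    (K : Type) (disp : measure_display) (T : measurableType disp)
    (Pr : probability T R) (q : nat -> nat)
    (v : forall n, 'I_(q n).+1 -> 'I_d -> 'cV[R[i]]_((q n).+1 * d))
    (A B : forall n, K -> T -> 'M[R[i]]_((q n).+1 * d))
    (V : forall n, T -> 'M[R[i]]_(q n)) :
  q @ \oo --> \oo ->
  (forall n, orthonormal_bases (v n)) ->
  (forall n k, random_matrix (A n k)) ->
  (forall n k, random_matrix (B n k)) ->
  bounded_ensemble Pr A ->
  bounded_ensemble Pr B ->
  (forall n, haar_unitary Pr (V n)) ->
  (forall n, independent3 Pr (sigma_entries (A n)) (sigma_entries (B n))
                             (sigma_entries (fun _ : unit => V n))) ->
  {ae Pr, forall w, forall P : ncpoly R d (K + K),
    let a n k := identify (v n) (A n k w) in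
    let b n k := identify (v n) (B n k w) in
    let lhs n :=
      phi_of Pr (sum_family
        (fun k _ => a n k)
        (fun k w' => act (fix_first (V n w')) (b n k))) P in
    let rhs n :=
      cfree_product
        (phi_of Pr (fun k _ => a n k)) (psi_of Pr (fun k _ => a n k))
        (psi_of Pr (fun k _ => b n k)) (phi_of Pr (fun k _ => b n k)) P in
    forall i j : 'I_d,
      (fun n => ComplexField.Normc.normc (lhs n i j - rhs n i j)) =O_\oo
      (fun n => (q n).+1%:R^-1 : R)}.
Proof.
move=> q_oo hv _ _ [cA hA] [cB hB] haarV _.
have q_large k : exists m0, forall m, (m0 <= m)%N -> (k <= q m)%N.
  have /cvgnyPge/(_ k) [m0 _ hm0] := q_oo.
  by exists m0 => m lm; exact: hm0.
(* The samples [w] at which both ensembles are bounded; from here on [w] is fixed. *)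
apply: filterS2 hA hB => w hA hB P /= i j.
have [c [c0 hc]] := mixed_moment_rate haarV q_large
  (fun n k => opbound_identify (hv n) (opbound_opnorm (hA n k)))
  (fun n k => opbound_identify (hv n) (opbound_opnorm (hB n k))) P.
have [m0 hm0] := q_large 1.
apply/eqOP; exists c; split=> [|k ck]; first exact: num_real.
exists m0 => // n /= ln.
have subE (x y : 'M[R[i]]_d) : (x - y) i j = x i j - y i j by rewrite !mxE.
have := hc n (hm0 n ln) i j; rewrite subE => h.
rewrite ger0_norm ?normc_ge0 // ger0_norm ?invr_ge0 //.
apply: le_trans h _; apply: ler_wpM2r; first by rewrite invr_ge0.
exact: ltW.
Qed.
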